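(* Let $\{G^i\}_{i\ge0}$ be a family of finite simple graphs. For each $i$, let $\mathcal{C}^i$ be a vertex cover of $G^i$. Suppose that, for all $i\ge0$, (1) $V(G^0)$ is nonempty; (2) $D(G^0,\mathcal{C}^0)$ has no oriented cycles; (3) $V(G^i)\cup\{z_{i+1}\}\subseteq V(G^{i+1})$, where $z_{i+1}\notin V(G^i)$ is a new vertex; (4) $\mathcal{C}^i\subseteq\mathcal{C}^{i+1}$; (5) $E(G^{i+1})=E(G^i)\cup\{z_{i+1}x: x\in\mathcal{C}^i\}$. Let $\mathbb{K}^0$ be the Koszul complex on the vertex cover $\mathcal{C}^0$. If the minimal free resolution $\mathbb{G}^0$ of $Q/I(G^0)$ is a strictly commutative dg algebra and the map $\tau^0:\mathbb{G}^0\to\mathbb{K}^0$ (described in the context) lifting the surjection $Q/I(G^0)\to Q/\langle x\mid x\in\mathcal{C}^0\rangle$ is a dg morphism, then the minimal free resolution $\mathbb{G}^i$ of $Q/I(G^i)$ is a strictly commutative dg algebra (i.e. admits such a structure) for all $i\ge0$.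
   Context: $\Bbbk$ is a field; vertices of a graph are regarded as variables, $Q$ denotes a polynomial ring over $\Bbbk$ whose variables include the vertices of the graph under consideration, an edge $\{a,b\}$ is identified with the monomial $ab$, and $I(G)\subseteq Q$ is the ideal generated by the edges of $G$. A dg $Q$-algebra is a nonnegatively graded associative unital $Q$-algebra with degree-$0$ part $Q$ and a degree $-1$ differential satisfying $\partial(ab)=\partial(a)b+(-1)^{|a|}a\partial(b)$; it is strictly commutative if $ab=(-1)^{|a||b|}ba$ for homogeneous $a,b$ and $a^2=0$ for $|a|$ odd. A dg morphism is a chain map that is a homomorphism of graded algebras. A dg ideal is a graded ideal closed under the differential. Fix for $G=G^0$, $\mathcal{C}=\mathcal{C}^0$ a cover map, i.e. a map $\mathfrak{X}:E(G)\to V(G)$ with $\mathfrak{X}(w)\in\mathcal{C}$ an endpoint of $w$ for all edges $w$, and let $\Upsilon(w)=w/\mathfrak{X}(w)$ be the other endpoint. For $W\subseteq E(G)$ put $x_W=\operatorname{lcm}\{\mathfrak{X}(w):w\in W\}$, $y_W=\operatorname{lcm}\{\Upsilon(w):w\in W\}$, $d_W=\gcd\{x_W,y_W\}$. $D(G,\mathcal{C})$ is the directed graph on $V(G)$ with a directed edge $(a,b)$ exactly when $\{a,b\}\in E(G)$ and $b=\mathfrak{X}(\{a,b\})$. Fix total orders on $\mathcal{C}$ and $E(G)$ such that $\mathfrak{X}(w)<\mathfrak{X}(w')$ implies $w<w'$. The Taylor resolution on a totally ordered set of monomials is the complex of free $Q$-modules with basis $g_U$ in degree $|U|$, $U$ ranging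 over subsets, with $\partial(g_U)=\sum_{u\in U}(-1)^{\sigma(u,U)}\frac{\operatorname{lcm}U}{\operatorname{lcm}(U\smallsetminus\{u\})}g_{U\smallsetminus\{u\}}$, $\sigma(u,U)=|\{v\in U:v<u\}|$; it is a strictly commutative dg algebra with $g_Ug_W=(-1)^{\sigma(U,W)}\frac{\operatorname{lcm}U\operatorname{lcm}W}{\operatorname{lcm}(U\cup W)}g_{U\cup W}$ if $U\cap W=\emptyset$ and $0$ otherwise, $\sigma(U,W)=|\{(v,w)\in U\times W:v>w\}|$. Let $\mathbb{T}$ be the Taylor resolution on $E(G^0)$; $\mathbb{K}^0$ is the Koszul complex on the variables in $\mathcal{C}^0$, with basis $e_W$, $W\subseteq\mathcal{C}^0$ (the Taylor resolution on $\mathcal{C}^0$). When $\mathbb{G}^0$ is a dg algebra it is identified, as a dg algebra, with $\mathbb{T}/\mathbb{J}$ for a dg ideal $\mathbb{J}$ (by a theorem of Katthän), and one chooses a $Q$-basis of $\mathbb{G}^0$ consisting of images of certain $g_W$, again denoted $g_W$. The map $\tau^0$ is given on basis elements by $\tau^0(1)=1$ and $\tau^0(g_W)=\frac{y_W}{d_W}e_{W'}$, where $e_{W'}=e_{\mathfrak{X}(W)}$ if $|\mathfrak{X}(W)|=|W|$ and $e_{W'}=0$ otherwise. *)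

(* Defs.v *)
From mathcomp Require Import all_boot all_order all_algebra.
From mathcomp Require Import finmap.
From mathcomp Require Import mpoly.

Set Implicit Arguments.
Unset Strict Implicit.
Unset Printing Implicit Defensive.

Import GRing.Theory.
Local Open Scope ring_scope.

Definition strict_total_order (T : eqType) (lt : rel T) : Prop :=
  [/\ irreflexive lt, transitive lt & forall x y, x != y -> lt x y || lt y x].

(* The vertices are drawn from an ambient type V; an edge is a 2-element set. *)
Record sgraph (V : choiceType) := SGraph {
  vertices : {fset V};
  edges : {fset {fset V}};
  edges_wf : forall e, e \in edges ->
               (e `<=` vertices)%fset && (#|` e| == 2)%N
}.

Definition vertex_cover (V : choiceType) (G : sgraph V) (C : {fset V}) : Prop :=
  (C `<=` vertices G)%fset /\
  forall e, e \in edges G -> exists2 v, v \in C & v \in e.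

(* That the values of chi lie in C is built into its type.                   *)
Definition cover_map (V : choiceType) (G : sgraph V) (C : {fset V})
    (chi : edges G -> C) : Prop :=
  forall w, val (chi w) \in val w.

Definition cover_digraph (V : choiceType) (G : sgraph V) (C : {fset V})
    (chi : edges G -> C) : rel V :=
  fun a b => [exists w : edges G,
    (val w == [fset a; b]%fset) && (b == val (chi w))].

Definition acyclic_digraph (V : choiceType) (D : rel V) : Prop :=
  forall c : seq V, cycle D c -> c = [::].

Section Complexes.
Variables (k : fieldType) (n : nat).

Local Notation Q := {mpoly k[n]}.

Definition ideal_gen (s : seq Q) (p : Q) : Prop :=
  exists a : nat -> Q, p = \sum_(i < size s) a i * s`_i.

Definition irrelevant_ideal : Q -> Prop := ideal_gen [seq 'X_i | i : 'I_n].

Definition mgcd (m1 m2 : 'X_{1..n}) : 'X_{1..n} :=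
  [multinom minn (m1 i) (m2 i) | i < n].

Definition mlcm_set (E : finType) (mon : E -> 'X_{1..n}) (W : {set E}) :
    'X_{1..n} :=
  \big[@mlcm n/0%MM]_(w in W) mon w.

(* Finitely generated free Q-modules with a basis that is homogeneous for    *)
(* the homological degree and for the N^n-grading, and a Q-linear            *)
(* endomorphism given by its values on the basis.                            *)
Record free_complex := FreeComplex {
  fbasis : finType;
  hdeg : fbasis -> nat;
  mdg : fbasis -> 'X_{1..n};
  diff_basis : fbasis -> {ffun fbasis -> Q^o}
}.

Definition carrier (F : free_complex) := {ffun fbasis F -> Q^o}.

Definition bvec (F : free_complex) (b : fbasis F) : carrier F :=
  [ffun b' => (b' == b)%:R].

Definition lin_ext (F F' : free_complex) (f : fbasis F -> carrier F')
    (x : carrier F) : carrier F' :=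
  \sum_(b : fbasis F) (x b : Q) *: f b.

Definition differential (F : free_complex) : carrier F -> carrier F :=
  @lin_ext F F (@diff_basis F).

Definition homogeneous (F : free_complex) (p : nat) (x : carrier F) : Prop :=
  forall b, x b != 0 -> hdeg b = p.

Definition hcomponent (F : free_complex) (p : nat) (x : carrier F) :
    carrier F :=
  [ffun b => if hdeg b == p then x b else 0].

Definition chain_complex (F : free_complex) : Prop :=
  (forall b b', @diff_basis F b b' != 0 -> hdeg b = (hdeg b').+1) /\
  (forall x : carrier F, differential (differential x) = 0).

(* Homogeneity of the differential for the N^n-grading. *)
Definition multigraded (F : free_complex) : Prop :=
  forall (b b' : fbasis F) m,
    m \in msupp (diff_basis b b' : Q) -> (m + mdg b')%MM = mdg b.

(* aug represents the augmentation F_0 -> Q / I: since F_0 is free the       *)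
(* augmentation lifts to Q, and it is surjective as soon as it hits 1 mod I. *)
Definition free_resolution (F : free_complex) (I : Q -> Prop) : Prop :=
  [/\ chain_complex F,
      multigraded F,
      (forall p (x : carrier F), homogeneous p.+1 x -> differential x = 0 ->
         exists y : carrier F, homogeneous p.+2 y /\ differential y = x) &
      exists aug : {linear carrier F -> Q^o},
        [/\ forall (b : fbasis F) m, hdeg b = 0 ->
              m \in msupp (aug (bvec b) : Q) -> m = mdg b,
            exists x : carrier F, homogeneous 0 x /\ I (aug x - 1) &
            forall x : carrier F, homogeneous 0 x ->
              (I (aug x) <-> exists y : carrier F, homogeneous 1 y /\ differential y = x)]].

Definition minimal_complex (F : free_complex) : Prop :=
  forall b b' : fbasis F, irrelevant_ideal (diff_basis b b').

Definition minimal_free_resolution (F : free_complex) (I : Q -> Prop) : Prop :=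
  free_resolution F I /\ minimal_complex F.

Record product (F : free_complex) := Product {
  mul_basis : fbasis F -> fbasis F -> carrier F;
  unit_elt : carrier F
}.

(* The Q-bilinear extension of the multiplication table. *)
Definition pmul (F : free_complex) (mu : product F) (x y : carrier F) :
    carrier F :=
  \sum_(b : fbasis F) \sum_(b' : fbasis F)
     ((x b : Q) * (y b' : Q)) *: mul_basis mu b b'.

Definition dg_algebra (F : free_complex) (mu : product F) : Prop :=
  chain_complex F /\
  [/\ associative (pmul mu),
      left_id (unit_elt mu) (pmul mu) /\ right_id (unit_elt mu) (pmul mu),
      forall p q (x y : carrier F),
        homogeneous p x -> homogeneous q y -> homogeneous (p + q) (pmul mu x y),
      forall p (x y : carrier F), homogeneous p x ->
        differential (pmul mu x y) =
          pmul mu (differential x) y + (-1 : Q) ^+ p *: pmul mu x (differential y) &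
      homogeneous 0 (unit_elt mu) /\
      forall x : carrier F, homogeneous 0 x -> exists! a : Q, x = a *: unit_elt mu].

Definition strictly_commutative (F : free_complex) (mu : product F) : Prop :=
  (forall p q (x y : carrier F), homogeneous p x -> homogeneous q y ->
     pmul mu x y = (-1 : Q) ^+ (p * q) *: pmul mu y x) /\
  (forall p (x : carrier F), odd p -> homogeneous p x -> pmul mu x x = 0).

Definition dg_morphism (F F' : free_complex) (mu : product F)
    (mu' : product F') (f : carrier F -> carrier F') : Prop :=
  [/\ forall (a : Q) x y, f (a *: x + y) = a *: f x + f y,
      forall p x, homogeneous p x -> homogeneous p (f x),
      forall x, f (differential x) = differential (f x),
      forall x y, f (pmul mu x y) = pmul mu' (f x) (f y) &
      f (unit_elt mu) = unit_elt mu'].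

Definition dg_ideal (F : free_complex) (mu : product F)
    (J : carrier F -> Prop) : Prop :=
  [/\ J 0 /\ forall (a : Q) x y, J x -> J y -> J (a *: x + y),
      forall x y, J x -> J (pmul mu x y) /\ J (pmul mu y x),
      forall p x, J x -> J (hcomponent p x) &
      forall x, J x -> J (differential x)].

(* f induces an isomorphism of dg algebras from F / J onto F'. *)
Definition dg_quotient_by (F F' : free_complex) (mu : product F)
    (mu' : product F') (J : carrier F -> Prop)
    (f : carrier F -> carrier F') : Prop :=
  [/\ dg_morphism mu mu' f,
      forall y, exists x, f x = y &
      forall x, f x = 0 <-> J x].

Section Taylor.
Variables (E : finType) (lt : rel E) (mon : E -> 'X_{1..n}).

Local Notation lcm := (mlcm_set mon).

Definition sgn_elt (u : E) (U : {set E}) : nat := #|[set v in U | lt v u]|.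

Definition sgn_sets (U W : {set E}) : nat :=
  #|[set p in setX U W | lt p.2 p.1]|.

Definition single (U : {set E}) : {ffun {set E} -> Q^o} :=
  [ffun W => (W == U)%:R].

Definition taylor : free_complex :=
  @FreeComplex {set E} (fun U => #|U|) lcm
    (fun U => \sum_(u in U)
       ((-1) ^+ sgn_elt u U * 'X_[lcm U - lcm (U :\ u)] : Q) *:
         single (U :\ u)).

Definition taylor_product : product taylor :=
  @Product taylor
    (fun U W : {set E} =>
       if [disjoint U & W] then
         ((-1) ^+ sgn_sets U W * 'X_[lcm U + lcm W - lcm (U :|: W)] : Q) *:
           (single (U :|: W) : carrier taylor)
       else 0)
    (single set0).

End Taylor.

Section GraphAlgebra.
(* The vertices are identified with variables of Q through x. *)
Variables (V : choiceType) (x : V -> 'I_n) (G : sgraph V).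

Definition edge_monomial (e : {fset V}) : 'X_{1..n} :=
  (\sum_(v : e) U_(x (val v)))%MM.

Definition edge_ideal : Q -> Prop :=
  ideal_gen [seq 'X_[edge_monomial e] | e <- edges G].

Definition edge_taylor (ltE : rel (edges G)) : free_complex :=
  taylor ltE (fun w => edge_monomial (val w)).

Definition edge_taylor_product (ltE : rel (edges G)) :
    product (edge_taylor ltE) :=
  taylor_product ltE (fun w => edge_monomial (val w)).

Variable C : {fset V}.

Definition koszul (ltC : rel C) : free_complex :=
  taylor ltC (fun v => U_(x (val v))%MM).

Definition koszul_product (ltC : rel C) : product (koszul ltC) :=
  taylor_product ltC (fun v => U_(x (val v))%MM).

Variable chi : edges G -> C.

Definition chi_monomial (w : edges G) : 'X_{1..n} := U_(x (val (chi w)))%MM.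

Definition upsilon_monomial (w : edges G) : 'X_{1..n} :=
  (edge_monomial (val w) - chi_monomial w)%MM.

Definition x_lcm (W : {set edges G}) := mlcm_set chi_monomial W.
Definition y_lcm (W : {set edges G}) := mlcm_set upsilon_monomial W.
Definition d_gcd (W : {set edges G}) := mgcd (x_lcm W) (y_lcm W).

(* For a complex whose basis element b is the image of g_(s b). *)
Definition tau (ltC : rel C) (F : free_complex)
    (s : fbasis F -> {set edges G}) : carrier F -> carrier (koszul ltC) :=
  @lin_ext F (koszul ltC) (fun b =>
    if #|chi @: s b| == #|s b| then
      ('X_[y_lcm (s b) - d_gcd (s b)] : Q) *:
        @bvec (koszul ltC) (chi @: s b)
    else 0).

End GraphAlgebra.

End Complexes.

(* Main.v *)
From HB Require Import structures.
Require Import Defs.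
From mathcomp Require Import all_boot all_order all_algebra.
From mathcomp Require Import finmap.
From mathcomp Require Import mpoly.
From mathcomp Require Import ring.

(* Put z = z_{i+1} and let I, C be the edge ideal and the cover at stage i, so that
   the edge ideal at stage i + 1 is I' = I + z (C).  Let G be the resolution of Q/I,
   K the Koszul algebra on C and tau : G -> K the lifting.  On G + s G + K, with
   d s = z - 1_K, s K = 0, e e' = z (e e')_K and g e = (tau g e)_K for e, e' in K,
   there is a strictly commutative dg algebra structure; the elements u such that u
   and du have degree 0 part in Q form a sub dg algebra G'.  A vector (g, h, e) is a
   boundary as soon as h = d w and g + z w, e - tau w are boundaries, so that G' is
   exact because G, K are and because z is regular modulo I.  It is minimal because
   the coefficients of tau in positive degree lie in the irrelevant ideal: at stage 0
   this is what the acyclicity of D(G^0, C^0) gives.  The map (g, h, e) |->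
   tau g + z e is a dg morphism from G' to K, so that the step can be iterated.

   Everything is multigraded.  The polynomial ring of stage i has its own variables,
   so the base resolution is moved to it by renaming variables; exactness survives
   because it only concerns the strands of each multidegree. *)

Set Implicit Arguments.
Unset Strict Implicit.
Unset Printing Implicit Defensive.

Import GRing.Theory.
Local Open Scope ring_scope.

(** * Ideals of polynomial rings *)

Section Ideals.
Variables (k : fieldType) (n : nat).
Local Notation Q := {mpoly k[n]}.
Implicit Types (s : seq Q) (p q : Q) (P : Q -> Prop).

(** As C is a vertex cover, I lies in (C); as z is regular modulo I, the intersection of I and z (C)
    is z I. Hence I' is the cokernel of z I -> I + z (C) (direct sum), and it is resolved by the
    mapping cone of (z, - tau) from the positive part of G to the positive parts of G and K. This
    cone is G'. A product on it is awkward to write directly, since the multiples of s and of 1_K by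
    the degree 0 part are missing. They are restored in G + s G + K, where all formulas are
    bilinear, with no case distinction on degrees. An element e of K stands for z e: this explains
    the factor z in e e', the square z 1_K of 1_K and the term z e in the new tau. A variable e_v of
    K has boundary x_v 1_K; the corrected element e_v + x_v s has boundary z x_v, as it should.

    The cover grows with the stage. All the Koszul algebras are therefore taken inside one, on all
    variables of the ring of stage i, as subcomplexes spanned by basis vectors, and the induction
    over the stages j <= i stays in this ring. *)

Definition ideal_closed P :=
  [/\ P 0, forall p q, P p -> P q -> P (p + q) & forall a p, P p -> P (a * p)].

Lemma ideal_closed_sum P (T : Type) (r : seq T) (F : T -> Q) :
  ideal_closed P -> (forall i, P (F i)) -> P (\sum_(i <- r) F i).
Proof. by case=> P0 PD _ PF; elim/big_ind: _ => // *; apply: PF. Qed.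

Lemma ideal_gen_closed s : ideal_closed (ideal_gen s).
Proof.
split=> [|p q [a ->] [b ->]|c p [a ->]].
- by exists (fun=> 0); rewrite big1 // => i _; rewrite mul0r.
- by exists (fun i => a i + b i); rewrite -big_split; apply: eq_bigr => i _; rewrite mulrDl.
- by exists (fun i => c * a i); rewrite mulr_sumr; apply: eq_bigr => i _; rewrite mulrA.
Qed.

Lemma ideal_gen_mem s p : p \in s -> ideal_gen s p.
Proof.
move=> sp; exists (fun i => (i == index p s)%:R).
rewrite (bigD1 (Ordinal (introT idP (etrans (index_mem p s) sp)))) //=.
rewrite eqxx mul1r nth_index // big1 ?addr0 // => i.
by rewrite -val_eqE /= => /negPf->; rewrite mul0r.
Qed.

Lemma ideal_gen_min s P :
  ideal_closed P -> {in s, forall p, P p} -> forall p, ideal_gen s p -> P p.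
Proof.
move=> idP sP p [a ->]; case: (idP) => _ _ PM.
by apply: ideal_closed_sum => // i; apply: PM; apply: sP; apply: mem_nth.
Qed.

Lemma irrelevant_idealP p : irrelevant_ideal p <-> p@_0%MM = 0.
Proof.
split=> [|p0].
  move: p; apply: ideal_gen_min => [|p /codomP[i ->]]; last by rewrite mcoeffX mnm1_eq0.
  split=> [|p q p0 q0|a p p0]; first exact: mcoeff0.
    by rewrite mcoeffD p0 q0 addr0.
  by rewrite rmorphM /= p0 mulr0.
have [I0 ID IM] := ideal_gen_closed [seq ('X_i : Q) | i : 'I_n].
rewrite (mpolyE p); apply: ideal_closed_sum => // m.
have [->|m0] := eqVneq m 0%MM; first by rewrite p0 scale0r.
have [i mi] : exists i, m i != 0%N.
  by apply/existsP; apply: contraR m0 => /existsPn m0; apply/eqP/mnmP=> i; rewrite mnm0E; move/negbNE/eqP: (m0 i).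
rewrite -(submK (m := U_(i)) (m' := m)) ?lep1mP // mpolyXD scalerAl.
by apply/IM/ideal_gen_mem/codom_f.
Qed.

(* Division by the variable z of the part of q divisible by z. *)
Definition divX (z : 'I_n) (q : Q) : Q :=
  \sum_(m <- msupp q) (if m z == 0%N then 0 else q@_m *: 'X_[m - U_(z)]).

Lemma mcoeff_divX z q m : (divX z q)@_m = q@_(m + U_(z)).
Proof.
rewrite /divX raddf_sum /=; have [mq|mq] := boolP (m + U_(z) \in msupp q)%MM.
  rewrite (bigD1_seq _ mq (msupp_uniq _)) /= mnmDE mnm1E eqxx addn1 /= addmK.
  rewrite mcoeffZ mcoeffX eqxx mulr1 big1 ?addr0 // => m' m'q.
  case: ifP => m'z; first by rewrite mcoeff0.
  rewrite mcoeffZ mcoeffX; case: eqP => [e|]; last by rewrite mulr0.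
  by case/eqP: m'q; rewrite -e submK // lep1mP m'z.
rewrite (memN_msupp_eq0 mq) big1_seq // => m' /andP[_ m'q].
case: ifP => m'z; first by rewrite mcoeff0.
rewrite mcoeffZ mcoeffX; case: eqP => [e|]; last by rewrite mulr0.
by case/negP: mq; rewrite -e submK // lep1mP m'z.
Qed.

Lemma mcoeffMXE q m1 m : (q * 'X_[m1])@_m = if (m1 <= m)%MM then q@_(m - m1) else 0.
Proof.
case: ifP => m1m; first by rewrite -{1}(submK m1m) addmC mcoeffMX.
apply/memN_msupp_eq0/negP; rewrite (perm_mem (msuppMX q m1)) => /mapP[m2 _ e].
by rewrite e lem_addr in m1m.
Qed.

(** As z divides no generator, a relation z q = sum a_i m_i persists when the terms of the a_i prime
    to z are deleted, and what is left can be divided by z. *)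
Lemma monomial_ideal_regular (z : 'I_n) s (e : seq 'X_{1..n}) q :
  s = [seq 'X_[m] | m <- e] -> (forall m, m \in e -> m z = 0%N) ->
  ideal_gen s ('X_z * q) -> ideal_gen s q.
Proof.
move=> -> ez [a E]; exists (fun i => divX z (a i)); apply/mpolyP=> m.
have <- : ('X_z * q)@_(m + U_(z))%MM = q@_m by rewrite mulrC addmC mcoeffMX.
rewrite E !raddf_sum; apply: eq_bigr => i _ /=.
have ie : (i < size e)%N by case: i => i /=; rewrite size_map.
rewrite (nth_map 0%MM) // !mcoeffMXE mcoeff_divX.
have iz := ez _ (mem_nth 0%MM ie); set mi := nth 0%MM e i in iz *.
have -> : (mi <= m + U_(z))%MM = (mi <= m)%MM.
  apply/mnm_lepP/mnm_lepP => H j; move: (H j); rewrite mnmDE mnm1E.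
    by case: eqP => [<-|_]; rewrite ?iz ?addn0.
  by move/leq_trans; apply; apply: leq_addr.
case: ifP => // mim; congr mcoeff; apply/mnmP=> j.
by rewrite mnmDE !mnmBE mnmDE addnBAC //; move/mnm_lepP: mim.
Qed.

End Ideals.

(** * Free complexes and their products *)

Section FreeModules.
Variables (k : fieldType) (n : nat).
Local Notation Q := {mpoly k[n]}.
Implicit Types (F : free_complex k n).

Lemma carrierZE F (a : Q) (x : carrier F) b : (a *: x) b = a * (x b : Q) :> Q.
Proof. by rewrite ffunE. Qed.

Lemma carrierDE F (x y : carrier F) b : (x + y) b = (x b : Q) + y b :> Q.
Proof. by rewrite ffunE. Qed.

Lemma carrierNE F (x : carrier F) b : (- x) b = - (x b : Q) :> Q.
Proof. by rewrite ffunE. Qed.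

Lemma carrier0E F b : (0 : carrier F) b = 0 :> Q.
Proof. by rewrite ffunE. Qed.

Lemma lin_extE F F' (f : fbasis F -> carrier F') x b' :
  lin_ext f x b' = \sum_b (x b : Q) * f b b'.
Proof. by rewrite /lin_ext sum_ffunE; apply: eq_bigr => b _; rewrite ffunE. Qed.

Lemma lin_ext_is_linear F F' (f : fbasis F -> carrier F') : linear (lin_ext f).
Proof.
move=> a x y; rewrite /lin_ext scaler_sumr -big_split; apply: eq_bigr => b _ /=.
by rewrite !ffunE scalerDl scalerA.
Qed.

HB.instance Definition _ F F' (f : fbasis F -> carrier F') :=
  GRing.isLinear.Build Q (carrier F) (carrier F') _ (lin_ext f) (lin_ext_is_linear f).
HB.instance Definition _ F :=
  GRing.isLinear.Build Q (carrier F) (carrier F) _ (@differential k n F)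
    (lin_ext_is_linear (@diff_basis _ _ F)).

Lemma bvecE F (b b' : fbasis F) : bvec b b' = (b' == b)%:R :> Q.
Proof. by rewrite ffunE. Qed.

Lemma lin_ext_bvec F F' (f : fbasis F -> carrier F') b : lin_ext f (bvec b) = f b.
Proof.
rewrite /lin_ext (bigD1 b) //= bvecE eqxx scale1r big1 ?addr0 // => b' /negPf bb'.
by rewrite bvecE bb' scale0r.
Qed.

Lemma diff_bvec F (b : fbasis F) : differential (bvec b) = diff_basis b.
Proof. exact: lin_ext_bvec. Qed.

Lemma diffE F (x : carrier F) : differential x = \sum_b (x b : Q) *: diff_basis b.
Proof. by []. Qed.

Lemma carrier_expand F (x : carrier F) : x = \sum_b (x b : Q) *: bvec b.
Proof.
apply/ffunP=> b; rewrite sum_ffunE (bigD1 b) // big1 => [|b' /negPf bb'].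
  by rewrite carrierZE bvecE eqxx mulr1 [RHS]addr0.
by rewrite carrierZE bvecE eq_sym bb' mulr0.
Qed.

Lemma linear_expand F (M : lmodType Q) (f : carrier F -> M) :
  linear f -> forall x, f x = \sum_b (x b : Q) *: f (bvec b).
Proof.
move=> lf x; pose fL : {linear carrier F -> M} :=
  HB.pack f (GRing.isLinear.Build Q (carrier F) M _ f lf).
rewrite {1}(carrier_expand x) -[f]/(fL : _ -> _) linear_sum.
by apply: eq_bigr => b _; rewrite linearZ.
Qed.

Lemma linear_eq_basis F (M : lmodType Q) (f g : carrier F -> M) :
  linear f -> linear g -> (forall b, f (bvec b) = g (bvec b)) -> f =1 g.
Proof.
move=> lf lg fg x; rewrite (linear_expand lf) (linear_expand lg).
by apply: eq_bigr => b _; rewrite fg.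
Qed.

Definition biadditive_linear F (M : lmodType Q) (f : carrier F -> carrier F -> M) :=
  (forall y, linear (f^~ y)) /\ (forall x, linear (f x)).

Lemma bilinear_eq_basis F (M : lmodType Q) (f g : carrier F -> carrier F -> M) :
  biadditive_linear f -> biadditive_linear g ->
  (forall b b', f (bvec b) (bvec b') = g (bvec b) (bvec b')) -> f =2 g.
Proof.
move=> [lf rf] [lg rg] fg x y; move: x; apply: (linear_eq_basis (lf y) (lg y)) => b.
exact: (linear_eq_basis (rf _) (rg _)).
Qed.

Section Product.
Variables (F : free_complex k n) (mu : product F).

Lemma pmulE x y :
  pmul mu x y = \sum_b \sum_b' ((x b : Q) * (y b' : Q)) *: mul_basis mu b b'.
Proof. by []. Qed.

(** This form and the next present the product as a linear extension in either argument, so that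
    bilinearity is inherited from [lin_ext]. *)
Lemma pmul_lin_ext x y : pmul mu x y = lin_ext (fun b => lin_ext (mul_basis mu b) y) x.
Proof.
apply: eq_bigr => b _; rewrite /lin_ext scaler_sumr; apply: eq_bigr => b' _.
by rewrite scalerA.
Qed.

Lemma pmul_lin_extr x y :
  pmul mu x y = lin_ext (fun b' => lin_ext (fun b => mul_basis mu b b') x) y.
Proof.
rewrite /pmul exchange_big; apply: eq_bigr => b _; rewrite /lin_ext scaler_sumr.
by apply: eq_bigr => b' _; rewrite scalerA mulrC.
Qed.

Lemma pmul_linear_l y : linear ((pmul mu)^~ y).
Proof. by move=> a x x'; rewrite !pmul_lin_ext linearP. Qed.

Lemma pmul_linear_r x : linear (pmul mu x).
Proof. by move=> a y y'; rewrite !pmul_lin_extr linearP. Qed.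

HB.instance Definition _ x :=
  GRing.isLinear.Build Q (carrier F) (carrier F) _ (pmul mu x) (pmul_linear_r x).

Lemma pmulDl x y u : pmul mu (x + y) u = pmul mu x u + pmul mu y u.
Proof. by rewrite !pmul_lin_ext linearD. Qed.
Lemma pmulZl a x u : pmul mu (a *: x) u = a *: pmul mu x u.
Proof. by rewrite !pmul_lin_ext linearZ. Qed.
Lemma pmul0l u : pmul mu 0 u = 0.
Proof. by rewrite !pmul_lin_ext linear0. Qed.

Lemma pmul_bvec b b' : pmul mu (bvec b) (bvec b') = mul_basis mu b b'.
Proof. by rewrite pmul_lin_ext !lin_ext_bvec. Qed.

Lemma pmulPl a x y u : pmul mu (a *: x + y) u = a *: pmul mu x u + pmul mu y u.
Proof. exact: pmul_linear_l. Qed.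

Lemma pmulPr a x y u : pmul mu u (a *: x + y) = a *: pmul mu u x + pmul mu u y.
Proof. exact: pmul_linear_r. Qed.
Lemma pmulZr a x u : pmul mu u (a *: x) = a *: pmul mu u x.
Proof. exact: linearZ. Qed.
Lemma pmul0r u : pmul mu u 0 = 0.
Proof. exact: linear0. Qed.
Lemma pmul_sumr (I : Type) (r : seq I) (P : pred I) (f : I -> carrier F) u :
  pmul mu u (\sum_(i <- r | P i) f i) = \sum_(i <- r | P i) pmul mu u (f i).
Proof. exact: linear_sum. Qed.

End Product.

Section Differential.
Variable F : free_complex k n.
Implicit Types x y : carrier F.

Lemma diffP (a : Q) x y : differential (a *: x + y) = a *: differential x + differential y.
Proof. exact: linearP. Qed.
Lemma diffD x y : differential (x + y) = differential x + differential y.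
Proof. exact: linearD. Qed.
Lemma diffZ (a : Q) x : differential (a *: x) = a *: differential x.
Proof. exact: linearZ. Qed.
Lemma diffN x : differential (- x) = - differential x.
Proof. exact: linearN. Qed.
Lemma diff0 : differential (0 : carrier F) = 0.
Proof. exact: linear0. Qed.

End Differential.

Local Opaque pmul lin_ext differential bvec.

Section Homogeneous.
Variable F : free_complex k n.
Implicit Types x y : carrier F.

Lemma homogeneous0 p : homogeneous p (0 : carrier F).
Proof. by move=> b; rewrite carrier0E eqxx. Qed.

Lemma homogeneousD p x y : homogeneous p x -> homogeneous p y -> homogeneous p (x + y).
Proof.
move=> hx hy b; rewrite carrierDE => H; apply/eqP/negPn/negP => bp.
have x0 : x b = 0 by apply/eqP/negPn/negP => /hx/eqP; apply/negP.
have y0 : y b = 0 by apply/eqP/negPn/negP => /hy/eqP; apply/negP.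
by rewrite x0 y0 addr0 eqxx in H.
Qed.

Lemma homogeneousZ p (a : Q) x : homogeneous p x -> homogeneous p (a *: x).
Proof.
move=> hx b; rewrite carrierZE => H; apply: hx; apply: contraNneq H => ->.
by rewrite mulr0.
Qed.

Lemma homogeneousN p x : homogeneous p x -> homogeneous p (- x).
Proof. by move=> hx b; rewrite carrierNE oppr_eq0; apply: hx. Qed.

Lemma homogeneous_sum p (T : Type) (r : seq T) (P : pred T) (f : T -> carrier F) :
  (forall i, P i -> homogeneous p (f i)) -> homogeneous p (\sum_(i <- r | P i) f i).
Proof.
by move=> H; elim/big_ind: _ => // [|x y]; [apply: homogeneous0 | apply: homogeneousD].
Qed.

Lemma homogeneous_bvec (b : fbasis F) : homogeneous (hdeg b) (bvec b).
Proof. by move=> b'; rewrite bvecE; case: (b' =P b) => [->|_] //; rewrite eqxx. Qed.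

Lemma homogeneous_eq0 p x b : homogeneous p x -> hdeg b != p -> x b = 0.
Proof. by move=> hx bp; apply/eqP/negPn/negP => /hx/eqP; apply/negP. Qed.

(** The grading involution. With it the Leibniz rule becomes an identity between bilinear maps, free
    of homogeneity assumptions, which can be checked on basis vectors. *)
Definition eps : carrier F -> carrier F :=
  lin_ext (fun b => (-1 : Q) ^+ hdeg b *: bvec b).
HB.instance Definition _ := GRing.isLinear.Build Q (carrier F) (carrier F) _ eps
  (lin_ext_is_linear _).

Lemma eps_bvec b : eps (bvec b) = (-1 : Q) ^+ hdeg b *: bvec b.
Proof. exact: lin_ext_bvec. Qed.

Lemma epsE x b : eps x b = (-1) ^+ hdeg b * (x b : Q).
Proof.
rewrite /eps lin_extE (bigD1 b) // big1 => [|b' /negPf bb'].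
  by rewrite carrierZE bvecE eqxx mulr1 mulrC [LHS]addr0.
by rewrite carrierZE bvecE eq_sym bb' !mulr0.
Qed.

Lemma eps_homogeneous p x : homogeneous p x -> eps x = (-1 : Q) ^+ p *: x.
Proof.
move=> hx; apply/ffunP=> b; rewrite epsE carrierZE.
by have [->|/hx->] := eqVneq (x b) 0; first by rewrite !mulr0.
Qed.

Lemma epsK : involutive eps.
Proof.
by move=> x; apply/ffunP=> b; rewrite !epsE mulrA -exprMn mulrNN mulr1 expr1n mul1r.
Qed.

Lemma diff_homogeneous p x :
  chain_complex F -> homogeneous p.+1 x -> homogeneous p (differential x).
Proof.
move=> [H _] hx; rewrite diffE; apply: homogeneous_sum => b _.
have [->|xb] := eqVneq (x b) 0; first by rewrite scale0r; apply: homogeneous0.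
apply: homogeneousZ => b' /H; rewrite (hx b xb) => -[]; by [].
Qed.

Lemma diff_homogeneous0 x :
  chain_complex F -> homogeneous 0 x -> differential x = 0.
Proof.
move=> [H _] hx; rewrite diffE big1 // => b _.
have [->|xb] := eqVneq (x b) 0; first by rewrite scale0r.
suff -> : diff_basis b = 0 by rewrite scaler0.
by apply/ffunP=> b'; rewrite carrier0E; apply/eqP/negPn/negP => /H; rewrite hx.
Qed.

Lemma eps_diff x : chain_complex F -> eps (differential x) = - differential (eps x).
Proof.
move=> cF; move: x; apply: linear_eq_basis => [a x y|a x y|b].
- by rewrite !linearP.
- by rewrite !linearP.
rewrite eps_bvec linearZ /=.
case E: (hdeg b) => [|p].
  rewrite (diff_homogeneous0 cF) ?linear0 ?scaler0 ?oppr0 //.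
  by rewrite -E; apply: homogeneous_bvec.
rewrite (@eps_homogeneous p) ?exprS ?mulN1r ?scaleNr ?opprK //.
by apply: diff_homogeneous => //; rewrite -E; apply: homogeneous_bvec.
Qed.

End Homogeneous.

(** Strictly commutative dg algebras adapted to a basis: b0 alone has degree 0 and is the unit, and
    every axiom is either a bilinear identity or a condition on basis vectors. *)
Record dga F (mu : product F) (b0 : fbasis F) : Prop := Dga {
  dga_deg0 : forall b, (hdeg b == 0%N) = (b == b0);
  dga_unit : unit_elt mu = bvec b0;
  dga_chain : chain_complex F;
  dga_mulA : associative (pmul mu);
  dga_mul1 : left_id (bvec b0) (pmul mu);
  dga_mulr1 : right_id (bvec b0) (pmul mu);
  dga_hdeg : forall b b' c, mul_basis mu b b' c != 0 -> hdeg c = (hdeg b + hdeg b')%N;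
  dga_leibniz : forall x y, differential (pmul mu x y) =
    pmul mu (differential x) y + pmul mu (eps x) (differential y);
  dga_comm : forall b b',
    mul_basis mu b b' = (-1 : Q) ^+ (hdeg b * hdeg b') *: mul_basis mu b' b;
  dga_sq : forall b, odd (hdeg b) -> mul_basis mu b b = 0
}.

Section DgaTheory.
Variables (F : free_complex k n) (mu : product F) (b0 : fbasis F).

Local Opaque eps.

Lemma associative_basis :
  (forall a b c, pmul mu (bvec a) (mul_basis mu b c) = pmul mu (mul_basis mu a b) (bvec c)) ->
  associative (pmul mu).
Proof.
move=> H x y u; move: x.
apply: linear_eq_basis => [c x x'|c x x'|a]; first exact: pmulPl.
  by rewrite pmulPl pmulPl.
move: y u; apply: bilinear_eq_basis => [||b c]; last by rewrite !pmul_bvec H.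
  split=> [u c y y'|y c u u']; first by rewrite pmulPl linearP.
  by rewrite linearP /= linearP.
by split=> [u c y y'|y c u u']; [rewrite linearP /= pmulPl | rewrite linearP].
Qed.

Lemma leibniz_basis :
  (forall b b', differential (mul_basis mu b b') =
     pmul mu (diff_basis b) (bvec b') + (-1 : Q) ^+ hdeg b *: pmul mu (bvec b) (diff_basis b')) ->
  forall x y, differential (pmul mu x y) =
    pmul mu (differential x) y + pmul mu (eps x) (differential y).
Proof.
move=> H; apply: bilinear_eq_basis => [||b b']; last first.
  by rewrite pmul_bvec H eps_bvec pmulZl !diff_bvec.
  split=> [u c y y'|y c u u'].
    rewrite linearP /= pmulPl [eps (_ + _)]linearP /= pmulPl scalerDr !addrA.
    by congr (_ + _); rewrite addrAC.
  rewrite linearP /= [differential (_ + _)]linearP /= linearP /= scalerDr !addrA.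
  by congr (_ + _); rewrite addrAC.
split=> [u c y y'|y c u u']; first by rewrite pmulPl linearP.
by rewrite linearP /= linearP.
Qed.

Hypothesis H : dga mu b0.

Lemma pmul_homogeneous p q x y :
  homogeneous p x -> homogeneous q y -> homogeneous (p + q) (pmul mu x y).
Proof.
move=> hx hy; rewrite pmulE; do 2!apply: homogeneous_sum => ? _.
set b := (X in x X); set b' := (X in y X).
have [->|/hx<-] := eqVneq (x b) 0; first by rewrite mul0r scale0r; apply: homogeneous0.
have [->|/hy<-] := eqVneq (y b') 0; first by rewrite mulr0 scale0r; apply: homogeneous0.
by apply: homogeneousZ => c; apply: (dga_hdeg H).
Qed.

Lemma pmul_comm p q x y :
  homogeneous p x -> homogeneous q y -> pmul mu x y = (-1 : Q) ^+ (p * q) *: pmul mu y x.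
Proof.
move=> hx hy; rewrite !pmulE [in RHS]exchange_big scaler_sumr; apply: eq_bigr => b _.
rewrite scaler_sumr; apply: eq_bigr => b' _.
have [->|/hx<-] := eqVneq (x b) 0; first by rewrite mul0r mulr0 !scale0r scaler0.
have [->|/hy<-] := eqVneq (y b') 0; first by rewrite mul0r mulr0 !scale0r scaler0.
by rewrite (dga_comm H b b') !scalerA mulrC; congr (_ * _ *: _); apply: mulrC.
Qed.

(** Adding one basis term at a time: in the square of u + w the cross terms u w and w u cancel
    because both factors have odd degree, and the square of u vanishes by the axiom on basis
    vectors. No division by 2 occurs. *)
Lemma pmul_sq p x : odd p -> homogeneous p x -> pmul mu x x = 0.
Proof.
move=> op hx; pose supp (s : seq (fbasis F)) := \sum_(b <- s) (x b : Q) *: bvec b.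
have hs s : homogeneous p (supp s).
  apply: homogeneous_sum => b _; have [->|/hx<-] := eqVneq (x b) 0.
    by rewrite scale0r; apply: homogeneous0.
  exact/homogeneousZ/homogeneous_bvec.
suff S s : pmul mu (supp s) (supp s) = 0 by rewrite (carrier_expand x); apply: S.
elim: s => [|b s IH]; first by rewrite /supp big_nil pmul0l.
have hb : homogeneous p ((x b : Q) *: bvec b).
  have [->|/hx<-] := eqVneq (x b) 0; first by rewrite scale0r; apply: homogeneous0.
  exact/homogeneousZ/homogeneous_bvec.
have -> : supp (b :: s) = (x b : Q) *: bvec b + supp s by rewrite /supp big_cons.
move: (supp s) (hs s) IH hb => w hw ww; set u := _ *: _ => hu.
have uu : pmul mu u u = 0.
  rewrite pmulZl linearZ /= pmul_bvec; have [->|xb] := eqVneq (x b) 0; first by rewrite !scale0r.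
  by rewrite (dga_sq H) ?(hx b xb) // !scaler0.
clearbody u.
rewrite pmulDl [pmul mu u _]linearD [pmul mu w _]linearD /= ww uu.
rewrite (addr0 (pmul mu w u)) (add0r (pmul mu u w)) (pmul_comm hw hu).
by rewrite -signr_odd oddM op expr1 scaleN1r addrN.
Qed.

Lemma dga_strictly_commutative : strictly_commutative mu.
Proof. by split=> [p q x y|p x]; [apply: pmul_comm | apply: pmul_sq]. Qed.

Lemma homogeneous0E x : homogeneous 0 x -> x = (x b0 : Q) *: bvec b0.
Proof.
move=> hx; rewrite [LHS]carrier_expand (bigD1 b0) //= big1 ?addr0 // => b bb0.
by rewrite (homogeneous_eq0 hx) ?scale0r // (dga_deg0 H).
Qed.

Lemma homogeneous_b0 : homogeneous 0 (bvec b0).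
Proof. by rewrite -[0%N](eqP (etrans (dga_deg0 H b0) (eqxx b0))); apply: homogeneous_bvec. Qed.

Lemma dga_dg_algebra : dg_algebra mu.
Proof.
split; first exact: dga_chain H.
rewrite (dga_unit H); split.
- exact: dga_mulA H.
- by split; [apply: dga_mul1 H | apply: dga_mulr1 H].
- exact: pmul_homogeneous.
- by move=> p x y hx; rewrite (dga_leibniz H) (eps_homogeneous hx) pmulZl.
split=> [|x hx]; first exact: homogeneous_b0.
exists (x b0); split=> [|a]; first exact: homogeneous0E.
by move=> ->; rewrite carrierZE bvecE eqxx mulr1.
Qed.

Lemma eps_pmul x y : eps (pmul mu x y) = pmul mu (eps x) (eps y).
Proof.
move: x y; apply: bilinear_eq_basis => [||b b']; last first.
  rewrite pmul_bvec !eps_bvec pmulZl linearZ /= scalerA -exprD pmul_bvec.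
  by apply: eps_homogeneous => c; apply: (dga_hdeg H).
  by split=> [u c y y'|y c u u']; [rewrite linearP /= pmulPl | rewrite linearP /= linearP].
by split=> [u c y y'|y c u u']; [rewrite pmulPl linearP | rewrite linearP /= linearP].
Qed.

End DgaTheory.

End FreeModules.

(** * The algebra on G + s G + K *)

Section ModuleTerms.
Variables (R : comNzRingType) (V : lmodType R).

Inductive mod_term :=
  | MVar of nat | MZero | MAdd of mod_term & mod_term | MOpp of mod_term
  | MScale of R & mod_term.

Fixpoint mod_eval (env : seq V) t : V :=
  match t with
  | MVar i => nth 0 env i
  | MZero => 0
  | MAdd t1 t2 => mod_eval env t1 + mod_eval env t2
  | MOpp t1 => - mod_eval env t1
  | MScale a t1 => a *: mod_eval env t1
  end.

(** The comparison is by [eqn] so that it computes on numerals under [cbn]. *)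
Fixpoint mod_coef t (i : nat) : R :=
  match t with
  | MVar j => if eqn i j then 1 else 0
  | MZero => 0
  | MAdd t1 t2 => mod_coef t1 i + mod_coef t2 i
  | MOpp t1 => - mod_coef t1 i
  | MScale a t1 => a * mod_coef t1 i
  end.

Lemma mod_eval_coef env t :
  mod_eval env t = \sum_(i < size env) mod_coef t i *: nth 0 env i.
Proof.
elim: t => [j||t1 IH1 t2 IH2|t IH|a t IH] /=; rewrite ?IH1 ?IH2 ?IH.
- have [js|sj] := ltnP j (size env).
    rewrite (bigD1 (Ordinal js)) //= ?eqnE eqxx scale1r big1 ?addr0 // => i.
    by rewrite -val_eqE /= ?eqnE => /negPf->; rewrite scale0r.
  rewrite nth_default // big1 // => i _; rewrite ?eqnE.
  by rewrite ltn_eqF ?scale0r // (leq_trans (ltn_ord i)).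
- by rewrite big1 // => i _; rewrite scale0r.
- by rewrite -big_split; apply: eq_bigr => i _; rewrite scalerDl.
- by rewrite -sumrN; apply: eq_bigr => i _; rewrite scaleNr.
by rewrite scaler_sumr; apply: eq_bigr => i _; rewrite scalerA.
Qed.

(** A recursion rather than a quantifier over indices: it unfolds to a finite conjunction of
    identities in R, each of which is left to [ring]. *)
Fixpoint mod_eq_coefs (m : nat) t1 t2 : Prop :=
  if m is m'.+1 then mod_coef t1 m' = mod_coef t2 m' /\ mod_eq_coefs m' t1 t2 else True.

Lemma mod_term_eq env t1 t2 :
  mod_eq_coefs (size env) t1 t2 -> mod_eval env t1 = mod_eval env t2.
Proof.
move=> H; rewrite !mod_eval_coef; apply: eq_bigr => -[i /= ilt] _; congr (_ *: _).
elim: (size env) i ilt H => // m IH i; rewrite ltnS leq_eqVlt => /orP[/eqP->[]//|im [_]].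
exact: IH.
Qed.

End ModuleTerms.

Ltac mod_index x env :=
  lazymatch env with
  | x :: _ => constr:(O)
  | _ :: ?env' => let i := mod_index x env' in constr:(S i)
  end.

Ltac mod_atoms t env :=
  lazymatch t with
  | 0%R => env
  | (?t1 + ?t2)%R => let env1 := mod_atoms t1 env in mod_atoms t2 env1
  | (- ?t1)%R => mod_atoms t1 env
  | (_ *: ?t1)%R => mod_atoms t1 env
  | _ => match env with
         | _ => let _ := mod_index t env in env
         | _ => constr:(t :: env)
         end
  end.

Ltac mod_reify R t env :=
  lazymatch t with
  | 0%R => constr:(@MZero R)
  | (?t1 + ?t2)%R =>
      let u1 := mod_reify R t1 env in let u2 := mod_reify R t2 env in constr:(@MAdd R u1 u2)
  | (- ?t1)%R => let u1 := mod_reify R t1 env in constr:(@MOpp R u1)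
  | (?a *: ?t1)%R => let u1 := mod_reify R t1 env in constr:(@MScale R a u1)
  | _ => let i := mod_index t env in constr:(@MVar R i)
  end.

(* Proves an identity in an R-module by comparing the coefficients of the atoms. *)
Ltac module R V :=
  lazymatch goal with
  | |- ?l = ?r =>
      let env0 := mod_atoms l (@nil V) in
      let env := mod_atoms r env0 in
      let t1 := mod_reify R l env in
      let t2 := mod_reify R r env in
      change (mod_eval env t1 = mod_eval env t2);
      apply: mod_term_eq; cbn [mod_eq_coefs mod_coef size eqn];
      repeat (split; first by ring); exact I
  end.

Section Bilinear.
Variables (R : comNzRingType) (A : lmodType R) (m : A -> A -> A).

Definition bilinear_op :=
  (forall a x x' y, m (a *: x + x') y = a *: m x y + m x' y) /\
  (forall a x y y', m x (a *: y + y') = a *: m x y + m x y').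

Hypothesis mP : bilinear_op.

Lemma bil0l y : m 0 y = 0.
Proof.
by have := mP.1 (-1) 0 0 y; rewrite scaler0 addr0 scaleN1r addNr.
Qed.
Lemma bil0r x : m x 0 = 0.
Proof.
by have := mP.2 (-1) x 0 0; rewrite scaler0 addr0 scaleN1r addNr.
Qed.
Lemma bilDl x x' y : m (x + x') y = m x y + m x' y.
Proof. by have := mP.1 1 x x' y; rewrite !scale1r. Qed.
Lemma bilDr x y y' : m x (y + y') = m x y + m x y'.
Proof. by have := mP.2 1 x y y'; rewrite !scale1r. Qed.
Lemma bilZl a x y : m (a *: x) y = a *: m x y.
Proof. by have := mP.1 a x 0 y; rewrite bil0l !addr0. Qed.
Lemma bilZr a x y : m x (a *: y) = a *: m x y.
Proof. by have := mP.2 a x y 0; rewrite bil0r !addr0. Qed.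
Lemma bilNl x y : m (- x) y = - m x y.
Proof. by rewrite -scaleN1r bilZl scaleN1r. Qed.
Lemma bilNr x y : m x (- y) = - m x y.
Proof. by rewrite -scaleN1r bilZr scaleN1r. Qed.

End Bilinear.

Lemma signr_sq (R : comNzRingType) m : (-1 : R) ^+ m * (-1) ^+ m = 1.
Proof. by rewrite -exprMn mulrNN mulr1 expr1n. Qed.

Section BigAlgebra.
Variables (R : comNzRingType) (A K : lmodType R).
Variables (mA : A -> A -> A) (mK : K -> K -> K) (z : R).
Variables (dA eA : {linear A -> A}) (dK eK : {linear K -> K}) (tau : {linear A -> K}).
Hypotheses (mAP : bilinear_op mA) (mKP : bilinear_op mK).
Hypotheses (mAA : associative mA) (mKA : associative mK).
Hypothesis eAK : involutive eA.
Hypothesis eAM : forall x y, eA (mA x y) = mA (eA x) (eA y).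
Hypothesis eAd : forall x, eA (dA x) = - dA (eA x).
Hypothesis dAM : forall x y, dA (mA x y) = mA (dA x) y + mA (eA x) (dA y).
Hypothesis dKM : forall x y, dK (mK x y) = mK (dK x) y + mK (eK x) (dK y).
Hypothesis tauM : forall x y, tau (mA x y) = mK (tau x) (tau y).
Hypothesis taud : forall x, tau (dA x) = dK (tau x).
Hypothesis taue : forall x, tau (eA x) = eK (tau x).

Local Notation B := (A * A * K)%type.
Implicit Types u v w : B.

(* The triple (g, h, e) stands for g + s h + e, where d s = z - 1_K, the square
   of 1_K is z 1_K, and s K = 0. *)
Definition big_mul u v : B :=
  (mA u.1.1 v.1.1, mA u.1.2 v.1.1 + mA (eA u.1.1) v.1.2,
   mK (tau u.1.1) v.2 + mK u.2 (tau v.1.1) + z *: mK u.2 v.2).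
Definition big_diff u : B := (dA u.1.1 + z *: u.1.2, - dA u.1.2, dK u.2 - tau u.1.2).
Definition big_eps u : B := (eA u.1.1, - eA u.1.2, eK u.2).
(** It kills s, in agreement with d s = z - 1_K, because it sends 1_K to z. *)
Definition big_tau u : K := tau u.1.1 + z *: u.2.

Let mAbil := (bilDl mAP, bilDr mAP, bilZl mAP, bilZr mAP, bilNl mAP, bilNr mAP).
Let mKbil := (bilDl mKP, bilDr mKP, bilZl mKP, bilZr mKP, bilNl mKP, bilNr mKP).

Lemma big_diff_is_linear : linear big_diff.
Proof.
move=> a [[g h] e] [[g' h'] e']; congr (_, _, _) => /=; rewrite !linearP /=.
- by module R A.
- by module R A.
by module R K.
Qed.
HB.instance Definition _ := GRing.isLinear.Build R B B _ big_diff big_diff_is_linear.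

Lemma big_tau_is_linear : linear big_tau.
Proof.
move=> a [[g h] e] [[g' h'] e']; rewrite /big_tau /= linearP /=.
by module R K.
Qed.
HB.instance Definition _ := GRing.isLinear.Build R B K _ big_tau big_tau_is_linear.

Lemma big_mul_bilinear : bilinear_op big_mul.
Proof.
split=> [a [[g h] e] [[g' h'] e'] [[x y] t] | a [[g h] e] [[x y] t] [[x' y'] t']];
  congr (_, _, _) => /=; rewrite ?linearP /= ?mAbil ?mKbil //.
- by module R A.
- by module R K.
- by module R A.
by module R K.
Qed.

(** The last component of the product is dictated by [big_tau]: with T = tau g + z e, its multiple
    by z is T T' - tau (g g'). *)
Lemma big_mulA : associative big_mul.
Proof.
move=> [[g h] e] [[g' h'] e'] [[x y] t]; congr (_, _, _) => /=.
- by rewrite mAA.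
- by rewrite !mAbil !mAA eAM addrA.
rewrite !tauM !mKbil !mKA; by module R K.
Qed.

(** This is where s K = 0 is seen to be consistent. In the last component the term z (tau h) e',
    which comes from the summand z h of the differential, cancels against the one that - tau h
    contributes through the product z e e'; symmetrically for h' and e. *)
Lemma big_diffM u v :
  big_diff (big_mul u v) = big_mul (big_diff u) v + big_mul (big_eps u) (big_diff v).
Proof.
case: u v => [[g h] e] [[g' h'] e']; congr (_, _, _) => /=.
- by rewrite dAM !mAbil; module R A.
- by rewrite !linearD /= !dAM !mAbil !linearD linearZ /= eAd eAK !mAbil; module R A.
rewrite !linearD /= !linearZ /= !dKM !taud !tauM !mKbil !taue.
by module R K.
Qed.

Lemma big_tauM u v : big_tau (big_mul u v) = mK (big_tau u) (big_tau v).
Proof.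
case: u v => [[g h] e] [[g' h'] e']; rewrite /big_tau /= tauM !mKbil.
by module R K.
Qed.

Lemma big_tau_diff u : big_tau (big_diff u) = dK (big_tau u).
Proof.
case: u => [[g h] e]; rewrite /big_tau /= !linearD !linearZ /= taud; module R K.
Qed.

Hypothesis dAd : forall x, dA (dA x) = 0.
Hypothesis dKd : forall x, dK (dK x) = 0.

Lemma big_diff_diff u : big_diff (big_diff u) = 0.
Proof.
case: u => [[g h] e]; congr (_, _, _) => /=.
- by rewrite linearD linearZ /= dAd; module R A.
- by rewrite linearN /= dAd !oppr0.
by rewrite [tau (- _)]linearN [dK _]linearB /= dKd taud sub0r opprK addNr.
Qed.

Lemma big_diff_lift (g h w g' : A) (e e' : K) :
  h = dA w -> g + z *: w = dA g' -> e - tau w = dK e' -> big_diff (g', - w, e') = (g, h, e).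
Proof.
move=> -> hg he; congr (_, _, _) => /=.
- by rewrite -hg scalerN addrK.
- by rewrite linearN opprK.
by rewrite -he linearN opprK subrK.
Qed.

Section Subalgebra.
Variables (cA : {linear A -> R^o}) (cK : {linear K -> R^o}) (sK : K -> Prop).
Hypothesis cAM : forall x y, cA (mA x y) = (cA x : R) * cA y.
Hypothesis cKM : forall x y, cK (mK x y) = (cK x : R) * cK y.
Hypothesis cAe : forall x, cA (eA x) = cA x.
Hypothesis cKe : forall x, cK (eK x) = cK x.
Hypothesis cKtau : forall x, cK (tau x) = cA x.
Hypothesis sKD : forall x y, sK x -> sK y -> sK (x + y).
Hypothesis sKZ : forall (a : R) x, sK x -> sK (a *: x).
Hypothesis sKM : forall x y, sK x -> sK y -> sK (mK x y).
Hypothesis sKd : forall x, sK x -> sK (dK x).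
Hypothesis sKtau : forall x, sK (tau x).

(* The subalgebra whose degree 0 part is free on 1: in degree 1 it allows s only
   through the combinations e_v + x_v s. *)
Definition big_sub h e : Prop := [/\ sK e, cK e = 0 & cA h = cK (dK e)].

Lemma big_subM g h e g' h' e' : big_sub h e -> big_sub h' e' ->
  big_sub (mA h g' + mA (eA g) h') (mK (tau g) e' + mK e (tau g') + z *: mK e e').
Proof.
move=> [se ce ch] [se' ce' ch']; split.
- by apply: sKD; [apply: sKD; apply: sKM | apply/sKZ/sKM].
- by rewrite !linearD linearZ /= !cKM ce ce' !mulr0 mul0r scaler0 !addr0.
rewrite !linearD !linearZ /= !dKM !linearD /= !cKM !cAM !cKe !cKtau cAe ce ce' ch ch'.
by rewrite !mulr0 !mul0r ?scaler0 !addr0 !add0r ?scaler0 ?addr0 addrC.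
Qed.

Lemma big_sub_diff h e : big_sub h e -> big_sub (- dA h) (dK e - tau h).
Proof.
move=> [se ce ch]; split.
- by apply: sKD; [apply: sKd | rewrite -scaleN1r; apply: sKZ].
- by rewrite linearB /= cKtau ch subrr.
by rewrite [dK (_ - _)]linearB /= dKd sub0r !linearN /= -taud cKtau.
Qed.

End Subalgebra.

Variables (hA : nat -> A -> Prop) (hK : nat -> K -> Prop).
Hypothesis hAD : forall p x y, hA p x -> hA p y -> hA p (x + y).
Hypothesis hAZ : forall p (a : R) x, hA p x -> hA p (a *: x).
Hypothesis hKD : forall p x y, hK p x -> hK p y -> hK p (x + y).
Hypothesis hKZ : forall p (a : R) x, hK p x -> hK p (a *: x).
Hypothesis hAM : forall p q x y, hA p x -> hA q y -> hA (p + q) (mA x y).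
Hypothesis hKM : forall p q x y, hK p x -> hK q y -> hK (p + q) (mK x y).
Hypothesis htau : forall p x, hA p x -> hK p (tau x).
Hypothesis heA : forall p x, hA p x -> eA x = (-1 : R) ^+ p *: x.
Hypothesis mAC : forall p q x y, hA p x -> hA q y -> mA x y = (-1 : R) ^+ (p * q) *: mA y x.
Hypothesis mKC : forall p q x y, hK p x -> hK q y -> mK x y = (-1 : R) ^+ (p * q) *: mK y x.
Hypothesis mAsq : forall p x, odd p -> hA p x -> mA x x = 0.
Hypothesis mKsq : forall p x, odd p -> hK p x -> mK x x = 0.

Definition big_homogeneous (p : nat) u : Prop :=
  [/\ hA p u.1.1, if p is p'.+1 then hA p' u.1.2 else u.1.2 = 0 & hK p u.2].

Lemma big_homogeneousM p q u v :
  big_homogeneous p u -> big_homogeneous q v -> big_homogeneous (p + q) (big_mul u v).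
Proof.
case: u v => [[g h] e] [[g' h'] e'] [/= hg hh he] [/= hg' hh' he']; split=> /=.
- exact: hAM.
- rewrite (heA hg) (bilZl mAP).
  case: p q hg hh he hg' hh' he' => [|p] [|q] hg hh he hg' hh' he' /=.
  + by rewrite hh hh' (bil0l mAP) (bil0r mAP) scaler0 addr0.
  + by rewrite hh (bil0l mAP) add0r; apply/hAZ; rewrite -[q]add0n; apply: hAM.
  + by rewrite hh' (bil0r mAP) scaler0 addr0; apply: hAM.
  by apply: hAD; [apply: hAM | apply: hAZ; rewrite addnS -addSn; apply: hAM].
by apply: hKD; [apply: hKD; apply: hKM => //; apply: htau | apply/hKZ/hKM].
Qed.

(** Here h has degree p - 1, as the cofactor of s. The sign (-1)^q by which the exponents p q and (p
    - 1) q differ is supplied by [eA x]. *)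
Let mACs p q h x : (if p is p'.+1 then hA p' h else h = 0) -> hA q x ->
  mA h x = (-1 : R) ^+ (p * q) *: mA (eA x) h.
Proof.
move=> hh hx; rewrite (heA hx) (bilZl mAP); case: p hh => [->|p hh].
  by rewrite (bil0l mAP) (bil0r mAP) !scaler0.
by rewrite (mAC hh hx) scalerA mulSn exprD mulrAC signr_sq mul1r.
Qed.

Lemma big_mulC p q u v : big_homogeneous p u -> big_homogeneous q v ->
  big_mul u v = (-1 : R) ^+ (p * q) *: big_mul v u.
Proof.
case: u v => [[g h] e] [[g' h'] e'] [/= hg hh he] [/= hg' hh' he'].
congr (_, _, _) => /=.
- exact: mAC.
- rewrite (mACs hh hg') (mACs hh' hg) [(q * p)%N]mulnC !scalerDr scalerA signr_sq scale1r.
  by rewrite addrC.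
rewrite (mKC (htau hg) he') (mKC he (htau hg')) (mKC he he').
by module R K.
Qed.

Lemma big_mul_sq p u : odd p -> big_homogeneous p u -> big_mul u u = 0.
Proof.
move=> op; case: u => [[g h] e] [/= hg hh he].
have sp : (-1 : R) ^+ (p * p) = -1 by rewrite -signr_odd oddM op expr1.
congr (_, _, _) => /=.
- exact: (mAsq op).
- by rewrite (mACs hh hg) sp scaleN1r addNr.
by rewrite (mKC (htau hg) he) sp (mKsq op he) scaler0 addr0 scaleN1r addNr.
Qed.

(** * Identities inherited by a module embedded in the big algebra *)

Section Embedded.
Variables (A' : lmodType R) (m' : A' -> A' -> A') (d' e' : {linear A' -> A'}).
Variables (ig ih : {linear A' -> A}) (ie : {linear A' -> K}) (h' : nat -> A' -> Prop).
Let iota (y : A') : B := (ig y, ih y, ie y).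
Hypothesis iota_inj : injective iota.
Hypothesis iotaM : forall x y, iota (m' x y) = big_mul (iota x) (iota y).
Hypothesis iotad : forall y, iota (d' y) = big_diff (iota y).
Hypothesis iotae : forall y, iota (e' y) = big_eps (iota y).
Hypothesis iotah : forall p y, h' p y -> big_homogeneous p (iota y).

Let iotaD x y : iota (x + y) = iota x + iota y.
Proof. by rewrite /iota !linearD. Qed.

Let iotaZ a x : iota (a *: x) = a *: iota x.
Proof. by rewrite /iota !linearZ. Qed.

Let iota0 : iota 0 = 0.
Proof. by rewrite /iota !linear0. Qed.

Lemma embedded_mulA : associative m'.
Proof. by move=> x y w; apply: iota_inj; rewrite !iotaM big_mulA. Qed.

Lemma embedded_diffM x y : d' (m' x y) = m' (d' x) y + m' (e' x) (d' y).
Proof. by apply: iota_inj; rewrite iotaD iotad !iotaM !iotad iotae big_diffM. Qed.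

Lemma embedded_diff_diff y : d' (d' y) = 0.
Proof. by apply: iota_inj; rewrite !iotad big_diff_diff iota0. Qed.

Lemma embedded_mulC p q x y : h' p x -> h' q y -> m' x y = (-1 : R) ^+ (p * q) *: m' y x.
Proof.
by move=> hx hy; apply: iota_inj; rewrite iotaZ !iotaM; apply: big_mulC; apply: iotah.
Qed.

Lemma embedded_mul_sq p x : odd p -> h' p x -> m' x x = 0.
Proof. by move=> op hx; apply: iota_inj; rewrite iotaM iota0; apply: big_mul_sq (iotah hx). Qed.

Section Unit.
Variables (u' : A') (u : A) (uK : K).
Hypotheses (iotau : iota u' = (u, 0, 0)) (tauu : tau u = uK) (eAu : eA u = u).
Hypotheses (mul1A : left_id u mA) (mulr1A : right_id u mA).
Hypotheses (mul1K : left_id uK mK) (mulr1K : right_id uK mK).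

Lemma embedded_mul1 : left_id u' m'.
Proof.
move=> y; apply: iota_inj; rewrite iotaM iotau /big_mul /= tauu eAu !mul1A mul1K.
by rewrite (bil0l mAP) !(bil0l mKP) scaler0 !addr0 add0r.
Qed.

Lemma embedded_mulr1 : right_id u' m'.
Proof.
move=> y; apply: iota_inj; rewrite iotaM iotau /big_mul /= tauu !mulr1A mulr1K.
by rewrite (bil0r mAP) !(bil0r mKP) scaler0 !addr0 add0r.
Qed.

End Unit.
End Embedded.

End BigAlgebra.

(** * The Koszul algebra on variables *)

Local Opaque pmul lin_ext differential bvec eps.

Section DegreeZero.
Variables (k : fieldType) (n : nat) (F : free_complex k n) (mu : product F) (b0 : fbasis F).
Hypothesis H : dga mu b0.
Local Notation Q := {mpoly k[n]}.

Lemma eps_b0 x : eps x b0 = x b0.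
Proof. by rewrite epsE (eqP (etrans (dga_deg0 H b0) (eqxx b0))) mul1r. Qed.

Lemma pmul_b0 x y : pmul mu x y b0 = (x b0 : Q) * y b0 :> Q.
Proof.
move: x y; apply: (@bilinear_eq_basis _ _ _ Q^o) => [||b b'].
- split=> [u c y y'|y c u u'].
    by rewrite pmulPl carrierDE carrierZE.
  by rewrite linearP /= carrierDE carrierZE.
- split=> [u c y y'|y c u u'].
    by rewrite carrierDE carrierZE mulrDl -mulrA.
  by rewrite carrierDE carrierZE mulrDr mulrCA.
rewrite pmul_bvec !bvecE; have [->|bb0] := eqVneq b b0.
  have [->|b'b0] := eqVneq b' b0.
    by rewrite -pmul_bvec (dga_mul1 H) bvecE !eqxx mulr1.
  by rewrite -pmul_bvec (dga_mul1 H) bvecE eq_sym (negPf b'b0) mulr0.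
rewrite mul0r; apply/eqP/negPn/negP => /(dga_hdeg H).
rewrite (eqP (etrans (dga_deg0 H b0) (eqxx b0))) => /esym/eqP.
by rewrite addn_eq0 (dga_deg0 H) (negPf bb0).
Qed.

End DegreeZero.

(** The induction step for Koszul algebras: the Leibniz rule passes from a to u a when left
    multiplication by u already obeys it. The scalar s is the sign that relates a basis vector to
    such a product. *)
Lemma leibniz_step (R : comNzRingType) (V : lmodType R) (m : V -> V -> V) (d : {linear V -> V})
    (u a y : V) (p s t : R) :
  bilinear_op m -> associative m -> (forall y, d (m u y) = p *: y - m u (d y)) ->
  d (m a y) = m (d a) y + t *: m a (d y) ->
  d (m (s *: m u a) y) = m (d (s *: m u a)) y + (-1 * t) *: m (s *: m u a) (d y).
Proof.
move=> mP mA du IH; have mE := (bilDl mP, bilDr mP, bilZl mP, bilZr mP, bilNl mP).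
rewrite !linearZ /= !mE linearZ /= -!mA !du IH !mE -!mA.
by module R V.
Qed.

Lemma pmul_bilinear (k : fieldType) (n : nat) (F : free_complex k n) (mu : product F) :
  bilinear_op (pmul mu).
Proof. by split=> *; [apply: pmulPl | apply: pmulPr]. Qed.

Section Koszul.
Variables (k : fieldType) (n : nat) (E : finType) (lt : rel E) (x : E -> 'I_n).
Hypotheses (hlt : strict_total_order lt) (x_inj : injective x).
Local Notation Q := {mpoly k[n]}.
Let mon (v : E) : 'X_{1..n} := U_(x v)%MM.
Local Notation K := (taylor k lt mon).
Local Notation muK := (taylor_product k lt mon).
Local Notation e := (@bvec k n K).
Implicit Types (U W A : {set E}) (u v w : E).

Lemma mlcm_varE (W : {set E}) i : mlcm_set mon W i = (i \in x @: W) :> nat.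
Proof.
rewrite /mlcm_set; apply: (@eq_trans _ _ (\max_(w in W) (x w == i))).
  elim/big_rec2: _ => [|w m1 m2 _ <-]; first by rewrite mnm0E.
  by rewrite mnmE mnm1E.
case: imsetP => [[w wW ->]|H].
  apply/eqP; rewrite eqn_leq; apply/andP; split; first by apply/bigmax_leqP => v _; case: eqP.
  by rewrite (bigmax_sup w) ?eqxx.
by rewrite big1 // => w wW; case: eqP => // xw; case: H; exists w.
Qed.

Lemma koszul_diff_basis U :
  diff_basis (f := K) U = \sum_(u in U) ((-1) ^+ sgn_elt lt u U * 'X_(x u) : Q) *: e (U :\ u).
Proof.
apply: eq_bigr => u uU; congr (_ * mpolyX _ _ *: _); apply/mnmP=> i.
rewrite mnmBE !mlcm_varE mnm1E; have [<-|xui] := eqVneq (x u) i.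
  rewrite (imset_f x uU); case: imsetP => // -[v]; rewrite !inE => /andP[/eqP vu _ /x_inj uv].
  by case: vu.
apply/eqP; rewrite subn_eq0; case: imsetP => // -[v vU iv].
rewrite iv (imset_f x) // !inE vU andbT; apply: contraNneq xui => <-; exact/eqP.
Qed.

Lemma koszul_mul_basis U W :
  mul_basis muK U W =
  if [disjoint U & W] then ((-1) ^+ sgn_sets lt U W : Q) *: e (U :|: W) else 0.
Proof.
rewrite /mul_basis /taylor_product.
case: (boolP [disjoint U & W]) => dUW; last reflexivity.
suff -> : (mlcm_set mon U + mlcm_set mon W - mlcm_set mon (U :|: W))%MM = 0%MM.
  by rewrite mpolyX0 mulr1; reflexivity.
apply/mnmP=> i; rewrite mnm0E mnmBE mnmDE !mlcm_varE.
rewrite imsetU inE; case: imsetP => [[u uU ->]|_]; last by case: imsetP.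
case: imsetP => // -[w wW /x_inj uw]; rewrite uw in uU.
by move/disjointFr: dUW => /(_ w uU); rewrite wW.
Qed.

Lemma sgn_eltE u U : sgn_elt lt u U = (\sum_(v in U) lt v u)%N.
Proof.
rewrite /sgn_elt -sum1_card [RHS]big_mkcond [LHS]big_mkcond; apply: eq_bigr => v _.
by rewrite inE; case: (v \in U); case: (lt v u).
Qed.

Lemma sgn_setsE U W : sgn_sets lt U W = (\sum_(u in U) \sum_(w in W) lt w u)%N.
Proof.
rewrite /sgn_sets -sum1_card pair_big_dep [RHS]big_mkcond [LHS]big_mkcond.
apply: eq_bigr => -[u w] _.
by rewrite !inE /=; case: (u \in U); case: (w \in W); case: (lt w u).
Qed.

Lemma sgn_sets1 u W : sgn_sets lt [set u] W = sgn_elt lt u W.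
Proof. by rewrite sgn_setsE sgn_eltE big_set1. Qed.

Lemma sgn_setsUl U U' W : [disjoint U & U'] ->
  sgn_sets lt (U :|: U') W = (sgn_sets lt U W + sgn_sets lt U' W)%N.
Proof. by move=> d; rewrite !sgn_setsE -bigU //; apply: eq_bigl => u; rewrite inE. Qed.

Lemma sgn_setsUr U W W' : [disjoint W & W'] ->
  sgn_sets lt U (W :|: W') = (sgn_sets lt U W + sgn_sets lt U W')%N.
Proof.
move=> d; rewrite !sgn_setsE -big_split; apply: eq_bigr => u _; rewrite -bigU //.
by apply: eq_bigl => w; rewrite inE.
Qed.

Lemma lt_antisym u v : u != v -> (lt u v + lt v u = 1)%N.
Proof.
case: hlt => lti ltt ltc uv; have := ltc _ _ uv.
case: (boolP (lt u v)) => luv; case: (boolP (lt v u)) => lvu //= _.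
by have := ltt _ _ _ luv lvu; rewrite lti.
Qed.

(** Of the two orders on a pair (u, w) with u != w, exactly one counts it as an inversion. *)
Lemma sgn_setsC U W : [disjoint U & W] -> (sgn_sets lt U W + sgn_sets lt W U = #|U| * #|W|)%N.
Proof.
move=> d; rewrite !sgn_setsE [X in (_ + X)%N]exchange_big /= -big_split /=.
rewrite -sum_nat_const; apply: eq_bigr => u uU; rewrite -big_split /= -sum1_card.
apply: eq_bigr => w wW; rewrite addnC lt_antisym //; apply: contraTneq uU => ->.
by rewrite (disjointFl d wW).
Qed.

Lemma sgn_eltD1 u v U : v \in U -> sgn_elt lt u U = (lt v u + sgn_elt lt u (U :\ v))%N.
Proof. by move=> vU; rewrite !sgn_eltE (big_setD1 v). Qed.

Lemma koszul_lmul_var v y W :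
  pmul muK (e [set v]) y W =
  if v \in W then (-1) ^+ sgn_elt lt v (W :\ v) * (y (W :\ v) : Q) else 0 :> Q.
Proof.
rewrite pmul_lin_ext lin_ext_bvec lin_extE.
transitivity (\sum_(U : {set E} | (v \notin U) && (W == v |: U)) (-1) ^+ sgn_elt lt v U * (y U : Q)).
  rewrite [RHS]big_mkcond; apply: eq_bigr => U _.
  rewrite koszul_mul_basis disjoints1; case: (boolP (v \in U)) => vU; first by rewrite ffunE mulr0.
  rewrite carrierZE bvecE sgn_sets1; case: eqP => _; first by rewrite mulr1 mulrC.
  by rewrite !mulr0.
case: ifP => vW.
  rewrite (big_pred1 (W :\ v)) // => U; apply/andP/eqP => [[vU /eqP->]|->].
    by rewrite setU1K.
  by rewrite !inE eqxx setD1K.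
by rewrite big_pred0 // => U; apply/negP => /andP[_ /eqP WvU]; rewrite WvU !inE eqxx in vW.
Qed.

Lemma koszul_var_mul v W : v \notin W ->
  pmul muK (e [set v]) (e W) = ((-1) ^+ sgn_elt lt v W : Q) *: e (v |: W).
Proof. by move=> vW; rewrite pmul_bvec koszul_mul_basis disjoints1 vW sgn_sets1. Qed.

Lemma koszul_bvec_split v W : v \in W ->
  e W = ((-1) ^+ sgn_elt lt v (W :\ v) : Q) *: pmul muK (e [set v]) (e (W :\ v)).
Proof.
by move=> vW; rewrite koszul_var_mul ?inE ?eqxx // scalerA signr_sq scale1r setD1K.
Qed.

(** If v lies in W, then e_v e_W = 0, and the only term of d e_W that survives multiplication by e_v
    is the one that removes v; it gives back x_v e_W. Otherwise the terms that remove w in W appear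
    on both sides with opposite signs, because exactly one of v < w and w < v holds. *)
Lemma koszul_leibniz_var v y :
  differential (pmul muK (e [set v]) y) =
  ('X_(x v) : Q) *: y - pmul muK (e [set v]) (differential y).
Proof.
move: y; apply: linear_eq_basis => [a y y'|a y y'|W].
- by rewrite pmulPr diffP.
- rewrite diffP pmulPr scalerDr opprD scalerBr -scalerN !scalerA.
  by rewrite [_ * a]mulrC addrACA -!scalerA scalerN.
rewrite diff_bvec koszul_diff_basis pmul_sumr.
under eq_bigr => w wW do rewrite pmulZr pmul_bvec koszul_mul_basis disjoints1 sgn_sets1.
have [vW|vW] := boolP (v \in W).
  rewrite pmul_bvec koszul_mul_basis disjoints1 vW diff0 (big_setD1 v) //= !inE eqxx /=.
  rewrite big1 => [|w]; last by rewrite !inE eq_sym vW => /andP[-> _]; rewrite scaler0.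
  rewrite setD1K // scalerA [X in - X]addr0 (sgn_eltD1 _ vW); case: hlt => -> _ _.
  by rewrite add0n mulrAC signr_sq mul1r subrr.
rewrite koszul_var_mul // diffZ diff_bvec koszul_diff_basis big_setU1 //= setU1K //.
rewrite scalerDr scalerA mulrA (sgn_eltD1 _ (setU11 v W)) setU1K //.
have -> : lt v v = false by case: hlt => ->.
rewrite add0n signr_sq mul1r; congr (_ + _); rewrite scaler_sumr -sumrN; apply: eq_bigr => w wW.
have vw : v != w by apply: contraNneq vW => ->.
rewrite !inE negb_and vW orbT !scalerA -scaleNr.
have -> : (v |: W) :\ w = v |: (W :\ w) by rewrite setDUl (setDidPl _) // disjoints1 inE.
congr (_ *: _); rewrite (sgn_eltD1 w (setU11 v W)) setU1K // (sgn_eltD1 v wW).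
have : (-1 : Q) ^+ (lt w v + lt v w) = -1 by rewrite lt_antisym // eq_sym.
rewrite !exprD; move: (_ ^+ lt w v) ((-1) ^+ lt v w) => a b ab.
rewrite -[RHS]mulN1r -ab; ring.
Qed.

(** The square of d vanishes by induction on the size of W: for e_W = e_v a up to sign, the rule for
    e_v gives x_v da - (x_v da - e_v dda). *)
Lemma koszul_chain : chain_complex K.
Proof.
split=> [U W|].
  rewrite koszul_diff_basis sum_ffunE => H.
  have /exists_inP[u uU /eqP->] : [exists u in U, (W : {set E}) == U :\ u].
    apply: contraNT H => /exists_inPn H; rewrite big1 // => u uU.
    by rewrite carrierZE bvecE (negPf (H u uU)) mulr0.
  by rewrite /= (cardsD1 u U) uU.
apply: linear_eq_basis => [a y y'|a y y'|W]; first by rewrite !diffP.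
  by rewrite scaler0 addr0.
elim: {W}_.+1 {-2}W (ltnSn #|W|) => // m IH W; rewrite ltnS => Wm.
have [->|[v vW]] := set_0Vmem W.
  by rewrite [differential (e _)]diff_bvec koszul_diff_basis big_set0 diff0.
rewrite (koszul_bvec_split vW) !diffZ koszul_leibniz_var diffD diffN diffZ.
rewrite koszul_leibniz_var IH ?pmul0r; last by rewrite (leq_trans _ Wm) // (cardsD1 v W) vW.
by rewrite subr0 subrr scaler0.
Qed.

Lemma koszul_associative : associative (pmul muK).
Proof.
apply: associative_basis => a b c.
rewrite !koszul_mul_basis; have [dbc|dbc] := boolP [disjoint b & c]; last first.
  rewrite pmul0r; have [dab|dab] := boolP [disjoint a & b]; last by rewrite pmul0l.
  rewrite pmulZl pmul_bvec koszul_mul_basis.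
  have [d|] := boolP [disjoint a :|: b & c]; last by rewrite scaler0.
  by rewrite (disjointWl (subsetUr a b) d) in dbc.
rewrite pmulZr pmul_bvec koszul_mul_basis; have [dab|dab] := boolP [disjoint a & b]; last first.
  rewrite pmul0l; have [d|_] := boolP [disjoint a & b :|: c]; last by rewrite scaler0.
  by rewrite (disjointWr (subsetUl b c) d) in dab.
rewrite pmulZl pmul_bvec koszul_mul_basis.
have -> : [disjoint a & b :|: c] = [disjoint a :|: b & c].
  rewrite -!setI_eq0 setIUr setIUl !setU_eq0.
  by move: dab dbc; rewrite -!setI_eq0 => -> ->; rewrite andbT.
have [d|_] := boolP [disjoint a :|: b & c]; last by rewrite !scaler0.
rewrite !scalerA -!exprD setUA (sgn_setsUr a dbc) (sgn_setsUl c dab).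
by congr (_ ^+ _ *: _); rewrite addnC addnA.
Qed.

Lemma koszul_mul1 : left_id (e set0) (pmul muK).
Proof.
apply: linear_eq_basis => [a y y'|a y y'|W]; first exact: pmulPr.
  by [].
rewrite pmul_bvec koszul_mul_basis -setI_eq0 set0I eqxx set0U sgn_setsE big_set0.
by rewrite expr0 scale1r.
Qed.

Lemma koszul_mulr1 : right_id (e set0) (pmul muK).
Proof.
apply: linear_eq_basis => [a y y'|a y y'|W]; first exact: pmulPl.
  by [].
rewrite pmul_bvec koszul_mul_basis -setI_eq0 setI0 eqxx setU0 sgn_setsE exchange_big big_set0.
by rewrite expr0 scale1r.
Qed.

Lemma koszul_leibniz y y' : differential (pmul muK y y') =
  pmul muK (differential y) y' + pmul muK (eps y) (differential y').
Proof.
move: y y'; apply: leibniz_basis => U W; rewrite -pmul_bvec -!diff_bvec.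
move: (e W) => y {W}.
elim: {U}_.+1 {-2}U (ltnSn #|U|) => // m IH U; rewrite ltnS => Um.
have [->|[v vU]] := set_0Vmem U.
  rewrite koszul_mul1 diff_bvec koszul_diff_basis big_set0 pmul0l add0r koszul_mul1.
  by rewrite [hdeg _]cards0 expr0 scale1r.
have cU : #|U| = #|U :\ v|.+1 by rewrite (cardsD1 v U) vU.
rewrite (koszul_bvec_split vU) [hdeg _]cU exprS.
by apply: (@leibniz_step Q (carrier K) (pmul muK) (@differential k n K) _ _ y ('X_(x v)) _ _
  (pmul_bilinear _) koszul_associative (@koszul_leibniz_var v)); apply: IH; rewrite -cU.
Qed.

Lemma koszul_dga : dga muK set0.
Proof.
split.
- by move=> W; rewrite /= cards_eq0.
- by [].
- exact: koszul_chain.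
- exact: koszul_associative.
- exact: koszul_mul1.
- exact: koszul_mulr1.
- move=> U W c; rewrite koszul_mul_basis; have [d|_] := boolP [disjoint U & W].
    rewrite carrierZE bvecE; case: (c =P U :|: W) => [->|_]; last by rewrite mulr0 eqxx.
    by move=> _; rewrite /= cardsU (disjoint_setI0 d) cards0 subn0.
  by rewrite carrier0E eqxx.
- exact: koszul_leibniz.
- move=> U W; rewrite !koszul_mul_basis [ [disjoint W & U] ]disjoint_sym setUC.
  have [d|_] := boolP [disjoint U & W]; last by rewrite scaler0.
  by rewrite scalerA /= -(sgn_setsC d) exprD -mulrA signr_sq mulr1.
move=> U; rewrite koszul_mul_basis -setI_eq0 setIid /= => oU.
by case: eqP oU => // ->; rewrite cards0.
Qed.

(** The Koszul algebra on the variables in A, seen inside K. In this form A can shrink in the proof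
    of exactness and grow with the vertex cover, while K stays fixed. *)
Definition supported A (y : carrier K) := forall W : {set E}, y W != 0 -> W \subset A.

Lemma supportedP A (y : carrier K) :
  supported A y <-> forall W : {set E}, ~~ (W \subset A) -> y W = 0.
Proof.
split=> yA W; last by move=> yW; apply: contraR yW => /yA ->.
by move=> WA; apply/eqP; apply: contraR WA; apply: yA.
Qed.

Lemma supported0 A : supported A 0.
Proof. by move=> W; rewrite carrier0E eqxx. Qed.

Lemma supportedZ A (a : Q) y : supported A y -> supported A (a *: y).
Proof. by rewrite !supportedP => yA W /yA yW; rewrite carrierZE yW mulr0. Qed.

Lemma supportedD A y y' : supported A y -> supported A y' -> supported A (y + y').
Proof.
by rewrite !supportedP => yA yA' W WA; rewrite carrierDE (yA _ WA) (yA' _ WA) add0r.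
Qed.

Lemma supportedN A y : supported A y -> supported A (- y).
Proof. by rewrite -scaleN1r; apply: supportedZ. Qed.

Lemma supported_sum A (I : Type) (r : seq I) (P : pred I) (f : I -> carrier K) :
  (forall i, P i -> supported A (f i)) -> supported A (\sum_(i <- r | P i) f i).
Proof.
by move=> H; elim/big_ind: _ => // [|y y']; [apply: supported0 | apply: supportedD].
Qed.

Lemma supported_bvec A W : W \subset A -> supported A (e W).
Proof. by move=> WA U; rewrite bvecE; case: (U =P W) => [->|] //; rewrite eqxx. Qed.

Lemma supportedW A A' y : A \subset A' -> supported A y -> supported A' y.
Proof. by move=> AA' yA W /yA/subset_trans; apply. Qed.

Lemma supported_diff A y : supported A y -> supported A (differential y).
Proof.
move=> yA; rewrite diffE; apply: supported_sum => W _.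
have [->|/yA WA] := eqVneq (y W) 0; first by rewrite scale0r; apply: supported0.
apply: supportedZ; rewrite koszul_diff_basis; apply: supported_sum => u _.
by apply/supportedZ/supported_bvec/(subset_trans _ WA)/subD1set.
Qed.

Lemma supported_mul A y y' :
  supported A y -> supported A y' -> supported A (pmul muK y y').
Proof.
move=> yA yA'; rewrite pmulE; apply: supported_sum => U _; apply: supported_sum => W _.
have [->|/yA UA] := eqVneq (y U) 0; first by rewrite mul0r scale0r; apply: supported0.
have [->|/yA' WA] := eqVneq (y' W) 0; first by rewrite mulr0 scale0r; apply: supported0.
apply: supportedZ; rewrite koszul_mul_basis.
case: (boolP [disjoint U & W]) => _; last exact: supported0.
by apply/supportedZ/supported_bvec; rewrite subUset UA.
Qed.

Lemma koszul_diff_var v : differential (e [set v]) = ('X_(x v) : Q) *: e set0.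
Proof.
rewrite diff_bvec koszul_diff_basis big_set1 sgn_eltE big_set1 setDv.
by case: hlt => -> _ _; rewrite expr0 mul1r.
Qed.

Lemma koszul_deg1 A q :
  ideal_gen [seq ('X_(x w) : Q) | w <- enum A] q <->
  exists f : carrier K, [/\ supported A f, homogeneous 1 f & differential f = q *: e set0].
Proof.
split.
  move: q; apply: ideal_gen_min => [|_ /mapP[w wA ->]]; last first.
    exists (e [set w]); split; last exact: koszul_diff_var.
      by apply: supported_bvec; rewrite sub1set -mem_enum.
    by rewrite -(cards1 w); apply: (@homogeneous_bvec _ _ K).
  split=> [|q q' [f [fA f1 fq]] [f' [fA' f1' fq']]|a q [f [fA f1 fq]]].
  - exists 0; rewrite diff0 scale0r.
    by split; [apply: supported0 | apply: homogeneous0 | ].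
  - exists (f + f'); rewrite diffD fq fq' scalerDl.
    by split; [apply: supportedD | apply: homogeneousD | ].
  exists (a *: f); rewrite diffZ fq scalerA.
  by split; [exact: supportedZ | exact: homogeneousZ | ].
move=> [f [fA f1 fq]].
have -> : q = differential f set0 by rewrite fq carrierZE bvecE eqxx mulr1.
have idP := ideal_gen_closed [seq ('X_(x w) : Q) | w <- enum A].
rewrite diffE sum_ffunE; apply: ideal_closed_sum => // W; rewrite carrierZE.
have [->|fW] := eqVneq (f W) 0; first by rewrite mul0r; case: idP.
have /cards1P[w Ww] : #|W : {set E}| == 1%N by apply/eqP; apply: f1.
case: idP => _ _ idM; apply: idM.
rewrite -diff_bvec Ww koszul_diff_var carrierZE bvecE eqxx mulr1.
by apply: ideal_gen_mem; apply: map_f; rewrite mem_enum -sub1set -Ww; apply: fA.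
Qed.

(** Induction on A. Write y = y0 + e_v y1, where y0 and y1 do not involve v. Then y1 is a cycle,
    hence y1 = d f1; next y0 + x_v f1 is a cycle, hence equal to d f0; and f0 - e_v f1 has boundary
    y. *)
Lemma koszul_exact A p y : supported A y -> homogeneous p.+1 y -> differential y = 0 ->
  exists f : carrier K, [/\ supported A f, homogeneous p.+2 f & differential f = y].
Proof.
elim: {A}_.+1 {-2}A (ltnSn #|A|) p y => // m IH A; rewrite ltnS => Am p y yA yp dy.
have [A0|[v vA]] := set_0Vmem A.
  exists 0; rewrite diff0; split; [exact: supported0 | exact: homogeneous0 | ].
  apply/ffunP=> W; rewrite carrier0E; apply/esym/eqP/negPn/negP => yW.
  by have := yp _ yW; have := yA _ yW; rewrite A0 subset0 => /eqP-> /=; rewrite cards0.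
have A'm : (#|A :\ v| < m)%N by rewrite (leq_trans _ Am) // (cardsD1 v A) vA.
have A'A : A :\ v \subset A by apply: subD1set.
pose y0 : carrier K := [ffun W : {set E} => if v \in W then 0 else y W].
pose y1 : carrier K := [ffun W : {set E} =>
  if v \in W then 0 else (-1) ^+ sgn_elt lt v W * (y (v |: W) : Q)].
have y0E W : y0 W = if v \in W then 0 else y W by rewrite ffunE.
have y1E W : y1 W = if v \in W then 0 else (-1) ^+ sgn_elt lt v W * (y (v |: W) : Q).
  by rewrite ffunE.
have ys : y = y0 + pmul muK (e [set v]) y1.
  apply/ffunP=> W; rewrite carrierDE koszul_lmul_var y0E y1E; have [vW|vW] := boolP (v \in W).
    by rewrite !inE eqxx setD1K // mulrA signr_sq mul1r add0r.
  by rewrite addr0.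
have y0A : supported (A :\ v) y0.
  move=> W; rewrite y0E; have [vW|vW] := boolP (v \in W); first by rewrite eqxx.
  by move=> /yA WA; rewrite subsetD1 WA.
have y1A : supported (A :\ v) y1.
  move=> W; rewrite y1E; have [vW|vW] := boolP (v \in W); first by rewrite eqxx.
  move=> H; have /yA : y (v |: W) != 0 by apply: contraNneq H => ->; rewrite mulr0.
  by rewrite subUset subsetD1 vW andbT => /andP[].
have y0p : homogeneous p.+1 y0.
  move=> W; rewrite y0E; have [vW|vW] := boolP (v \in W); first by rewrite eqxx.
  exact: yp.
have y1p : homogeneous p y1.
  move=> W; rewrite y1E; have [vW|vW] := boolP (v \in W); first by rewrite eqxx.
  move=> H; have /yp : y (v |: W) != 0 by apply: contraNneq H => ->; rewrite mulr0.
  by rewrite /= cardsU1 vW => -[].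
(* This is the cycle condition. The left side does not involve v while the right side is a multiple
   of e_v, so both vanish. *)
have dy01 : differential y0 + ('X_(x v) : Q) *: y1 = pmul muK (e [set v]) (differential y1).
  by apply/eqP; rewrite -subr_eq0 -addrA -koszul_leibniz_var -diffD -ys dy.
have dy1 : differential y1 = 0.
  apply/ffunP=> W; rewrite carrier0E; have [vW|vW] := boolP (v \in W).
    have /supportedP-> // := supported_diff y1A.
    by rewrite subsetD1 vW andbF.
  have : pmul muK (e [set v]) (differential y1) (v |: W) = 0.
    rewrite -dy01; have /supportedP-> // : supported (A :\ v) (differential y0 + ('X_(x v) : Q) *: y1).
      by apply: supportedD; [apply: supported_diff | apply: supportedZ].
    by rewrite subsetD1 !inE eqxx andbF.
  rewrite koszul_lmul_var setU11 setU1K // => /(congr1 ( *%R ((-1) ^+ sgn_elt lt v W))).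
  by rewrite mulrA signr_sq mul1r mulr0.
rewrite dy1 pmul0r in dy01.
have [f1 [f1A f1p df1]] : exists f1 : carrier K,
    [/\ supported (A :\ v) f1, homogeneous p.+1 f1 & differential f1 = y1].
  case: p y1p y0p {yp} => [|p] y1p y0p; last exact: IH.
  (* In degree 0, y1 is q times the unit, and - y0 shows that x_v q lies in the ideal of the
     variables of A other than v. As x_v is regular modulo this ideal, q lies in it as well. *)
  have y1e : y1 = (y1 set0 : Q) *: e set0 := homogeneous0E koszul_dga y1p.
  rewrite y1e; apply/koszul_deg1.
  apply: (@monomial_ideal_regular _ _ (x v) _ [seq U_(x w)%MM | w <- enum (A :\ v)]).
  - by rewrite -map_comp.
  - move=> ? /mapP[w]; rewrite mem_enum !inE => /andP[wv _] ->.
    by rewrite mnm1E; case: eqP => // /x_inj wv'; rewrite wv' eqxx in wv.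
  apply/koszul_deg1; exists (- y0); split; [exact: supportedN | exact: homogeneousN | ].
  rewrite diffN -scalerA -y1e; apply/eqP; rewrite eq_sym -subr_eq0 opprK addrC.
  exact/eqP.
have [f0 [f0A f0p df0]] : exists f0 : carrier K, [/\ supported (A :\ v) f0, homogeneous p.+2 f0
    & differential f0 = y0 + ('X_(x v) : Q) *: f1].
  apply: (IH _ A'm); last by rewrite diffD diffZ df1; exact: dy01.
    by apply: supportedD; [exact: y0A | exact: supportedZ].
  by apply: homogeneousD; [exact: y0p | exact: homogeneousZ].
exists (f0 - pmul muK (e [set v]) f1); split.
- apply: supportedD; first exact: supportedW f0A.
  apply/supportedN/supported_mul; last exact: supportedW f1A.
  by apply: supported_bvec; rewrite sub1set.
- apply: homogeneousD => //; apply: homogeneousN; rewrite -[p.+2]add1n.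
  apply: (pmul_homogeneous koszul_dga) => //.
  by rewrite -(cards1 v); apply: (@homogeneous_bvec _ _ K).
rewrite diffD diffN koszul_leibniz_var df0 df1 [RHS]ys opprB addrA.
by rewrite [_ + _ - _]addrAC addrK.
Qed.

End Koszul.

(** * The resolution G' *)

Section Resolutions.
Variables (k : fieldType) (n : nat).
Local Notation Q := {mpoly k[n]}.

Record multigraded_minimal (F : free_complex k n) (mu : product F) (b0 : fbasis F) : Prop :=
  MultigradedMinimal {
  mm_dga : dga mu b0;
  mm_multigraded : multigraded F;
  mm_minimal : forall b b' : fbasis F, (diff_basis b b' : Q)@_0%MM = 0;
  mm_mdg0 : mdg b0 = 0%MM
}.

(** The augmentation is replaced by its kernel: since degree 0 is free on b0, it is enough to say
    that the boundaries of degree 0 are the multiples q b0 with q in I. *)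
Record resolves (I : Q -> Prop) (F : free_complex k n) (mu : product F) (b0 : fbasis F) : Prop :=
  Resolves {
  res_mm : multigraded_minimal mu b0;
  res_exact : forall p (x : carrier F), homogeneous p.+1 x -> differential x = 0 ->
    exists y : carrier F, homogeneous p.+2 y /\ differential y = x;
  res_ideal : forall q, I q <->
    exists y : carrier F, homogeneous 1 y /\ differential y = q *: bvec b0
}.

Definition supported_in (K : free_complex k n) (S : pred (fbasis K)) (y : carrier K) : Prop :=
  forall W, y W != 0 -> S W.

(** S selects the basis vectors of the Koszul algebra on the current cover, inside the algebra on
    all variables. *)
Record exact_subcomplex (K : free_complex k n) (muK : product K) (S : pred (fbasis K)) : Prop :=
  ExactSubcomplex {
  sub_mul : forall x y, supported_in S x -> supported_in S y -> supported_in S (pmul muK x y);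
  sub_diff : forall x, supported_in S x -> supported_in S (differential x);
  sub_exact : forall p (x : carrier K), supported_in S x -> homogeneous p.+1 x ->
    differential x = 0 ->
    exists y : carrier K, [/\ supported_in S y, homogeneous p.+2 y & differential y = x]
}.

(** What the induction carries along with the resolution: a multigraded dg morphism to K, given on
    the basis, with image in the subcomplex. The entries of t, up to sign, become entries of the
    next differential, so [cmp_minimal] is what keeps that one minimal; b0 is exempt, being sent to
    the unit, and s b0 is not a basis vector of the next resolution. *)
Record comparison (F : free_complex k n) (mu : product F) (b0 : fbasis F)
    (K : free_complex k n) (muK : product K) (k0 : fbasis K) (S : pred (fbasis K))
    (t : fbasis F -> carrier K) : Prop := Comparison {
  cmp_hdeg : forall b W, t b W != 0 -> hdeg W = hdeg b;
  cmp_mdg : forall b W m, m \in msupp (t b W : Q) -> (m + mdg W)%MM = mdg b;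
  cmp_supp : forall b W, t b W != 0 -> S W;
  cmp_minimal : forall b W, b != b0 -> (t b W : Q)@_0%MM = 0;
  cmp_b0 : t b0 = bvec k0;
  cmp_diff : forall x, lin_ext t (differential x) = differential (lin_ext t x);
  cmp_mul : forall x y, lin_ext t (pmul mu x y) = pmul muK (lin_ext t x) (lin_ext t y)
}.

Lemma resolves_minimal (I : Q -> Prop) F (mu : product F) (b0 : fbasis F) :
  resolves I mu b0 ->
  [/\ minimal_free_resolution F I, dg_algebra mu & strictly_commutative mu].
Proof.
case=> -[H Hm H0 Hmdg] Hex HI.
split; [|exact: dga_dg_algebra H|exact: dga_strictly_commutative H].
split; last by move=> b b'; apply/irrelevant_idealP.
split; [exact: dga_chain H | exact: Hm | exact: Hex |].
pose aug (x : carrier F) : Q^o := x b0.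
have aug_lin : linear aug by move=> a x y; rewrite /aug carrierDE carrierZE.
pose augL : {linear carrier F -> Q^o} :=
  HB.pack aug (GRing.isLinear.Build Q (carrier F) Q^o _ aug aug_lin).
exists augL; split; rewrite /augL /=.
- move=> b m hb; have /eqP-> : b == b0 by rewrite -(dga_deg0 H) hb.
  by rewrite /aug bvecE eqxx Hmdg msupp1 inE => /eqP.
- exists (bvec b0); split; first exact: homogeneous_b0 H.
  rewrite /aug bvecE eqxx subrr; apply/HI; exists 0; rewrite diff0 scale0r.
  by split; first exact: homogeneous0.
by move=> x hx; rewrite {2}(homogeneous0E H hx); apply: HI.
Qed.

Section LinExt.
Variables (F K : free_complex k n) (t : fbasis F -> carrier K).

Lemma lin_ext_homogeneous : (forall b W, t b W != 0 -> hdeg W = hdeg b) ->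
  forall p x, homogeneous p x -> homogeneous p (lin_ext t x).
Proof.
move=> ht p x hx W; rewrite lin_extE => H.
have /existsP[b /andP[xb tb]] : [exists b, (x b != 0) && (t b W != 0)].
  apply: contraNT H => /existsPn H; rewrite big1 // => b _.
  have := H b; rewrite negb_and !negbK => /orP[/eqP->|/eqP->]; first by rewrite mul0r.
  by rewrite mulr0.
by rewrite (ht _ _ tb) (hx _ xb).
Qed.

Lemma lin_ext_supported (S : pred (fbasis K)) : (forall b W, t b W != 0 -> S W) ->
  forall x, supported_in S (lin_ext t x).
Proof.
move=> ht x W; rewrite lin_extE => H.
have /existsP[b tb] : [exists b, t b W != 0]; last exact: ht tb.
apply: contraNT H => /existsPn H; rewrite big1 // => b _.
by have := H b; rewrite negbK => /eqP->; rewrite mulr0.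
Qed.

End LinExt.

Section SupportedIn.
Variables (K : free_complex k n) (S : pred (fbasis K)).

Lemma supported_inD (x y : carrier K) :
  supported_in S x -> supported_in S y -> supported_in S (x + y).
Proof.
move=> hx hy W; rewrite carrierDE => H; apply: contraNT H => SW.
have -> : x W = 0 by apply/eqP; apply: contraNT SW; apply: hx.
have -> : y W = 0 by apply/eqP; apply: contraNT SW; apply: hy.
by rewrite addr0.
Qed.

Lemma supported_inZ (a : Q) (x : carrier K) : supported_in S x -> supported_in S (a *: x).
Proof.
by move=> hx W; rewrite carrierZE => H; apply: hx; apply: contraNneq H => ->; rewrite mulr0.
Qed.

End SupportedIn.

(** * The subalgebra of G + s G + K attached to a comparison map *)

Section Transfer.
Variables (F : free_complex k n) (mu : product F) (b0 : fbasis F).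
Variables (K : free_complex k n) (muK : product K) (k0 : fbasis K).
Variables (S : pred (fbasis K)) (t : fbasis F -> carrier K) (I : Q -> Prop) (z : Q).
Hypotheses (resF : resolves I mu b0) (resK : multigraded_minimal muK k0).
Hypotheses (subS : exact_subcomplex muK S) (cmp : comparison mu b0 muK k0 S t).
Hypothesis z_regular : forall q, I (z * q) -> I q.

Let HF := mm_dga (res_mm resF).
Let HK := mm_dga resK.

Local Notation tau := (lin_ext t).

Lemma tau_eps x : tau (eps x) = eps (tau x).
Proof.
move: x; apply: linear_eq_basis => [a x y|a x y|b].
- by rewrite [eps _]linearP /= linearP.
- by rewrite [lin_ext _ _]linearP /= linearP.
rewrite eps_bvec linearZ /= lin_ext_bvec; apply/esym/eps_homogeneous => W.
exact: cmp_hdeg cmp _ _.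
Qed.

Lemma tau_b0 x : (tau x) k0 = x b0.
Proof.
rewrite lin_extE (bigD1 b0) // (cmp_b0 cmp) bvecE eqxx mulr1 big1 => [|b bb0]; first exact: addr0.
have -> : t b k0 = 0; last by rewrite mulr0.
apply/eqP; apply: contraNT bb0 => /(cmp_hdeg cmp); rewrite -(dga_deg0 HF) => <-.
by rewrite (dga_deg0 HK).
Qed.

Let diff_diff (G : free_complex k n) (m : product G) g0 (H : dga m g0) :
  forall x, differential (differential x) = 0 := (dga_chain H).2.

Definition coord (G : free_complex k n) (g0 : fbasis G) (x : carrier G) : Q^o := x g0.
Lemma coord_is_linear (G : free_complex k n) (g0 : fbasis G) : linear (coord g0).
Proof. by move=> a x y; rewrite /coord carrierDE carrierZE. Qed.
HB.instance Definition _ (G : free_complex k n) (g0 : fbasis G) :=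
  GRing.isLinear.Build Q (carrier G) Q^o _ (coord g0) (coord_is_linear g0).

Definition in_sub (h : carrier F) (e : carrier K) : Prop :=
  [/\ supported_in S e, e k0 = 0 & h b0 = differential e k0].

Definition big_hom p (g h : carrier F) (e : carrier K) : Prop :=
  [/\ homogeneous p g, if p is p'.+1 then homogeneous p' h else h = 0 & homogeneous p e].

Definition mul_g (g h : carrier F) (e : carrier K) (g' h' : carrier F) (e' : carrier K) :=
  pmul mu g g'.
Definition mul_h (g h : carrier F) (e : carrier K) (g' h' : carrier F) (e' : carrier K) :=
  pmul mu h g' + pmul mu (eps g) h'.
Definition mul_e (g h : carrier F) (e : carrier K) (g' h' : carrier F) (e' : carrier K) :=
  pmul muK (tau g) e' + pmul muK e (tau g') + z *: pmul muK e e'.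
Definition diff_g (g h : carrier F) (e : carrier K) := differential g + z *: h.
Definition diff_h (g h : carrier F) (e : carrier K) := - differential h.
Definition diff_e (g h : carrier F) (e : carrier K) := differential e - tau h.

Lemma in_subM g h e g' h' e' : in_sub h e -> in_sub h' e' ->
  in_sub (mul_h g h e g' h' e') (mul_e g h e g' h' e').
Proof.
exact: (@big_subM _ _ _ (pmul mu) (pmul muK) z (@eps k n F) (@differential k n K)
  (@eps k n K) tau (dga_leibniz HK) (coord b0) (coord k0) (supported_in S)
  (pmul_b0 HF) (pmul_b0 HK) (eps_b0 HF) (eps_b0 HK) tau_b0 (@supported_inD _ _)
  (@supported_inZ _ _) (sub_mul subS) (lin_ext_supported (cmp_supp cmp)) g h e g' h' e').
Qed.

Lemma in_sub_diff g h e : in_sub h e -> in_sub (diff_h g h e) (diff_e g h e).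
Proof.
have L := @big_sub_diff Q (carrier F) (carrier K) (@differential k n F) (@differential k n K) tau
  (cmp_diff cmp).
have {}L := L (diff_diff HK).
have {}L := L (coord b0) (coord k0) (supported_in S) tau_b0.
exact: (L (@supported_inD _ _) (@supported_inZ _ _) (sub_diff subS)
  (lin_ext_supported (cmp_supp cmp)) h e).
Qed.

(** * A complex F' identified with the subalgebra by an embedding (ig, ih, ie) with inverse rho *)

Variables (F' : free_complex k n) (mu' : product F') (b0' : fbasis F').
Variables (ig ih : {linear carrier F' -> carrier F}) (ie : {linear carrier F' -> carrier K}).
Variable (rho : carrier F -> carrier F -> carrier K -> carrier F').
Hypothesis iota_inj : forall x y, ig x = ig y -> ih x = ih y -> ie x = ie y -> x = y.
Hypothesis iota_sub : forall y, in_sub (ih y) (ie y).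
Hypothesis iotaK : forall g h e, in_sub h e ->
  [/\ ig (rho g h e) = g, ih (rho g h e) = h & ie (rho g h e) = e].
Hypothesis diff'E : forall y, differential y =
  rho (diff_g (ig y) (ih y) (ie y)) (diff_h (ig y) (ih y) (ie y)) (diff_e (ig y) (ih y) (ie y)).
Hypothesis mul'E : forall x y, pmul mu' x y =
  rho (mul_g (ig x) (ih x) (ie x) (ig y) (ih y) (ie y))
      (mul_h (ig x) (ih x) (ie x) (ig y) (ih y) (ie y))
      (mul_e (ig x) (ih x) (ie x) (ig y) (ih y) (ie y)).
Hypothesis unit' : unit_elt mu' = bvec b0'.
Hypothesis iota1 : [/\ ig (bvec b0') = bvec b0, ih (bvec b0') = 0 & ie (bvec b0') = 0].
Hypothesis iota_hom : forall p y, homogeneous p y -> big_hom p (ig y) (ih y) (ie y).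
Hypothesis rho_hom : forall p g h e, big_hom p g h e -> homogeneous p (rho g h e).
Hypothesis deg0' : forall b, (hdeg b == 0%N) = (b == b0').

Local Notation iota y := (ig y, ih y, ie y).

Lemma iota_diff y : iota (differential y) =
  big_diff z (@differential k n F) (@differential k n K) tau (iota y).
Proof.
have [eg eh ee] := iotaK (diff_g (ig y) (ih y) (ie y)) (in_sub_diff (ig y) (iota_sub y)).
by rewrite diff'E eg eh ee.
Qed.

Lemma iota_mul x y : iota (pmul mu' x y) =
  big_mul (pmul mu) (pmul muK) z (@eps k n F) tau (iota x) (iota y).
Proof.
have [eg eh ee] := iotaK (mul_g (ig x) (ih x) (ie x) (ig y) (ih y) (ie y))
  (in_subM (ig x) (ig y) (iota_sub x) (iota_sub y)).
by rewrite mul'E eg eh ee.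
Qed.

Lemma iota_injective : injective (fun y => iota y).
Proof. by move=> x y [eg eh ee]; apply: iota_inj. Qed.

Lemma iota_eps y : iota (eps y) =
  @big_eps Q (carrier F) (carrier K) (@eps k n F) (@eps k n K) (iota y).
Proof.
have E b : [/\ ig (eps (bvec b)) = eps (ig (bvec b)), ih (eps (bvec b)) = - eps (ih (bvec b))
    & ie (eps (bvec b)) = eps (ie (bvec b))].
  have [hg hh he] := iota_hom (@homogeneous_bvec _ _ F' b).
  rewrite eps_bvec !linearZ /= (eps_homogeneous hg) (eps_homogeneous he); split=> //.
  case: (hdeg b) hh => [|p] hh; first by rewrite hh [eps 0]linear0 oppr0 scaler0.
  by rewrite (eps_homogeneous hh) exprS mulN1r scaleNr.
have -> : ig (eps y) = eps (ig y).
  move: y; apply: linear_eq_basis => [a x y|a x y|b]; last by case: (E b).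
    by rewrite [eps _]linearP /= linearP.
  by rewrite [ig _]linearP /= linearP.
have -> : ih (eps y) = - eps (ih y).
  move: y; apply: linear_eq_basis => [a x y|a x y|b]; last by case: (E b).
    by rewrite [eps _]linearP /= linearP.
  by rewrite [ih _]linearP /= linearP opprD scalerN.
have -> // : ie (eps y) = eps (ie y).
move: y; apply: linear_eq_basis => [a x y|a x y|b]; last by case: (E b).
  by rewrite [eps _]linearP /= linearP.
by rewrite [ie _]linearP /= linearP.
Qed.

Lemma big_hom_diff p g h e : big_hom p.+1 g h e ->
  big_hom p (diff_g g h e) (diff_h g h e) (diff_e g h e).
Proof.
move=> [hg hh he]; split.
- by apply: homogeneousD; [exact: (diff_homogeneous (dga_chain HF)) | exact: homogeneousZ].
- case: p hh {hg he} => [|p] hh.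
    by rewrite /diff_h (diff_homogeneous0 (dga_chain HF) hh) oppr0.
  by apply/homogeneousN/(diff_homogeneous (dga_chain HF)).
apply: homogeneousD; first exact: (diff_homogeneous (dga_chain HK)).
exact/homogeneousN/(lin_ext_homogeneous (cmp_hdeg cmp)).
Qed.

Lemma transfer_hdeg (b c : fbasis F') : diff_basis b c != 0 -> hdeg b = (hdeg c).+1.
Proof.
rewrite -diff_bvec => H; case E: (hdeg b) => [|p].
  move/eqP: E; rewrite deg0' => /eqP bb0; move: H; rewrite bb0.
  suff -> : differential (bvec b0') = 0 by rewrite carrier0E eqxx.
  have [eg eh ee] := iota1; apply: iota_injective; rewrite iota_diff eg eh ee.
  congr (_, _, _); rewrite /= ?[ig 0]linear0 ?[ih 0]linear0 ?[ie 0]linear0.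
  - rewrite (diff_homogeneous0 (dga_chain HF) (homogeneous_b0 HF)) scaler0; exact: addr0.
  - rewrite diff0; exact: oppr0.
  - rewrite diff0 [lin_ext _ 0]linear0; exact: subr0.
congr _.+1; have hb : homogeneous p.+1 (bvec b) by rewrite -E; apply: homogeneous_bvec.
by have := rho_hom (big_hom_diff (iota_hom hb)); rewrite -diff'E => /(_ c H).
Qed.

Lemma big_hom_mul p q g h e g' h' e' : big_hom p g h e -> big_hom q g' h' e' ->
  big_hom (p + q) (mul_g g h e g' h' e') (mul_h g h e g' h' e') (mul_e g h e g' h' e').
Proof.
move=> H H'.
have L := @big_homogeneousM Q (carrier F) (carrier K) (pmul mu) (pmul muK) z (@eps k n F) tau
  (pmul_bilinear mu) (@homogeneous k n F) (@homogeneous k n K).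
have {}L := L (@homogeneousD _ _ _) (@homogeneousZ _ _ _) (@homogeneousD _ _ _)
  (@homogeneousZ _ _ _).
have {}L := L (pmul_homogeneous HF) (pmul_homogeneous HK).
have {}L := L (lin_ext_homogeneous (cmp_hdeg cmp)) (@eps_homogeneous _ _ _).
exact: (L p q (g, h, e) (g', h', e') H H').
Qed.

Lemma transfer_mulC p q x y : homogeneous p x -> homogeneous q y ->
  pmul mu' x y = (-1 : Q) ^+ (p * q) *: pmul mu' y x.
Proof.
have L := @embedded_mulC Q (carrier F) (carrier K) (pmul mu) (pmul muK) z (@eps k n F) tau
  (pmul_bilinear mu) (@homogeneous k n F) (@homogeneous k n K).
have {}L := L (lin_ext_homogeneous (cmp_hdeg cmp)) (@eps_homogeneous _ _ _).
have {}L := L (pmul_comm HF) (pmul_comm HK).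
have {}L := L (carrier F') (pmul mu') ig ih ie (@homogeneous k n F') iota_injective.
exact: (L iota_mul iota_hom).
Qed.

Lemma transfer_mul_sq p x : odd p -> homogeneous p x -> pmul mu' x x = 0.
Proof.
have L := @embedded_mul_sq Q (carrier F) (carrier K) (pmul mu) (pmul muK) z (@eps k n F) tau
  (pmul_bilinear mu) (@homogeneous k n F) (@homogeneous k n K).
have {}L := L (lin_ext_homogeneous (cmp_hdeg cmp)) (@eps_homogeneous _ _ _).
have {}L := L (pmul_comm HF) (pmul_comm HK).
have {}L := L (pmul_sq HF) (pmul_sq HK).
have {}L := L (carrier F') (pmul mu') ig ih ie (@homogeneous k n F') iota_injective.
exact: (L iota_mul iota_hom).
Qed.

Lemma transfer_mulA : associative (pmul mu').
Proof.
have L := @embedded_mulA Q (carrier F) (carrier K) (pmul mu) (pmul muK) z (@eps k n F) tau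
  (pmul_bilinear mu) (pmul_bilinear muK) (dga_mulA HF) (dga_mulA HK).
have {}L := L (eps_pmul HF) (cmp_mul cmp).
exact: (L (carrier F') (pmul mu') ig ih ie iota_injective iota_mul).
Qed.

Lemma transfer_leibniz x y : differential (pmul mu' x y) =
  pmul mu' (differential x) y + pmul mu' (eps x) (differential y).
Proof.
have L := @embedded_diffM Q (carrier F) (carrier K) (pmul mu) (pmul muK) z
  (@differential k n F) (@eps k n F) (@differential k n K) (@eps k n K) tau
  (pmul_bilinear mu) (pmul_bilinear muK) (@epsK _ _ F).
have {}L := L (fun x => eps_diff x (dga_chain HF)).
have {}L := L (dga_leibniz HF) (dga_leibniz HK).
have {}L := L (cmp_mul cmp) (cmp_diff cmp) tau_eps.
have {}L := L (carrier F') (pmul mu') (@differential k n F') (@eps k n F') ig ih ie.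
exact: (L iota_injective iota_mul iota_diff iota_eps).
Qed.

Lemma transfer_diff_diff (y : carrier F') : differential (differential y) = 0.
Proof.
have L := @embedded_diff_diff Q (carrier F) (carrier K) z
  (@differential k n F) (@differential k n K) tau (cmp_diff cmp).
have {}L := L (diff_diff HF) (diff_diff HK).
have {}L := L (carrier F') (@differential k n F') ig ih ie.
exact: (L iota_injective iota_diff).
Qed.

Lemma transfer_unit : left_id (bvec b0') (pmul mu') /\ right_id (bvec b0') (pmul mu').
Proof.
have [eg eh ee] := iota1.
have i1 : iota (bvec b0') = (bvec b0, 0, 0) by rewrite eg eh ee.
have t0 : tau (bvec b0) = bvec k0 by rewrite lin_ext_bvec (cmp_b0 cmp).
split.
  have L := @embedded_mul1 Q (carrier F) (carrier K) (pmul mu) (pmul muK) z (@eps k n F) tau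
    (pmul_bilinear mu) (pmul_bilinear muK).
  have {}L := L (carrier F') (pmul mu') ig ih ie iota_injective iota_mul _ _ _ i1 t0.
  have e0 : eps (bvec b0) = bvec b0.
    by rewrite (eps_homogeneous (homogeneous_b0 HF)) expr0 scale1r.
  exact: (L e0 (dga_mul1 HF) (dga_mul1 HK)).
have L := @embedded_mulr1 Q (carrier F) (carrier K) (pmul mu) (pmul muK) z (@eps k n F) tau
  (pmul_bilinear mu) (pmul_bilinear muK).
have {}L := L (carrier F') (pmul mu') ig ih ie iota_injective iota_mul _ _ _ i1 t0.
exact: (L (dga_mulr1 HF) (dga_mulr1 HK)).
Qed.

Lemma transfer_dga : dga mu' b0'.
Proof.
have [u1 u2] := transfer_unit.
split.
- exact: deg0'.
- exact: unit'.
- by split=> [b c|x]; [exact: transfer_hdeg | exact: transfer_diff_diff].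
- exact: transfer_mulA.
- exact: u1.
- exact: u2.
- move=> b b' c; rewrite -pmul_bvec mul'E.
  by apply: rho_hom; apply: big_hom_mul; apply: iota_hom; apply: homogeneous_bvec.
- exact: transfer_leibniz.
- by move=> b b'; rewrite -!pmul_bvec; apply: transfer_mulC; apply: homogeneous_bvec.
by move=> b ob; rewrite -pmul_bvec; apply: transfer_mul_sq ob _; apply: homogeneous_bvec.
Qed.

Lemma transfer_exact p (y : carrier F') : homogeneous p.+1 y -> differential y = 0 ->
  exists y' : carrier F', homogeneous p.+2 y' /\ differential y' = y.
Proof.
move=> yp dy; have [hg hh he] := iota_hom yp; have [eS ek0 hb0] := iota_sub y.
have := iota_diff y; rewrite dy !linear0 /big_diff /= => -[/esym dg /esym dh /esym de].
set g := ig y in dg hg; set h := ih y in dg dh de hh hb0; set e := ie y in de he eS ek0 hb0.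
have {}dh : differential h = 0 by apply/eqP; rewrite -oppr_eq0; apply/eqP.
have [w [wp wh]] : exists w : carrier F, homogeneous p.+1 w /\ differential w = h.
  case: p {yp} hg hh he => [|p] hg hh he; last exact: res_exact resF _ _ hh dh.
  (* In degree 0, h is q times the unit, and dg = - z h says that z q lies in I; so q lies in I, and
     h is a boundary. *)
  rewrite (homogeneous0E HF hh); apply/(res_ideal resF)/z_regular/(res_ideal resF).
  exists (- g); split; first exact: homogeneousN.
  rewrite diffN -scalerA -(homogeneous0E HF hh); apply/eqP.
  by rewrite eq_sym -subr_eq0 opprK addrC dg.
have [g' [g'p dg']] : exists g' : carrier F, homogeneous p.+2 g' /\ differential g' = g + z *: w.
  apply: (res_exact resF); first by apply: homogeneousD => //; apply: homogeneousZ.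
  by rewrite diffD diffZ wh.
have [e' [e'S e'p de']] : exists e' : carrier K,
    [/\ supported_in S e', homogeneous p.+2 e' & differential e' = e - tau w].
  have tS : supported_in S (tau w) by apply: (lin_ext_supported (cmp_supp cmp)).
  have tp : homogeneous p.+1 (tau w) := lin_ext_homogeneous (cmp_hdeg cmp) wp.
  apply: (sub_exact subS).
  - by apply: supported_inD => //; rewrite -scaleN1r; apply: supported_inZ.
  - by apply: homogeneousD => //; apply: homogeneousN.
  by rewrite diffD diffN -(cmp_diff cmp) wh.
have k00 q : hdeg k0 != q.+1 by rewrite (eqP (etrans (dga_deg0 HK k0) (eqxx k0))).
have b00 q : hdeg b0 != q.+1 by rewrite (eqP (etrans (dga_deg0 HF b0) (eqxx b0))).
have sub' : in_sub (- w) e'.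
  split; [exact: e'S | exact: homogeneous_eq0 e'p _ | ].
  have ep : homogeneous p.+1 (differential e') by apply: (diff_homogeneous (dga_chain HK)).
  by rewrite (homogeneous_eq0 ep) // carrierNE (homogeneous_eq0 wp) // oppr0.
exists (rho g' (- w) e'); split; first by apply: rho_hom; split => //=; apply: homogeneousN.
have [eg eh ee] := iotaK g' sub'.
apply: iota_injective; rewrite iota_diff eg eh ee.
exact: (big_diff_lift (esym wh) (esym dg') (esym de')).
Qed.

(** For an element (g, h, e) of degree 1 of the subalgebra, h is forced to be the coefficient of de
    at the unit, times the unit; so the boundary is dg + z de, the two terms running through I and z
    (C). *)
Lemma transfer_ideal q :
  (exists q1 (e : carrier K), [/\ I q1, supported_in S e, homogeneous 1 e &
     q = q1 + z * (differential e k0 : Q)]) <->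
  (exists y : carrier F', homogeneous 1 y /\ differential y = q *: bvec b0').
Proof.
have [bg bh be] := iota1.
have k00 q' : hdeg k0 != q'.+1 by rewrite (eqP (etrans (dga_deg0 HK k0) (eqxx k0))).
split=> [[q1 [e [/(res_ideal resF)[g [g1 dg]] eS e1 ->]]]|[y [y1 dy]]].
  pose h : carrier F := (differential e k0 : Q) *: bvec b0.
  have h0 : homogeneous 0 h by apply/homogeneousZ/homogeneous_b0/HF.
  have de0 : homogeneous 0 (differential e) by apply: (diff_homogeneous (dga_chain HK)).
  have sub' : in_sub h e.
    split; [exact: eS | exact: homogeneous_eq0 e1 _ | ].
    by rewrite /h carrierZE bvecE eqxx mulr1.
  exists (rho g h e); split; first by apply: rho_hom; split.
  have [eg eh ee] := iotaK g sub'.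
  apply: iota_injective; rewrite iota_diff eg eh ee; congr (_, _, _) => /=.
  - by rewrite [ig (_ *: _)]linearZ /= bg dg /h scalerA scalerDl.
  - rewrite [ih (_ *: _)]linearZ /= bh scaler0 (diff_homogeneous0 (dga_chain HF) h0).
    exact: oppr0.
  rewrite [ie (_ *: _)]linearZ /= be scaler0 /h [lin_ext _ _]linearZ /= lin_ext_bvec (cmp_b0 cmp).
  rewrite -(homogeneous0E HK de0); exact: subrr.
have [g1 h0 e1] := iota_hom y1; have [eS _ hb0] := iota_sub y.
have := iota_diff y; rewrite dy !linearZ /= bg bh be /big_diff /= => -[dg _ _].
exists (q - z * (differential (ie y) k0 : Q)), (ie y); split=> //; last by rewrite subrK.
apply/(res_ideal resF); exists (ig y); split=> //.
by rewrite scalerBl dg -hb0 -scalerA -(homogeneous0E HF h0) addrK.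
Qed.

End Transfer.
End Resolutions.

(** * An explicit basis of the subalgebra *)

Section Extension.
Variables (k : fieldType) (n : nat).
Local Notation Q := {mpoly k[n]}.
Variables (F : free_complex k n) (mu : product F) (b0 : fbasis F).
Variables (K : free_complex k n) (muK : product K) (k0 : fbasis K).
Variables (S : pred (fbasis K)) (t : fbasis F -> carrier K) (z : 'I_n).

Local Notation tau := (lin_ext t).
Local Notation Z := ('X_z : Q).

(** In this order: the basis of G; the basis vectors e_W of positive degree of the subcomplex,
    corrected by the multiple of s that removes 1_K from their boundary; and s times the basis of G
    in positive degree. The unit of G is then alone in degree 0. *)
Definition ext_basis : finType :=
  (fbasis F + {W : fbasis K | S W && (W != k0)} + {b : fbasis F | b != b0})%type.

Definition ext_hdeg (c : ext_basis) : nat :=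
  match c with
  | inl (inl b) => hdeg b
  | inl (inr W) => hdeg (val W)
  | inr b => (hdeg (val b)).+1
  end.

(** The vectors of K stand for their multiples by z, and s has the multidegree of z. *)
Definition ext_mdg (c : ext_basis) : 'X_{1..n} :=
  match c with
  | inl (inl b) => mdg b
  | inl (inr W) => (U_(z) + mdg (val W))%MM
  | inr b => (U_(z) + mdg (val b))%MM
  end.

Definition ig_basis (c : ext_basis) : carrier F :=
  if c is inl (inl b) then bvec b else 0.

Definition ih_basis (c : ext_basis) : carrier F :=
  match c with
  | inl (inl _) => 0
  | inl (inr W) => (differential (bvec (val W)) k0 : Q) *: bvec b0
  | inr b => bvec (val b)
  end.

Definition ie_basis (c : ext_basis) : carrier K :=
  if c is inl (inr W) then bvec (val W) else 0.

(** Coordinates on the basis. The coefficient of h at b0 and those of e at k0 and outside S are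
    dropped; on the subalgebra they are determined by the others. *)
Definition ext_rho (g h : carrier F) (e : carrier K) : {ffun ext_basis -> Q^o} :=
  [ffun c => match c with
             | inl (inl b) => g b
             | inl (inr W) => e (val W)
             | inr b => h (val b)
             end].

Definition ext_diff (c : ext_basis) : {ffun ext_basis -> Q^o} :=
  ext_rho (diff_g Z (ig_basis c) (ih_basis c) (ie_basis c))
          (diff_h (ig_basis c) (ih_basis c) (ie_basis c))
          (diff_e t (ig_basis c) (ih_basis c) (ie_basis c)).

Definition ext_complex : free_complex k n := FreeComplex ext_hdeg ext_mdg ext_diff.

Definition ext_product : product ext_complex :=
  @Product k n ext_complex
    (fun c c' => ext_rho
      (mul_g mu (ig_basis c) (ih_basis c) (ie_basis c) (ig_basis c') (ih_basis c') (ie_basis c'))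
      (mul_h mu (ig_basis c) (ih_basis c) (ie_basis c) (ig_basis c') (ih_basis c') (ie_basis c'))
      (mul_e muK t Z
         (ig_basis c) (ih_basis c) (ie_basis c) (ig_basis c') (ih_basis c') (ie_basis c')))
    (@bvec k n ext_complex (inl (inl b0))).

Definition ext_map (c : ext_basis) : carrier K := tau (ig_basis c) + Z *: ie_basis c.

Local Notation F' := ext_complex.
Local Notation ig := (@lin_ext k n F' F ig_basis).
Local Notation ih := (@lin_ext k n F' F ih_basis).
Local Notation ie := (@lin_ext k n F' K ie_basis).
Local Notation rho := (ext_rho : carrier F -> carrier F -> carrier K -> carrier F').

Lemma ext_rhoE g h e c : rho g h e c = match c with
             | inl (inl b) => g b
             | inl (inr W) => e (val W)
             | inr b => h (val b)
             end.
Proof. by rewrite ffunE. Qed.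

Lemma ext_rhoP (a : Q) g h e g' h' e' :
  rho (a *: g + g') (a *: h + h') (a *: e + e') = a *: rho g h e + rho g' h' e'.
Proof.
apply/ffunP=> c; rewrite carrierDE carrierZE !ext_rhoE.
by case: c => [[b|W]|b]; rewrite carrierDE carrierZE.
Qed.

Lemma igE (y : carrier F') b : ig y b = y (inl (inl b)).
Proof.
rewrite lin_extE (bigD1 (inl (inl b) : fbasis F')) // big1 => [|[[b'|W]|b']] /=.
- by rewrite /ig_basis bvecE eqxx mulr1; exact: addr0.
- by move=> bb'; rewrite bvecE; case: (b =P b') bb' => [->|]; rewrite ?eqxx ?mulr0.
- by rewrite carrier0E mulr0.
by rewrite carrier0E mulr0.
Qed.

Lemma ieE (y : carrier F') (W : {W : fbasis K | S W && (W != k0)}) :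
  ie y (val W) = y (inl (inr W)).
Proof.
rewrite lin_extE (bigD1 (inl (inr W) : fbasis F')) // big1 => [|[[b'|W']|b']] /=.
- by rewrite /ie_basis bvecE eqxx mulr1; exact: addr0.
- by rewrite carrier0E mulr0.
- move=> WW'; rewrite bvecE; case: (val W =P val W') WW' => [/val_inj->|]; rewrite ?eqxx //.
  by rewrite mulr0.
by rewrite carrier0E mulr0.
Qed.

Lemma ie0 (y : carrier F') W : ~~ (S W && (W != k0)) -> ie y W = 0.
Proof.
move=> SW; rewrite lin_extE big1 // => -[[b'|W']|b'] _ /=; rewrite ?carrier0E ?mulr0 //.
by rewrite bvecE; case: (W =P val W') SW => [->|]; rewrite ?(valP W') ?mulr0.
Qed.

Lemma ihE (y : carrier F') (b : {b : fbasis F | b != b0}) : ih y (val b) = y (inr b).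
Proof.
rewrite lin_extE (bigD1 (inr b : fbasis F')) // big1 => [|[[b'|W']|b']] /=.
- by rewrite /ih_basis bvecE eqxx mulr1; exact: addr0.
- by rewrite carrier0E mulr0.
- by rewrite carrierZE bvecE (negPf (valP b)) !mulr0.
move=> bb'; rewrite bvecE; case: (val b =P val b') bb' => [/val_inj->|]; rewrite ?eqxx //.
by rewrite mulr0.
Qed.

Lemma ih_b0 (y : carrier F') : ih y b0 = differential (ie y) k0.
Proof.
move: y; apply: (@linear_eq_basis _ _ F' Q^o (fun y => ih y b0)
  (fun y => differential (ie y) k0)) => [a y y'|a y y'|c].
- by rewrite linearP carrierDE carrierZE.
- by rewrite linearP diffP carrierDE carrierZE.
rewrite !lin_ext_bvec; case: c => [[b|W]|b] /=.
- by rewrite diff0 !carrier0E.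
- by rewrite carrierZE bvecE eqxx mulr1.
by rewrite diff0 carrier0E bvecE eq_sym (negPf (valP b)).
Qed.

Lemma ext_iota_inj (x y : carrier F') : ig x = ig y -> ih x = ih y -> ie x = ie y -> x = y.
Proof.
move=> eg eh ee; apply/ffunP=> -[[b|W]|b]; first by rewrite -!igE eg.
  by rewrite -!ieE ee.
by rewrite -!ihE eh.
Qed.

Lemma ext_iota_sub y : in_sub b0 k0 S (ih y) (ie y).
Proof.
split; last exact: ih_b0.
  by move=> W; apply: contraNT => SW; rewrite ie0 ?(negPf SW).
by rewrite ie0 // eqxx andbF.
Qed.

Lemma ext_iotaK g h e : in_sub b0 k0 S h e ->
  [/\ ig (rho g h e) = g, ih (rho g h e) = h & ie (rho g h e) = e].
Proof.
move=> [eS ek0 hb0].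
have ieK : ie (rho g h e) = e.
  apply/ffunP=> W; have [SW|SW] := boolP (S W && (W != k0)).
    by rewrite -[W]/(val (Sub W SW : {W : fbasis K | S W && (W != k0)})) ieE ext_rhoE.
  rewrite ie0 //; have [->|Wk0] := eqVneq W k0; first by rewrite ek0.
  apply/esym/eqP; apply: contraNT SW; rewrite Wk0 andbT; exact: eS.
split=> //; first by apply/ffunP=> b; rewrite igE ext_rhoE.
apply/ffunP=> b; have [->|bb0] := eqVneq b b0; first by rewrite ih_b0 ieK hb0.
by rewrite -[b]/(val (Sub b bb0 : {b : fbasis F | b != b0})) ihE ext_rhoE.
Qed.

Lemma ext_diffE (y : carrier F') : differential y =
  rho (diff_g Z (ig y) (ih y) (ie y)) (diff_h (ig y) (ih y) (ie y)) (diff_e t (ig y) (ih y) (ie y)).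
Proof.
move: y; apply: (@linear_eq_basis _ _ F' (carrier F')) => [a y y'|a y y'|c].
- exact: diffP.
- rewrite -ext_rhoP [ig _]linearP [ih _]linearP [ie _]linearP /=.
  congr ext_rho; rewrite /diff_g /diff_h /diff_e !diffP ?[lin_ext t _]linearP /=.
  + by rewrite !scalerDr !scalerA [a * _]mulrC addrACA.
  + by rewrite opprD scalerN.
  by rewrite scalerBr opprD addrACA.
by rewrite diff_bvec !lin_ext_bvec.
Qed.

Lemma ext_mulE (x y : carrier F') : pmul ext_product x y =
  rho (mul_g mu (ig x) (ih x) (ie x) (ig y) (ih y) (ie y))
      (mul_h mu (ig x) (ih x) (ie x) (ig y) (ih y) (ie y))
      (mul_e muK t Z (ig x) (ih x) (ie x) (ig y) (ih y) (ie y)).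
Proof.
have [Bl Br] := @big_mul_bilinear Q (carrier F) (carrier K) (pmul mu) (pmul muK) Z (@eps k n F)
  tau (pmul_bilinear mu) (pmul_bilinear muK).
move: x y; apply: (@bilinear_eq_basis _ _ F' (carrier F')) => [||c c'].
- by split=> [u a y y'|y a u u']; [exact: pmulPl | exact: pmulPr].
- split=> [u a y y'|y a u u'];
    rewrite -ext_rhoP [ig (_ + _)]linearP [ih (_ + _)]linearP [ie (_ + _)]linearP /=.
    have [eg eh ee] := Bl a (ig y, ih y, ie y) (ig y', ih y', ie y') (ig u, ih u, ie u).
    by congr ext_rho; [exact: eg | exact: eh | exact: ee].
  have [eg eh ee] := Br a (ig y, ih y, ie y) (ig u, ih u, ie u) (ig u', ih u', ie u').
  by congr ext_rho; [exact: eg | exact: eh | exact: ee].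
by rewrite pmul_bvec !lin_ext_bvec.
Qed.

Lemma ext_mapE (y : carrier F') : @lin_ext k n F' K ext_map y = tau (ig y) + Z *: ie y.
Proof.
move: y; apply: (@linear_eq_basis _ _ F' (carrier K)) => [a y y'|a y y'|c].
- exact: linearP.
- rewrite [ig _]linearP [ie _]linearP [lin_ext t _]linearP /=.
  by rewrite !scalerDr !scalerA [a * _]mulrC addrACA.
by rewrite !lin_ext_bvec.
Qed.

Variable I : Q -> Prop.
Hypotheses (resF : resolves I mu b0) (resK : multigraded_minimal muK k0).
Hypotheses (subS : exact_subcomplex muK S) (cmp : comparison mu b0 muK k0 S t).
Hypothesis z_regular : forall q, I (Z * q) -> I q.

Let HF := mm_dga (res_mm resF).
Let HK := mm_dga resK.

Lemma ext_deg0 (c : fbasis F') : (hdeg c == 0%N) = (c == inl (inl b0)).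
Proof.
case: c => [[b|W]|b] /=; first by rewrite (dga_deg0 HF).
  by rewrite (dga_deg0 HK); case/andP: (valP W) => _ /negPf->.
by [].
Qed.

Let hk0 : hdeg k0 = 0%N. Proof. by apply/eqP; rewrite (dga_deg0 HK). Qed.
Let hb0 : hdeg b0 = 0%N. Proof. by apply/eqP; rewrite (dga_deg0 HF). Qed.

Lemma ext_iota_hom p (y : carrier F') : homogeneous p y -> big_hom p (ig y) (ih y) (ie y).
Proof.
move=> hy.
have he : homogeneous p (ie y).
  move=> W; have [SW|SW] := boolP (S W && (W != k0)); last by rewrite ie0 ?eqxx.
  by rewrite -[W]/(val (Sub W SW : {W : fbasis K | S W && (W != k0)})) ieE => /hy.
split=> //; first by move=> b; rewrite igE => /hy.
case: p hy he => [|p] hy he.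
  apply/ffunP=> b; rewrite carrier0E; have [->|bb0] := eqVneq b b0.
    by rewrite ih_b0 (diff_homogeneous0 (dga_chain HK) he) carrier0E.
  rewrite -[b]/(val (Sub b bb0 : {b : fbasis F | b != b0})) ihE.
  exact: homogeneous_eq0 hy _.
move=> b; have [->|bb0] := eqVneq b b0.
  by rewrite ih_b0 hb0 => /(diff_homogeneous (dga_chain HK) he); rewrite hk0.
by rewrite -[b]/(val (Sub b bb0 : {b : fbasis F | b != b0})) ihE => /hy [].
Qed.

Lemma ext_rho_hom p g h e : big_hom p g h e -> homogeneous p (rho g h e).
Proof.
move=> [hg hh he] c; rewrite ext_rhoE; case: c => [[b|W]|b] /=; [exact: hg | exact: he |].
case: p {hg he} hh => [->|p hh]; first by rewrite carrier0E eqxx.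
by move/hh => ->.
Qed.

Lemma ext_iota1 : [/\ ig (@bvec k n F' (inl (inl b0))) = bvec b0,
  ih (@bvec k n F' (inl (inl b0))) = 0 & ie (@bvec k n F' (inl (inl b0))) = 0].
Proof. by rewrite !lin_ext_bvec. Qed.

Lemma ext_dga : @dga k n F' ext_product (inl (inl b0)).
Proof.
exact: (@transfer_dga k n F mu b0 K muK k0 S t I Z resF resK subS cmp F' ext_product
  (inl (inl b0)) ig ih ie rho ext_iota_inj ext_iota_sub ext_iotaK ext_diffE ext_mulE
  (erefl _) ext_iota1 ext_iota_hom ext_rho_hom ext_deg0).
Qed.

Definition ext_ideal (q : Q) : Prop :=
  exists q1 (e : carrier K), [/\ I q1, supported_in S e, homogeneous 1 e &
     q = q1 + Z * (differential e k0 : Q)].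

Let mhom (a a' : 'X_{1..n}) (q : Q) := forall m, m \in msupp q -> (m + a')%MM = a.

Let mhom0 a a' : mhom a a' 0.
Proof. by move=> m; rewrite msupp0. Qed.

Let mhomZ a a' q : mhom a a' q -> mhom (U_(z) + a)%MM a' (Z * q).
Proof.
move=> H m; rewrite mulrC (perm_mem (msuppMX q U_(z)%MM)) => /mapP[m' m'q ->].
by rewrite -(H _ m'q) addmA.
Qed.

Let mhomN a a' q : mhom a a' q -> mhom a a' (- q).
Proof. by move=> H m; rewrite (perm_mem (msuppN q)); apply: H. Qed.

Let mhomU a a' q : mhom a a' q -> mhom (U_(z) + a)%MM (U_(z) + a')%MM q.
Proof. by move=> H m /H <-; rewrite addmA [(m + _)%MM]addmC -addmA. Qed.

(** The block matrix of the mapping cone of (z, - tau), completed in degree 1 by the boundaries z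
    x_v of the corrected e_v. Multigrading and minimality are read off from it entry by entry. *)
Lemma ext_diff_entry (c c' : fbasis F') :
  (diff_basis c c' : Q) = match c, c' with
  | inl (inl b), inl (inl b') => diff_basis b b'
  | inl (inr W), inl (inl b') => if b' == b0 then Z * (diff_basis (val W) k0 : Q) else 0
  | inl (inr W), inl (inr W') => diff_basis (val W) (val W')
  | inr b, inl (inl b') => if b' == val b then Z else 0
  | inr b, inl (inr W') => - (t (val b) (val W') : Q)
  | inr b, inr b' => - (diff_basis (val b) (val b') : Q)
  | _, _ => 0
  end.
Proof.
have db0 : diff_basis b0 = 0.
  by rewrite -diff_bvec (diff_homogeneous0 (dga_chain HF) (homogeneous_b0 HF)).
have tau0 : tau 0 = 0 by exact: linear0.
rewrite [LHS]ext_rhoE; case: c c' => [[b|W]|b] [[b'|W']|b'] /=;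
  rewrite /diff_g /diff_h /diff_e ?diff0 ?tau0 ?diffZ ?diff_bvec ?db0 ?scaler0
    ?(carrierDE, carrierNE, carrierZE, carrier0E, bvecE).
- exact: addr0.
- by rewrite oppr0; exact: addr0.
- exact: oppr0.
- by case: eqP => _; rewrite ?mulr1 ?mulr0; exact: add0r.
- rewrite [lin_ext t _]linearZ /= carrierZE lin_ext_bvec (cmp_b0 cmp) bvecE.
  by case/andP: (valP W') => _ /negPf->; rewrite mulr0 oppr0; exact: addr0.
- exact: oppr0.
- by case: eqP => _; rewrite ?mulr1 ?mulr0; exact: add0r.
- by rewrite lin_ext_bvec; exact: add0r.
by [].
Qed.

Lemma ext_multigraded : multigraded F'.
Proof.
move=> c c' m; rewrite ext_diff_entry; case: c c' => [[b|W]|b] [[b'|W']|b'] /=.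
- exact: (mm_multigraded (res_mm resF)).
- exact: mhom0.
- exact: mhom0.
- case: eqP => [->|_]; last exact: mhom0.
  apply: mhomZ => m' /(mm_multigraded resK).
  by rewrite (mm_mdg0 resK) (mm_mdg0 (res_mm resF)).
- by apply: mhomU => m'; exact: (mm_multigraded resK).
- exact: mhom0.
- case: eqP => [->|_]; last exact: mhom0.
  by rewrite msuppX inE => /eqP->.
- by apply: mhomN; apply: mhomU => m'; exact: (cmp_mdg cmp).
by apply: mhomN; apply: mhomU => m'; exact: (mm_multigraded (res_mm resF)).
Qed.

Let mcoeff0Z (q : Q) : (Z * q)@_0%MM = 0.
Proof. by rewrite rmorphM /= mcoeffX mnm1_eq0 mul0r. Qed.

Lemma ext_minimal (c c' : fbasis F') : (diff_basis c c' : Q)@_0%MM = 0.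
Proof.
rewrite ext_diff_entry; case: c c' => [[b|W]|b] [[b'|W']|b'] /=; rewrite ?mcoeff0 //.
- exact: (mm_minimal (res_mm resF)).
- by case: eqP => _; rewrite ?mcoeff0Z ?mcoeff0.
- exact: (mm_minimal resK).
- by case: eqP => _; rewrite ?mcoeff0 // -[X in X@_ _]mulr1 mcoeff0Z.
- by rewrite mcoeffN (cmp_minimal cmp) ?oppr0 // (valP b).
by rewrite mcoeffN (mm_minimal (res_mm resF)) oppr0.
Qed.

Lemma ext_resolves : @resolves k n ext_ideal F' ext_product (inl (inl b0)).
Proof.
split.
- split; [exact: ext_dga | exact: ext_multigraded | exact: ext_minimal |].
  exact: (mm_mdg0 (res_mm resF)).
- move=> p y; exact: (@transfer_exact k n F mu b0 K muK k0 S t I Z resF resK subS cmp z_regular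
    F' ig ih ie rho ext_iota_inj ext_iota_sub ext_iotaK ext_diffE ext_iota_hom ext_rho_hom).
move=> q; exact: (@transfer_ideal k n F mu b0 K muK k0 S t I Z resF resK subS cmp
  F' (inl (inl b0)) ig ih ie rho ext_iota_inj ext_iota_sub ext_iotaK ext_diffE ext_iota1
  ext_iota_hom ext_rho_hom).
Qed.

(** The nonzero entries that are added to t are all equal to z, so they lie in the irrelevant ideal;
    acyclicity of the digraph is needed at stage 0 only. *)
Lemma ext_comparison : @comparison k n F' ext_product (inl (inl b0)) K muK k0 S ext_map.
Proof.
have mE (c : fbasis F') W : ext_map c W = match c with
    | inl (inl b) => t b W
    | inl (inr W') => if W == val W' then Z else 0
    | inr b => 0
    end :> Q.
  rewrite carrierDE carrierZE; case: c => [[b|W']|b] /=.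
  - by rewrite lin_ext_bvec carrier0E mulr0; exact: addr0.
  - rewrite [lin_ext t 0]linear0 carrier0E bvecE.
    by case: eqP => _; rewrite ?mulr1 ?mulr0; exact: add0r.
  by rewrite [lin_ext t 0]linear0 !carrier0E mulr0; exact: add0r.
split.
- move=> [[b|W']|b] W; rewrite mE; first exact: (cmp_hdeg cmp).
    by case: (W =P val W') => [->|]; rewrite ?eqxx.
  by rewrite eqxx.
- move=> [[b|W']|b] W m; rewrite mE; first exact: (cmp_mdg cmp).
    case: eqP => [->|]; last by rewrite msupp0.
    by rewrite msuppX inE => /eqP->.
  by rewrite msupp0.
- move=> [[b|W']|b] W; rewrite mE; first exact: (cmp_supp cmp).
    by case: (W =P val W') => [->|]; rewrite ?eqxx //; case/andP: (valP W').
  by rewrite eqxx.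
- move=> [[b|W']|b] W bb0; rewrite mE; first exact: (cmp_minimal cmp).
    by case: eqP => _; rewrite ?mcoeff0 // mcoeffX mnm1_eq0.
  exact: mcoeff0.
- apply/ffunP=> W; rewrite mE; by rewrite (cmp_b0 cmp).
- move=> y; rewrite !ext_mapE.
  have iE : (ig (differential y), ih (differential y), ie (differential y)) =
     big_diff Z (@differential k n F) (@differential k n K) tau (ig y, ih y, ie y).
    exact: (@iota_diff k n F mu b0 K muK k0 S t I Z resF resK subS cmp
      F' ig ih ie rho ext_iota_sub ext_iotaK ext_diffE).
  have := @big_tau_diff Q (carrier F) (carrier K) Z (@differential k n F) (@differential k n K)
    tau (cmp_diff cmp) (ig y, ih y, ie y).
  by rewrite -iE.
move=> x y; rewrite !ext_mapE.
have iE : (ig (pmul ext_product x y), ih (pmul ext_product x y), ie (pmul ext_product x y)) =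
    big_mul (pmul mu) (pmul muK) Z (@eps k n F) tau (ig x, ih x, ie x) (ig y, ih y, ie y).
  exact: (@iota_mul k n F mu b0 K muK k0 S t I Z resF resK subS cmp
    F' ext_product ig ih ie rho ext_iota_sub ext_iotaK ext_mulE).
have := @big_tauM Q (carrier F) (carrier K) (pmul mu) (pmul muK) Z (@eps k n F)
  tau (pmul_bilinear muK) (cmp_mul cmp) (ig x, ih x, ie x) (ig y, ih y, ie y).
by rewrite -iE.
Qed.

End Extension.

(** * Renaming of variables *)

Section VariableChange.
Variables (k : fieldType) (n n' : nat) (f : 'I_n -> 'I_n').

Definition rename (p : {mpoly k[n]}) : {mpoly k[n']} :=
  comp_mpoly [tuple ('X_(f i) : {mpoly k[n']}) | i < n] p.

HB.instance Definition _ := GRing.RMorphism.copy rename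
  (comp_mpoly [tuple ('X_(f i) : {mpoly k[n']}) | i < n]).

Definition rename_mnm (m : 'X_{1..n}) : 'X_{1..n'} := (\sum_(i < n) U_(f i) *+ m i)%MM.

Lemma renameX m : rename 'X_[m] = 'X_[rename_mnm m].
Proof.
rewrite /rename comp_mpolyX /rename_mnm -mprodXnE; apply: eq_bigr => i _.
by rewrite tnth_mktuple.
Qed.

Lemma renameZ (c : k) p : rename (c *: p) = c *: rename p.
Proof. exact: comp_mpolyZ. Qed.

Lemma rename_mnmE m j : rename_mnm m j = (\sum_(i | f i == j) m i)%N.
Proof.
rewrite /rename_mnm mnm_sumE [RHS]big_mkcond; apply: eq_bigr => i _.
by rewrite mulmnE mnm1E; case: eqP => _; rewrite ?mul1n ?mul0n.
Qed.

Lemma rename_mnm0 : rename_mnm 0 = 0%MM.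
Proof. by apply/mnmP=> j; rewrite rename_mnmE mnm0E big1 // => i _; rewrite mnm0E. Qed.

Lemma rename_mnmD m1 m2 : rename_mnm (m1 + m2) = (rename_mnm m1 + rename_mnm m2)%MM.
Proof.
apply/mnmP=> j; rewrite mnmDE !rename_mnmE -big_split; apply: eq_bigr => i _.
by rewrite mnmDE.
Qed.

Lemma rename_mnmU i : rename_mnm U_(i) = U_(f i)%MM.
Proof.
apply/mnmP=> j; rewrite rename_mnmE mnm1E.
under eq_bigr do rewrite mnm1E.
have [fij|fij] := eqVneq (f i) j.
  rewrite (bigD1 i) ?fij ?eqxx //= big1 // => i' /andP[_ /negPf].
  by rewrite eq_sym => ->.
rewrite big1 // => i' fi'; case: eqP => // ii'; by rewrite ii' fi' in fij.
Qed.

(** A renaming, even one that identifies variables, turns no nonconstant monomial into a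
    constant. *)
Lemma rename_coef0 p : (rename p)@_0%MM = p@_0%MM.
Proof.
rewrite (mpolyE p) [rename _]raddf_sum !raddf_sum; apply: eq_bigr => m _ /=.
rewrite renameZ renameX !mcoeffZ !mcoeffX; congr (_ * (nat_of_bool _)%:R).
apply/eqP/eqP => [/mnmP m0|->]; last exact: rename_mnm0.
apply/mnmP=> i; apply/eqP; rewrite mnm0E -leqn0.
by have := m0 (f i); rewrite rename_mnmE mnm0E (bigD1 i) //= => <-; apply: leq_addr.
Qed.

Variable A : {set 'I_n}.
Hypothesis f_inj : {in A &, injective f}.
Definition mnm_on (m : 'X_{1..n}) := forall i, i \notin A -> m i = 0%N.

Lemma rename_mnm_f m i : mnm_on m -> i \in A -> rename_mnm m (f i) = m i.
Proof.
move=> mA iA; rewrite rename_mnmE (bigD1 i) ?eqxx //= big1 ?addn0 // => i' /andP[/eqP fi' ii'].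
by apply: mA; apply: contra ii' => i'A; apply/eqP; apply: f_inj.
Qed.

Lemma rename_mnm_out m j : mnm_on m -> j \notin f @: A -> rename_mnm m j = 0%N.
Proof.
move=> mA jA; rewrite rename_mnmE big1 // => i /eqP fi; apply: mA.
by apply: contra jA => iA; rewrite -fi imset_f.
Qed.

(** The right adjoint of [rename_mnm] for divisibility, on monomials in the variables of A: the
    largest such monomial whose renaming divides d. *)
Definition restrict_mnm (d : 'X_{1..n'}) : 'X_{1..n} := [multinom if i \in A then d (f i) else 0 | i < n].

Lemma rename_mnm_le m d : mnm_on m -> (rename_mnm m <= d)%MM = (m <= restrict_mnm d)%MM.
Proof.
move=> mA; apply/mnm_lepP/mnm_lepP => H i.
  rewrite mnmE; have [iA|iA] := boolP (i \in A); last by rewrite mA.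
  by rewrite -(rename_mnm_f mA iA).
have [/imsetP[i' i'A ->]|iA] := boolP (i \in f @: A); last by rewrite rename_mnm_out.
by rewrite rename_mnm_f //; have := H i'; rewrite mnmE i'A.
Qed.

End VariableChange.

(** * Strands of multigraded complexes *)

Section Strands.
Variables (k : fieldType) (B : finType) (c : B -> B -> k).

(** A multihomogeneous matrix amounts to a matrix c of scalars and a list of multidegrees, each
    entry having at most one monomial. Renaming variables changes the multidegrees but keeps c. The
    second clause makes the truncated subtraction of exponents an honest one. *)
Definition homog_entries n (mdg : B -> 'X_{1..n}) (D : B -> B -> {mpoly k[n]}) : Prop :=
  (forall b b', D b b' = c b b' *: 'X_[mdg b - mdg b']) /\
  (forall b b', c b b' != 0 -> (mdg b' <= mdg b)%MM).

(* Moves the part of multidegree d of a vector to multidegree d'. *)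
Definition strand n n' (mdg : B -> 'X_{1..n}) (mdg' : B -> 'X_{1..n'}) d d'
    (x : B -> {mpoly k[n]}) (b : B) : {mpoly k[n']} :=
  if (mdg b <= d)%MM then (x b)@_(d - mdg b) *: 'X_[d' - mdg' b] else 0.

(** The part of multidegree d is the complex of vector spaces on the b with [mdg b] dividing d, with
    matrix c. It depends on the grading through this set of b alone, so it can be moved to any other
    grading, over another ring, that selects the same set. *)
Lemma strand_diff n n' (mdg : B -> 'X_{1..n}) (mdg' : B -> 'X_{1..n'}) D D' d d' x b' :
  homog_entries mdg D -> homog_entries mdg' D' ->
  (forall b, (mdg b <= d)%MM = (mdg' b <= d')%MM) ->
  strand mdg mdg' d d' (fun b' => \sum_b x b * D b b') b' =
  \sum_b strand mdg mdg' d d' x b * D' b b'.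
Proof.
move=> [DE cD] [DE' cD'] dd'; rewrite /strand.
have [b'd|b'd] := boolP (mdg b' <= d)%MM; last first.
  rewrite big1 // => b _; have [bd|_] := boolP (mdg b <= d)%MM; last by rewrite mul0r.
  rewrite DE'; have [->|/cD bb'] := eqVneq (c b b') 0; first by rewrite scale0r mulr0.
  by rewrite (lepm_trans bb' bd) in b'd.
rewrite raddf_sum /= scaler_suml; apply: eq_bigr => b _.
rewrite DE DE'; have [->|cbb'] := eqVneq (c b b') 0.
  by rewrite !scale0r !mulr0 mcoeff0 scale0r.
have bb' := cD _ _ cbb'; have bb'2 := cD' _ _ cbb'.
rewrite -scalerAr mcoeffZ mcoeffMXE.
have -> : (mdg b - mdg b' <= d - mdg b')%MM = (mdg b <= d)%MM.
  apply/mnm_lepP/mnm_lepP => H i; have := H i; rewrite !mnmBE.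
    by move/mnm_lepP: bb' => /(_ i); move/mnm_lepP: b'd => /(_ i) h1 h2; rewrite leq_sub2rE.
  by move=> h; apply: leq_sub2r.
have [bd|bd] := boolP (mdg b <= d)%MM; last by rewrite mulr0 scale0r mul0r.
have -> : (d - mdg b' - (mdg b - mdg b'))%MM = (d - mdg b)%MM.
  apply/mnmP=> i; rewrite !mnmBE subnBA; last by move/mnm_lepP: bb'.
  by rewrite subnK //; move/mnm_lepP: b'd.
rewrite -scalerAl -scalerAr scalerA mulrC -mpolyXD; congr (_ *: mpolyX _ _).
apply/mnmP=> i; rewrite mnmDE !mnmBE addnBA; last by move/mnm_lepP: bb'2.
by rewrite subnK //; have := bd; rewrite dd' => /mnm_lepP.
Qed.

Lemma strandK n n' (mdg : B -> 'X_{1..n}) (mdg' : B -> 'X_{1..n'}) d d' x b :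
  (forall b, (mdg b <= d)%MM = (mdg' b <= d')%MM) ->
  strand mdg' mdg d' d (strand mdg mdg' d d' x) b = strand mdg mdg d d x b.
Proof.
move=> dd'; rewrite /strand -dd'; have [bd|bd] := boolP (mdg b <= d)%MM => //.
by rewrite mcoeffZ mcoeffX eqxx mulr1.
Qed.

(** The list r collects the multidegrees of all terms of all coordinates, each of them once so that
    no term is counted twice. *)
Lemma strand_sum n (mdg : B -> 'X_{1..n}) (x : B -> {mpoly k[n]}) :
  exists r : seq 'X_{1..n}, forall b, x b = \sum_(d <- r) strand mdg mdg d d x b.
Proof.
pose r := undup (flatten [seq [seq (m + mdg b)%MM | m <- msupp (x b)] | b <- enum B]).
exists r => b; apply/mpolyP=> m; rewrite raddf_sum /=.
transitivity (\sum_(d <- r | d == (m + mdg b)%MM) (x b)@_m).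
  have [dr|dr] := boolP (m + mdg b \in r)%MM.
    by rewrite -big_filter (filter_pred1_uniq (undup_uniq _) dr) big_seq1.
  rewrite big1_seq => [|d /andP[/eqP-> ]]; last by rewrite (negPf dr).
  apply/memN_msupp_eq0; apply: contra dr => mx; rewrite mem_undup.
  apply/flattenP; exists [seq (m + mdg b)%MM | m <- msupp (x b)]; last exact: map_f.
  by apply/mapP; exists b; rewrite ?mem_enum.
rewrite big_mkcond; apply: eq_bigr => d _; rewrite /strand.
have [->|dm] := eqVneq d (m + mdg b)%MM.
  by rewrite lem_addl addmK mcoeffZ mcoeffX eqxx mulr1.
have [bd|bd] := boolP (mdg b <= d)%MM; last by rewrite mcoeff0.
rewrite mcoeffZ mcoeffX; case: eqP => [e|_]; last by rewrite mulr0.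
by rewrite -e submK // eqxx in dm.
Qed.

End Strands.

Lemma multigraded_entries (k : fieldType) n (F : free_complex k n) : multigraded F ->
  homog_entries (fun b b' : fbasis F => (diff_basis b b' : {mpoly k[n]})@_(mdg b - mdg b'))
    (@mdg k n F) (fun b b' => diff_basis b b').
Proof.
move=> Fm; split=> b b'.
  apply/mpolyP=> m; rewrite mcoeffZ mcoeffX; case: eqP => [->|em]; first by rewrite mulr1.
  rewrite mulr0; apply/memN_msupp_eq0/negP => /Fm e; case: em.
  by rewrite -e addmK.
by rewrite -mcoeff_msupp => /Fm <-; apply: lem_addl.
Qed.

Lemma entries_multigraded (k : fieldType) n (F : free_complex k n) c :
  homog_entries c (@mdg k n F) (fun b b' => diff_basis b b') -> multigraded F.
Proof.
move=> [DE cD] b b' m; rewrite DE; have [->|cbb] := eqVneq (c b b') 0.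
  by rewrite scale0r msupp0.
by rewrite msuppMCX // inE => /eqP->; rewrite submK // cD.
Qed.

(** * Base change along a renaming of variables *)

Section BaseChange.
Variables (k : fieldType) (n n' : nat) (f : 'I_n -> 'I_n').
Variables (F : free_complex k n) (mu : product F) (b0 : fbasis F).
Local Notation Q := {mpoly k[n]}.
Local Notation Q' := {mpoly k[n']}.
Local Notation phi := (@rename k n n' f).

Definition bc_complex : free_complex k n' :=
  @FreeComplex k n' (fbasis F) (@hdeg k n F) (fun b => rename_mnm f (mdg b))
    (fun b => [ffun b' => phi (diff_basis b b')]).

Local Notation F' := bc_complex.

Definition bc_map (x : carrier F) : carrier F' := [ffun b => phi (x b)].

Definition bc_product : product F' :=
  @Product k n' F' (fun b b' => bc_map (mul_basis mu b b')) (bc_map (unit_elt mu)).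

Lemma bc_mapE x b : bc_map x b = phi (x b) :> Q'.
Proof. by rewrite ffunE. Qed.

Lemma bc_map_sum (T : Type) (r : seq T) (a : T -> Q) (x : T -> carrier F) :
  bc_map (\sum_(i <- r) a i *: x i) = \sum_(i <- r) phi (a i) *: bc_map (x i).
Proof.
apply/ffunP=> b; rewrite bc_mapE !sum_ffunE rmorph_sum; apply: eq_bigr => i _.
by rewrite !carrierZE bc_mapE rmorphM.
Qed.

Lemma bc_mapZ (a : Q) x : bc_map (a *: x) = phi a *: bc_map x.
Proof. by apply/ffunP=> b; rewrite bc_mapE !carrierZE bc_mapE rmorphM. Qed.

Lemma bc_mapD x y : bc_map (x + y) = bc_map x + bc_map y.
Proof. by apply/ffunP=> b; rewrite bc_mapE !carrierDE !bc_mapE rmorphD. Qed.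

Lemma bc_map0 : bc_map 0 = 0.
Proof. by apply/ffunP=> b; rewrite bc_mapE !carrier0E rmorph0. Qed.

Lemma bc_map_bvec (b : fbasis F) : bc_map (bvec b) = @bvec k n' F' b.
Proof. by apply/ffunP=> b'; rewrite bc_mapE !bvecE rmorph_nat. Qed.

Lemma bc_diff x : bc_map (differential x) = differential (bc_map x).
Proof.
rewrite diffE bc_map_sum [RHS]diffE; apply: eq_bigr => b _; rewrite bc_mapE.
by congr (_ *: _); apply/ffunP=> b'; rewrite !ffunE.
Qed.

Lemma bc_mul x y : bc_map (pmul mu x y) = pmul bc_product (bc_map x) (bc_map y).
Proof.
rewrite !pmulE; transitivity (\sum_b \sum_b' bc_map (((x b : Q) * (y b' : Q)) *: mul_basis mu b b')).
  rewrite -[X in bc_map X](eq_bigr _ (fun b _ => scale1r _)) bc_map_sum.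
  apply: eq_bigr => b _; rewrite rmorph1 scale1r bc_map_sum.
  by apply: eq_bigr => b' _; rewrite bc_mapZ.
by apply: eq_bigr => b _; apply: eq_bigr => b' _; rewrite bc_mapZ !bc_mapE rmorphM.
Qed.

Lemma bc_homogeneous p x : homogeneous p x -> homogeneous p (bc_map x).
Proof.
by move=> hx b; rewrite bc_mapE => H; apply: hx; apply: contraNneq H => ->; rewrite rmorph0.
Qed.

Hypothesis H : dga mu b0.

Lemma bc_dga : @dga k n' F' bc_product b0.
Proof.
have dd : forall x, differential (differential x) = 0 := (dga_chain H).2.
split.
- exact: dga_deg0 H.
- by rewrite /= (dga_unit H) bc_map_bvec.
- split=> [b b'|].
    rewrite ffunE => Hb; apply: (dga_chain H).1; apply: contraNneq Hb => ->.
    by rewrite rmorph0.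
  apply: (@linear_eq_basis _ _ F' (carrier F')) => [a y y'|a y y'|b].
  + by rewrite !diffP.
  + by rewrite scaler0; exact: esym (addr0 _).
  by rewrite -bc_map_bvec -!bc_diff dd bc_map0.
- apply: associative_basis => a b c.
  by rewrite -!bc_map_bvec -!bc_mul -!pmul_bvec (dga_mulA H).
- apply: (@linear_eq_basis _ _ F' (carrier F')) => [a y y'|//|b]; first exact: pmulPr.
  by rewrite -!bc_map_bvec -bc_mul (dga_mul1 H).
- apply: (@linear_eq_basis _ _ F' (carrier F')) => [a y y'|//|b]; first exact: pmulPl.
  by rewrite -!bc_map_bvec -bc_mul (dga_mulr1 H).
- move=> b b' c; rewrite bc_mapE => Hc; apply: (dga_hdeg H).
  by apply: contraNneq Hc => ->; rewrite rmorph0.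
- apply: leibniz_basis => b b'.
  rewrite -[diff_basis b](@diff_bvec _ _ F') -[diff_basis b'](@diff_bvec _ _ F').
  rewrite -!bc_map_bvec -!bc_diff -!bc_mul -pmul_bvec (dga_leibniz H) bc_mapD.
  rewrite eps_bvec pmulZl bc_mapZ.
  by rewrite rmorphXn rmorphN1.
- by move=> b b'; rewrite /= (dga_comm H) bc_mapZ rmorphXn rmorphN1.
by move=> b ob; rewrite /= (dga_sq H) // bc_map0.
Qed.

Variable I : Q -> Prop.
Hypothesis resF : resolves I mu b0.
Variable A : {set 'I_n}.
Hypothesis f_inj : {in A &, injective f}.
Hypothesis mdgA : forall b : fbasis F, mnm_on A (mdg b).

Let c (b b' : fbasis F) : k := (diff_basis b b' : Q)@_(mdg b - mdg b').

Lemma bc_entries : homog_entries c (@mdg k n' F') (fun b b' => diff_basis (f := F') b b').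
Proof.
have [DE cD] := multigraded_entries (mm_multigraded (res_mm resF)).
split=> b b' /=.
  rewrite ffunE [X in phi X]DE renameZ renameX -/(c b b').
  have [->|/cD bb'] := eqVneq (c b b') 0; first by rewrite !scale0r.
  by congr (_ *: mpolyX _ _); rewrite -{2}(submK bb') rename_mnmD addmK.
by move=> /cD bb'; rewrite -(submK bb') rename_mnmD; apply: lem_addl.
Qed.

(** The strand of multidegree d of the renamed complex is the strand of F of multidegree
    [restrict_mnm f A d]: the same basis vectors are selected, by adjunction, and the scalars c are
    the same. A cycle is cut into strands; each is moved to F, bounded there, and its bounding
    element is moved back. *)
Lemma bc_exact p (x : carrier F') : homogeneous p.+1 x -> differential x = 0 ->
  exists y : carrier F', homogeneous p.+2 y /\ differential y = x.
Proof.
move=> xp dx; have [r xr] := strand_sum (@mdg k n' F') x.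
have E := multigraded_entries (mm_multigraded (res_mm resF)).
have E' := bc_entries.
have S d : exists y : carrier F', homogeneous p.+2 y /\
    forall b, differential y b = strand (@mdg k n' F') (@mdg k n' F') d d x b.
  pose d0 := restrict_mnm f A d.
  have dd' (b : fbasis F) : (mdg b <= d0)%MM = (@mdg k n' F' b <= d)%MM.
    by rewrite /= (rename_mnm_le f_inj) //; apply: mdgA.
  have d'd (b : fbasis F) : (@mdg k n' F' b <= d)%MM = (mdg b <= d0)%MM by rewrite dd'.
  pose x0 : carrier F := [ffun b => strand (@mdg k n' F') (@mdg k n F) d d0 x b].
  have x0p : homogeneous p.+1 x0.
    move=> b; rewrite ffunE => Hb; apply: (xp b); apply: contraNneq Hb => xb.
    by rewrite /strand xb mcoeff0 scale0r; case: ifP.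
  have dx0 : differential x0 = 0.
    apply/ffunP=> b'; rewrite carrier0E diffE sum_ffunE.
    transitivity (\sum_b strand (@mdg k n' F') (@mdg k n F) d d0 x b *
                    (diff_basis (f := F) b b' : Q)).
      by apply: eq_bigr => b _; rewrite carrierZE ffunE.
    rewrite -(strand_diff x b' E' E d'd) /strand.
    have -> : \sum_b x b * (diff_basis (f := F') b b' : Q') = differential x b' :> Q'.
      by rewrite diffE sum_ffunE; apply: eq_bigr => b _; rewrite carrierZE.
    by rewrite dx carrier0E mcoeff0 scale0r; case: ifP.
  have [y0 [y0p dy0]] := res_exact resF x0p dx0.
  exists [ffun b => strand (@mdg k n F) (@mdg k n' F') d0 d y0 b]; split.
    move=> b; rewrite ffunE => Hb; apply: (y0p b); apply: contraNneq Hb => yb.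
    by rewrite /strand yb mcoeff0 scale0r; case: ifP.
  move=> b'; rewrite diffE sum_ffunE.
  transitivity (\sum_b strand (@mdg k n F) (@mdg k n' F') d0 d y0 b *
                  (diff_basis (f := F') b b' : Q')).
    by apply: eq_bigr => b _; rewrite carrierZE ffunE.
  rewrite -(strand_diff y0 b' E E' dd') -(strandK x b' d'd).
  rewrite {1}/strand [RHS]/strand.
  have -> : \sum_b (y0 b : Q) * (diff_basis b b' : Q) = x0 b'.
    rewrite -dy0 diffE sum_ffunE; apply: eq_bigr => b _; exact/esym/carrierZE.
  by rewrite [x0 b']ffunE.
have [y [yp dy]] : exists y : carrier F', homogeneous p.+2 y /\
    forall b, differential y b = \sum_(d <- r) strand (@mdg k n' F') (@mdg k n' F') d d x b.
  elim: r {xr} => [|d r [y [yp dy]]].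
    exists 0; split=> [|b]; first exact: homogeneous0.
    by rewrite diff0 carrier0E big_nil.
  have [y' [yp' dy']] := S d.
  exists (y' + y); split=> [|b]; first exact: homogeneousD.
  rewrite diffD carrierDE dy dy' big_cons; exact: erefl.
by exists y; split=> //; apply/ffunP=> b; rewrite dy -xr.
Qed.

Variable I' : Q' -> Prop.
Hypothesis idI' : ideal_closed I'.
Hypothesis I_sub : forall q, I q -> I' (phi q).
Hypothesis I'_min : forall P : Q' -> Prop, ideal_closed P -> (forall q, I q -> P (phi q)) ->
  forall q, I' q -> P q.

(** The hypotheses on [I'] characterize it as the ideal generated by the image of I. Conversely, a
    boundary of degree 0 is a combination of images of boundaries of basis vectors of F of degree 1,
    and these have their coefficients in I. *)
Lemma bc_resolves : @resolves k n' I' F' bc_product b0.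
Proof.
split; [split| exact: bc_exact |].
- exact: bc_dga.
- exact: (@entries_multigraded k n' F' c bc_entries).
- by move=> b b'; rewrite /= ffunE rename_coef0 (mm_minimal (res_mm resF)).
- by rewrite /= (mm_mdg0 (res_mm resF)) rename_mnm0.
have mapb0 (a : Q) : bc_map (a *: bvec b0) = phi a *: @bvec k n' F' b0.
  by rewrite bc_mapZ bc_map_bvec.
move=> q; split.
  move: q; apply: I'_min => [|q /(res_ideal resF)[y [y1 dy]]]; last first.
    exists (bc_map y); split; first exact: bc_homogeneous.
    by rewrite -bc_diff dy mapb0.
  split=> [|q q' [y [y1 dy]] [y' [y1' dy']]|a q [y [y1 dy]]].
  - by exists 0; rewrite diff0 scale0r; split; first exact: homogeneous0.
  - exists (y + y'); split; first exact: homogeneousD.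
    by rewrite diffD dy dy' scalerDl.
  exists (a *: y); split; first exact: homogeneousZ.
  by rewrite diffZ dy scalerA.
move=> [y [y1 dy]].
have -> : q = differential y b0 by rewrite dy carrierZE bvecE eqxx mulr1.
rewrite diffE sum_ffunE; apply: ideal_closed_sum => // b; rewrite carrierZE.
case: idI' => I0 _ IM; have [->|yb] := eqVneq (y b) 0; first by rewrite mul0r.
apply: IM; rewrite /= ffunE; apply/I_sub/(res_ideal resF).
exists (@bvec k n F b); split; first by rewrite -(y1 b yb); apply: (@homogeneous_bvec _ _ F).
rewrite diff_bvec; apply: (homogeneous0E H); rewrite -diff_bvec.
apply: (diff_homogeneous (dga_chain H)); rewrite -(y1 b yb).
exact: (@homogeneous_bvec _ _ F).
Qed.

End BaseChange.

(** * The Koszul algebra as target of comparison maps *)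

Section KoszulTarget.
Variables (k : fieldType) (n : nat) (E : finType) (lt : rel E) (x : E -> 'I_n).
Hypotheses (hlt : strict_total_order lt) (x_inj : injective x).
Local Notation Q := {mpoly k[n]}.
Let mon (v : E) : 'X_{1..n} := U_(x v)%MM.
Local Notation K := (taylor k lt mon).
Local Notation muK := (taylor_product k lt mon).

Lemma koszul_diff_entry (U W : {set E}) :
  (diff_basis (f := K) U W : Q) =
  \sum_(u in U | W == U :\ u) (-1) ^+ sgn_elt lt u U * 'X_(x u).
Proof.
rewrite (koszul_diff_basis _ _ x_inj) sum_ffunE [RHS]big_mkcondr; apply: eq_bigr => u _.
rewrite carrierZE bvecE; have [_|_] := boolP (W == U :\ u); first by rewrite mulr1.
by rewrite mulr0.
Qed.

Lemma koszul_mm : @multigraded_minimal k n K muK set0.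
Proof.
split.
- exact: koszul_dga hlt x_inj.
- move=> U W m.
  rewrite koszul_diff_entry mcoeff_msupp => H.
  have /existsP[u /and3P[uU /eqP-> ]] : [exists u, [&& u \in U, (W : {set E}) == U :\ u &
      m == U_(x u)%MM]].
    apply: contraNT H => /existsPn H; rewrite raddf_sum big1 //= => u /andP[uU WU].
    have := H u; rewrite uU WU /= => mu.
    rewrite -signr_odd; case: (odd _); rewrite ?expr1 ?mulN1r ?mcoeffN ?expr0 ?mul1r;
      by rewrite mcoeffX eq_sym (negPf mu) ?oppr0.
  move/eqP->; apply/mnmP=> i; rewrite mnmDE !(mlcm_varE x) mnm1E.
  have [<-|xui] := eqVneq (x u) i.
    rewrite (imset_f x uU); case: imsetP => // -[v]; rewrite !inE => /andP[/eqP vu _ /x_inj uv].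
    by case: vu.
  rewrite add0n; congr (nat_of_bool _); apply/imsetP/imsetP => -[v].
    by rewrite !inE => /andP[_ vU] ->; exists v.
  move=> vU iv; exists v => //; rewrite !inE vU andbT; apply: contraNneq xui => <-.
  exact/eqP.
- move=> U W; rewrite koszul_diff_entry raddf_sum big1 //= => u _.
  rewrite -signr_odd; case: (odd _); rewrite ?expr1 ?mulN1r ?mcoeffN ?expr0 ?mul1r;
    by rewrite mcoeffX mnm1_eq0 ?oppr0.
by apply/mnmP=> i; rewrite (mlcm_varE x) imset0 inE mnm0E.
Qed.

Lemma koszul_subcomplex (A : {set E}) :
  @exact_subcomplex k n K muK (fun W : {set E} => W \subset A).
Proof.
split.
- exact: supported_mul.
- exact: (supported_diff x_inj).
exact: koszul_exact.
Qed.

End KoszulTarget.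

(** * Functoriality of the Koszul algebra *)

Section KoszulMap.
Variables (k : fieldType) (n n' : nat) (f : 'I_n -> 'I_n').
Variables (E E' : finType) (lt : rel E) (lt' : rel E') (x : E -> 'I_n) (x' : E' -> 'I_n').
Variable g : E -> E'.
Hypotheses (x_inj : injective x) (x'_inj : injective x') (g_inj : injective g).
Hypothesis fx : forall v, f (x v) = x' (g v).
Hypothesis ltg : forall u v, lt' (g u) (g v) = lt u v.
Local Notation Q := {mpoly k[n]}.
Local Notation phi := (@rename k n n' f).
Let mon (v : E) : 'X_{1..n} := U_(x v)%MM.
Let mon' (v : E') : 'X_{1..n'} := U_(x' v)%MM.
Local Notation K := (taylor k lt mon).
Local Notation K' := (taylor k lt' mon').
Local Notation muK := (taylor_product k lt mon).
Local Notation muK' := (taylor_product k lt' mon').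

(** Semilinear over the renaming phi, hence not a [lin_ext]. It respects the signs because g
    preserves the orders. *)
Definition koszul_map (y : carrier K) : carrier K' :=
  \sum_(W : {set E}) phi (y W) *: @bvec k n' K' (g @: W).

Lemma koszul_mapD y y' : koszul_map (y + y') = koszul_map y + koszul_map y'.
Proof.
rewrite /koszul_map -big_split; apply: eq_bigr => W _.
by rewrite carrierDE rmorphD scalerDl.
Qed.

Lemma koszul_mapZ (a : Q) y : koszul_map (a *: y) = phi a *: koszul_map y.
Proof.
rewrite /koszul_map scaler_sumr; apply: eq_bigr => W _.
by rewrite carrierZE rmorphM scalerA.
Qed.

Lemma koszul_map0 : koszul_map 0 = 0.
Proof. by rewrite /koszul_map big1 // => W _; rewrite carrier0E rmorph0 scale0r. Qed.

Lemma koszul_map_sum (T : Type) (r : seq T) (P : pred T) (y : T -> carrier K) :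
  koszul_map (\sum_(i <- r | P i) y i) = \sum_(i <- r | P i) koszul_map (y i).
Proof. exact: (big_morph koszul_map koszul_mapD koszul_map0). Qed.

Lemma koszul_map_bvec (W : {set E}) : koszul_map (@bvec k n K W) = @bvec k n' K' (g @: W).
Proof.
rewrite /koszul_map (bigD1 W) // bvecE eqxx rmorph1 scale1r big1 => [|U /negPf UW].
  exact: addr0.
by rewrite bvecE UW rmorph0 scale0r.
Qed.

Lemma sgn_elt_map u (U : {set E}) : sgn_elt lt' (g u) (g @: U) = sgn_elt lt u U.
Proof.
rewrite !sgn_eltE big_imset /=; last by move=> ? ? _ _; apply: g_inj.
by apply: eq_bigr => v _; rewrite ltg.
Qed.

Lemma sgn_sets_map (U W : {set E}) : sgn_sets lt' (g @: U) (g @: W) = sgn_sets lt U W.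
Proof.
rewrite !sgn_setsE big_imset /=; last by move=> ? ? _ _; apply: g_inj.
apply: eq_bigr => u _; rewrite big_imset /=; last by move=> ? ? _ _; apply: g_inj.
by apply: eq_bigr => w _; rewrite ltg.
Qed.

Let imsetD1_inj u (W : {set E}) : g @: (W :\ u) = (g @: W) :\ g u.
Proof.
apply/setP=> v; rewrite !inE; apply/imsetP/andP => [[w]|[vu /imsetP[w wW vw]]].
  by rewrite !inE => /andP[wu wW] ->; rewrite (inj_eq g_inj) wu imset_f.
by exists w => //; rewrite !inE wW andbT -(inj_eq g_inj) -vw.
Qed.

Lemma koszul_map_diff y : koszul_map (differential y) = differential (koszul_map y).
Proof.
rewrite (carrier_expand y) [differential (\sum_(_ | _) _)]linear_sum !koszul_map_sum.
rewrite [differential (\sum_(_ | _) _)]linear_sum; apply: eq_bigr => W _ /=.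
rewrite diffZ !koszul_mapZ diffZ koszul_map_bvec !diff_bvec; congr (_ *: _).
rewrite (koszul_diff_basis _ _ x_inj) (koszul_diff_basis _ _ x'_inj) koszul_map_sum.
rewrite big_imset /=; last by move=> ? ? _ _; apply: g_inj.
apply: eq_bigr => u uW; rewrite koszul_mapZ koszul_map_bvec sgn_elt_map.
rewrite rmorphM rmorphXn rmorphN1 /= renameX rename_mnmU fx.
by rewrite imsetD1_inj.
Qed.

Lemma koszul_map_mul y y' : koszul_map (pmul muK y y') = pmul muK' (koszul_map y) (koszul_map y').
Proof.
rewrite pmulE koszul_map_sum {2}/koszul_map.
rewrite (big_morph (fun u => pmul muK' u _) (fun u v => pmulDl _ u v _) (pmul0l _ _)).
apply: eq_bigr => U _; rewrite koszul_map_sum pmulZl pmul_sumr scaler_sumr.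
apply: eq_bigr => W _; rewrite koszul_mapZ pmulZr scalerA rmorphM; congr (_ *: _).
rewrite pmul_bvec (koszul_mul_basis _ _ x_inj) (koszul_mul_basis _ _ x'_inj) sgn_sets_map.
have -> : [disjoint g @: U & g @: W] = [disjoint U & W].
  rewrite -!setI_eq0 -imsetI ?imset_eq0 // => ? ? _ _; exact: g_inj.
have [d|d] := boolP [disjoint U & W]; last exact: koszul_map0.
by rewrite koszul_mapZ koszul_map_bvec rmorphXn rmorphN1 imsetU.
Qed.

End KoszulMap.

(** * Putting the given resolution into based form *)

Section MinimalResolutions.
Variables (k : fieldType) (n : nat) (F : free_complex k n) (mu : product F).
Local Notation Q := {mpoly k[n]}.

(** The degree 0 part is free on the unit u and also on the basis vectors of degree 0. With no such
    vector, u would be 0 and multiples of u would not determine their factor. With two, b0 and b,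
    both would be multiples of u; u has a nonzero coefficient at b0, so the factor for b would be
    0. *)
Lemma dg_algebra_deg0 : dg_algebra mu ->
  exists b0 : fbasis F, forall b, (hdeg b == 0%N) = (b == b0).
Proof.
case=> _ [_ _ _ _ [u0 uP]]; set u := unit_elt mu in u0 uP.
have [b0 hb0] : exists b0 : fbasis F, hdeg b0 == 0%N.
  apply/existsP; apply: contraT => /existsPn Hb.
  have u_eq0 : u = 0.
    by apply/ffunP=> b; rewrite carrier0E (homogeneous_eq0 u0).
  have [a [_ aU]] := uP 0 (homogeneous0 0).
  have a0 : a = 0 by apply: aU; rewrite u_eq0 scaler0.
  have a1 : a = 1 by apply: aU; rewrite u_eq0 scaler0.
  by move: (oner_neq0 Q); rewrite -a1 a0 eqxx.
exists b0 => b; apply/idP/eqP => [hb|->]; last by [].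
have coef (b' : fbasis F) : hdeg b' == 0%N ->
    exists a : Q, forall c, (c == b')%:R = a * (u c : Q).
  move=> /eqP hb'; have hb'0 : homogeneous 0 (bvec b').
    by rewrite -[0%N]hb'; apply: homogeneous_bvec.
  have [a [ea _]] := uP _ hb'0; exists a => c.
  by rewrite -carrierZE -ea bvecE.
have [a0 e0] := coef _ hb0; have [a e] := coef _ hb.
apply/eqP/negPn/negP => bb0.
have ub0 : u b0 != 0.
  apply: contraNneq (oner_neq0 Q) => ub0.
  by have H1 := e0 b0; rewrite eqxx ub0 mulr0 in H1; apply/eqP; exact: H1.
have H0 := e b0; rewrite eq_sym (negPf bb0) in H0.
move/esym/eqP: H0; rewrite mulf_eq0 (negPf ub0) orbF => /eqP a_eq0.
have H1 := e b; rewrite eqxx a_eq0 mul0r in H1.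
by case/eqP: (oner_neq0 Q); exact: H1.
Qed.

Variable b0 : fbasis F.

Lemma dg_algebra_dga : dg_algebra mu -> strictly_commutative mu ->
  (forall b, (hdeg b == 0%N) = (b == b0)) -> unit_elt mu = bvec b0 -> dga mu b0.
Proof.
move=> [cF [mA [m1 mr1] mh ml _]] [mC msq] hb0 u0; rewrite u0 in m1 mr1.
split=> //.
- move=> b b' c; rewrite -pmul_bvec.
  by apply: mh; apply: homogeneous_bvec.
- apply: leibniz_basis => b b'.
  by rewrite -pmul_bvec (ml (hdeg b)) ?diff_bvec //; apply: homogeneous_bvec.
- by move=> b b'; rewrite -!pmul_bvec; apply: mC; apply: homogeneous_bvec.
by move=> b ob; rewrite -pmul_bvec; apply: msq ob _; apply: homogeneous_bvec.
Qed.

(** As b0 has multidegree 0, the augmentation sends it to a scalar c. If c is invertible, q c lies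
    in I exactly when q does. If c = 0, surjectivity puts 1 in I, and both sides hold for every
    q. *)
Lemma minimal_resolves (I : Q -> Prop) : ideal_closed I -> minimal_free_resolution F I ->
  dga mu b0 -> mdg b0 = 0%MM -> resolves I mu b0.
Proof.
move=> idI [[_ Fm Fex [aug [augm [x1 [x1h Ix1]] augP]]] Fmin] H mdg0.
split; [split=> // | exact: Fex |].
  by move=> b b'; apply/irrelevant_idealP/Fmin.
have hq (q : Q) : homogeneous 0 (q *: bvec b0) by apply/homogeneousZ/homogeneous_b0/H.
have [c augb0] : exists c : k, aug (bvec b0) = c%:MP.
  exists (aug (bvec b0) : Q)@_0%MM; apply/mpolyP=> m; rewrite mcoeffC.
  have [->|m0] := eqVneq m 0%MM; first by rewrite mulr1.
  rewrite mulr0; apply/memN_msupp_eq0/negP => /augm mE.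
  by case/eqP: m0; rewrite mE ?mdg0 //; apply/eqP; rewrite (dga_deg0 H).
have augq (q : Q) : aug (q *: bvec b0) = q * c%:MP by rewrite linearZ augb0.
have [_ ID IM] := idI.
move=> q; have <- := augP _ (hq q); rewrite augq.
have [c0|c0] := eqVneq c 0.
  have I1 : I 1.
    rewrite -[1]opprK -mulN1r; apply: IM.
    move: Ix1; rewrite (homogeneous0E H x1h) augq c0 mpolyC0 mulr0 sub0r.
    by [].
  by split=> _; rewrite -[X in I X]mulr1; apply: IM.
split=> [Iq|]; first by rewrite mulrC; apply: IM.
move/(IM (c^-1)%:MP); rewrite mulrCA -mpolyCM mulVf // mpolyC1 mulr1.
by [].
Qed.

End MinimalResolutions.

Lemma resolves_equiv (k : fieldType) n (F : free_complex k n) (mu : product F) b0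
    (I I' : {mpoly k[n]} -> Prop) :
  (forall q, I q <-> I' q) -> resolves I mu b0 -> resolves I' mu b0.
Proof.
move=> II' [Hm Hex HI]; split=> // q; split; first by move/II'/HI.
by move/HI/II'.
Qed.

Lemma comparison_subset (k : fieldType) n (F K : free_complex k n) (mu : product F)
    (muK : product K) b0 k0 (S S' : pred (fbasis K)) t :
  (forall W, S W -> S' W) -> comparison mu b0 muK k0 S t -> comparison mu b0 muK k0 S' t.
Proof. by move=> SS' [? ? tS ? ? ? ?]; split=> // b W /tS; apply: SS'. Qed.

(** * Sources of finite acyclic digraphs *)

Lemma cycle_of_function (T : finType) (f : T -> T) (w0 : T) (P : pred T) :
  P w0 -> (forall w, P w -> P (f w)) ->
  exists c : seq T, [/\ c != [::], all P c & cycle (frel f) c].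
Proof.
move=> Pw0 Pf; have := looping_order f w0; case/trajectP=> i ilt ei.
have Pi m : P (iter m f w0) by elim: m => //= m; apply: Pf.
set w1 := iter i f w0 in ei; exists (traject f w1 (order f w0 - i)).
have n0 : (0 < order f w0 - i)%N by rewrite subn_gt0.
have e1 : iter (order f w0 - i) f w1 = w1 by rewrite /w1 -iterD subnK ?ei // ltnW.
case: (order f w0 - i)%N n0 e1 => // m _ e1; split=> //.
  by apply/allP => w /trajectP[j _ ->]; rewrite /w1 -iterD.
rewrite [traject _ _ _]/= /= -[X in rcons _ X]e1 iterSr -trajectSr.
exact: fpath_traject.
Qed.

(** Otherwise every element of P has a predecessor in P; iterating a choice of predecessors in a
    finite set closes up into an oriented cycle. *)
Lemma acyclic_source (V : choiceType) (T : finType) (D : rel V) (a : T -> V) (P : pred T)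
    (w0 : T) : acyclic_digraph D -> P w0 ->
  exists2 w, P w & forall w', P w' -> ~~ D (a w') (a w).
Proof.
move=> acD Pw0; have [/exists_inP[w Pw /forall_inP Dw]|] :=
  boolP [exists w in P, [forall w' in P, ~~ D (a w') (a w)]]; first by exists w.
move/exists_inPn => H.
pose f w := odflt w [pick w' | P w' && D (a w') (a w)].
have fP w : P w -> P (f w) && D (a (f w)) (a w).
  move=> Pw; rewrite /f; case: pickP => [//|noP].
  have /forall_inPn[w' Pw' /negPn Dw'] := H _ Pw.
  by have := noP w'; rewrite Dw' andbT; rewrite unfold_in in Pw'; rewrite Pw'.
have [c [c0 Pc fc]] := @cycle_of_function _ f w0 P Pw0 (fun w Pw => proj1 (andP (fP w Pw))).
(* Predecessors run against the arrows, so the list is reversed to give a cycle of D. *)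
case/eqP: c0; apply/nilP; rewrite /nilp -size_rev -(size_map a); apply/nilP/acD.
rewrite cycle_map rev_cycle; apply: sub_in_cycle Pc fc => w w' Pw _ /eqP <-.
by case/andP: (fP w Pw).
Qed.

(** * Edge monomials *)

Section Edges.
Variables (V : choiceType) (n : nat) (x : V -> 'I_n) (G : sgraph V).
Hypothesis x_inj : {in vertices G &, injective x}.

Lemma edge_vertex (e : {fset V}) v : e \in edges G -> v \in e -> v \in vertices G.
Proof. by move=> /(edges_wf) /andP[/fsubsetP eG _] /eG. Qed.

Lemma edge_monomialE (e : {fset V}) i : e \in edges G ->
  edge_monomial x e i = [exists v : e, x (val v) == i] :> nat.
Proof.
move=> eG; rewrite /edge_monomial mnm_sumE.
have [/existsP[v /eqP xv]|/existsPn H] := boolP [exists v : e, x (val v) == i].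
  rewrite (bigD1 v) //= mnm1E xv eqxx big1 // => u uv; rewrite mnm1E; case: eqP => // xu.
  case/eqP: uv; apply/val_inj/x_inj; rewrite ?xu ?xv //.
    exact: edge_vertex eG (valP u).
  exact: edge_vertex eG (valP v).
by rewrite big1 // => v _; rewrite mnm1E (negPf (H v)).
Qed.

Lemma edge_monomial_le1 (e : {fset V}) i : e \in edges G -> (edge_monomial x e i <= 1)%N.
Proof. by move=> eG; rewrite edge_monomialE //; case: [exists _, _]. Qed.

Lemma edge_monomial_vertex (e : {fset V}) v : e \in edges G -> v \in e ->
  edge_monomial x e (x v) = 1%N.
Proof.
move=> eG ve; rewrite edge_monomialE //.
by have -> : [exists u : e, x (val u) == x v] by apply/existsP; exists [` ve]%fset.
Qed.

End Edges.

(** * The comparison map at stage 0 *)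

Lemma mlcm_setE n (E : finType) (mon : E -> 'X_{1..n}) (W : {set E}) i :
  mlcm_set mon W i = (\max_(w in W) mon w i)%N.
Proof.
rewrite /mlcm_set; elim/big_rec2: _ => [|w m1 m2 _ <-]; first by rewrite mnm0E.
by rewrite mnmE.
Qed.

Section CoverMap.
Variables (V : choiceType) (n : nat) (x : V -> 'I_n) (G : sgraph V) (C : {fset V}).
Hypothesis x_inj : {in vertices G &, injective x}.
Variable chi : edges G -> C.
Hypothesis hchi : cover_map chi.

Lemma chi_vertex w : val (chi w) \in vertices G.
Proof. by apply: edge_vertex (valP w) _; apply: hchi. Qed.

Lemma max_chi_upsilon w i :
  maxn (chi_monomial x chi w i) (upsilon_monomial x chi w i) = edge_monomial x (val w) i.
Proof.
have w1 := edge_monomial_le1 x_inj i (valP w).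
have : (chi_monomial x chi w i <= edge_monomial x (val w) i)%N.
  rewrite /chi_monomial mnm1E; case: eqP => // <-.
  by rewrite (edge_monomial_vertex x_inj) //; apply: valP.
rewrite /upsilon_monomial mnmBE; move: w1; case: (edge_monomial _ _ i) => [|[|//]] _.
  by rewrite leqn0 => /eqP->.
by case: (chi_monomial _ _ _ i) => [|[|]].
Qed.

(** In the exponents this is (y / gcd(x, y)) x = lcm(x, y), together with w = lcm of its two
    endpoints, valid as w is squarefree. It makes tau^0 multihomogeneous. *)
Lemma y_lcmD_x_lcm (W : {set edges G}) :
  (y_lcm x chi W - d_gcd x chi W + x_lcm x chi W)%MM =
  mlcm_set (fun w => edge_monomial x (val w)) W.
Proof.
apply/mnmP=> i; rewrite mnmDE mnmBE mnmE.
have -> : mlcm_set (fun w => edge_monomial x (val w)) W i =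
    maxn (x_lcm x chi W i) (y_lcm x chi W i).
  rewrite !mlcm_setE -big_split; apply: eq_bigr => w _.
  by rewrite /= max_chi_upsilon.
move: (x_lcm _ _ _ i) (y_lcm _ _ _ i) => a b.
by case: (leqP a b) => [ab|/ltnW ab]; [rewrite subnK | rewrite subnn add0n].
Qed.

(** If y_W / d_W = 1, then y_W divides x_W. Take w in W such that no arrow leads to its cover vertex
    from the cover vertex of an edge of W. The other endpoint u of w divides y_W, hence x_W, so u is
    the cover vertex of an edge of W; but w gives an arrow from u to the cover vertex of w. *)
Lemma y_lcm_neq_gcd (W : {set edges G}) : acyclic_digraph (cover_digraph chi) -> W != set0 ->
  (y_lcm x chi W - d_gcd x chi W)%MM != 0%MM.
Proof.
move=> acD /set0Pn[w0 w0W].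
have [w wW nD] := @acyclic_source _ _ _ (fun w => val (chi w)) (mem W) _ acD w0W.
apply/eqP => /mnmP y0.
have yx i : (y_lcm x chi W i <= x_lcm x chi W i)%N.
  have := y0 i; rewrite mnmBE mnmE mnm0E => /eqP; rewrite subn_eq0 => /leq_trans; apply.
  exact: geq_minl.
have [u [uw uchi wu]] : exists u, [/\ u \in val w, u != val (chi w) &
    val w = [fset u; val (chi w)]%fset].
  have /andP[_] := edges_wf (valP w); rewrite (cardfsD1 (val (chi w))) hchi eqSS.
  case/cardfs1P=> u wu; exists u; have : u \in (val w `\ val (chi w))%fset by rewrite wu inE.
  rewrite !inE => /andP[uchi uw]; split=> //.
  by rewrite -(fsetD1K (hchi w)) wu fsetUC.
have uG := edge_vertex (valP w) uw.
have : (0 < y_lcm x chi W (x u))%N.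
  rewrite mlcm_setE (bigmax_sup w) // /upsilon_monomial mnmBE.
  rewrite (edge_monomial_vertex x_inj) //; last exact: valP.
  rewrite /chi_monomial mnm1E; case: eqP => // /x_inj xu; case/eqP: uchi.
  by rewrite xu // chi_vertex.
move/leq_trans/(_ (yx _)); rewrite (mlcm_varE (fun w => x (val (chi w)))) lt0b.
case/imsetP=> w' w'W /x_inj uw'; have := nD w' w'W; case/negP; apply/existsP; exists w.
by rewrite -uw' ?chi_vertex // -wu !eqxx.
Qed.

End CoverMap.

Section OrderExtension.
Variables (C T : finType) (lt : rel C) (g : C -> T).
Hypotheses (hlt : strict_total_order lt) (g_inj : injective g).

(** The image of g comes first, in the given order, and the remaining elements follow in the order
    of their enumeration. *)
Lemma extend_order : exists lt' : rel T,
  strict_total_order lt' /\ forall u v, lt' (g u) (g v) = lt u v.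
Proof.
pose h a := [pick u | g u == a].
have hg u : h (g u) = Some u.
  by rewrite /h; case: pickP => [v /eqP/g_inj->//|/(_ u)]; rewrite eqxx.
have hK a u : h a = Some u -> a = g u.
  by rewrite /h; case: pickP => // v /eqP<- [->].
pose lt' a b := match h a, h b with
  | Some u, Some v => lt u v
  | Some _, None => true
  | None, Some _ => false
  | None, None => (enum_rank a < enum_rank b)%N
  end.
exists lt'; split; last by move=> u v; rewrite /lt' !hg.
have [lti ltt ltc] := hlt; split.
- by move=> a; rewrite /lt'; case: (h a) => [u|]; rewrite ?lti ?ltnn.
- move=> b a c; rewrite /lt'; case: (h a) => [u|]; case: (h b) => [v|]; case: (h c) => [w|] //.
    exact: ltt.
  exact: ltn_trans.
move=> a b ab; rewrite /lt'; case ha: (h a) => [u|]; case hb: (h b) => [v|] //.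
  by apply: ltc; apply: contraNneq ab => uv; rewrite (hK _ _ ha) (hK _ _ hb) uv.
by rewrite -neq_ltn; apply: contraNneq ab => /val_inj/enum_rank_inj->.
Qed.

End OrderExtension.

(** * The base resolution over the ring of a later stage *)

Section Base.
Variables (k : fieldType) (V : choiceType) (G : sgraph V) (C : {fset V}).
Variables (n n' : nat) (x : V -> 'I_n) (x' : V -> 'I_n').
Hypotheses (x_inj : {in vertices G &, injective x}) (x'_inj : {in vertices G &, injective x'}).
Hypothesis CG : (C `<=` vertices G)%fset.
Variable f : 'I_n -> 'I_n'.
Hypothesis fx : {in vertices G, forall v, f (x v) = x' v}.
Local Notation Q := {mpoly k[n]}.
Local Notation Q' := {mpoly k[n']}.

Let A : {set 'I_n} := [set x (val v) | v : vertices G].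

Lemma base_f_inj : {in A &, injective f}.
Proof.
move=> _ _ /imsetP[u _ ->] /imsetP[v _ ->]; rewrite !fx ?(valP u) ?(valP v) //.
by move/x'_inj => ->; rewrite ?(valP u) ?(valP v).
Qed.

Lemma rename_edge (e : {fset V}) : e \in edges G ->
  rename_mnm f (edge_monomial x e) = edge_monomial x' e.
Proof.
move=> eG; rewrite /edge_monomial (big_morph _ (rename_mnmD f) (rename_mnm0 f)).
by apply: eq_bigr => v _; rewrite rename_mnmU fx // (edge_vertex eG (valP v)).
Qed.

Lemma base_ideal_sub (q : Q) : edge_ideal x G q -> edge_ideal x' G (rename f q).
Proof.
have [I0 ID IM] := ideal_gen_closed [seq ('X_[edge_monomial x' e] : Q') | e <- edges G].
move: q; apply: ideal_gen_min => [|_ /mapP[e eG ->]].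
  split=> [|p q Ip Iq|a p Ip]; first by rewrite rmorph0.
    by rewrite rmorphD; apply: ID.
  by rewrite rmorphM; apply: IM.
rewrite renameX rename_edge //; apply: ideal_gen_mem.
by apply/mapP; exists e.
Qed.

Lemma base_ideal_min (P : Q' -> Prop) : ideal_closed P ->
  (forall q : Q, edge_ideal x G q -> P (rename f q)) -> forall q : Q', edge_ideal x' G q -> P q.
Proof.
move=> idP HP; apply: ideal_gen_min => // _ /mapP[e eG ->].
rewrite -(rename_edge eG) -renameX; apply: HP; apply: ideal_gen_mem.
by apply/mapP; exists e.
Qed.

Variable chi : edges G -> C.
Hypothesis hchi : cover_map chi.
Hypothesis acD : acyclic_digraph (cover_digraph chi).
Variables (ltC : rel C) (lt' : rel 'I_n').
Hypothesis hlt' : strict_total_order lt'.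
Hypothesis lt'C : forall u v : C, lt' (x' (val u)) (x' (val v)) = ltC u v.

Variables (F : free_complex k n) (mu : product F).
Hypothesis resI : minimal_free_resolution F (@edge_ideal k n V x G).
Hypotheses (hmu : dg_algebra mu) (hmuc : strictly_commutative mu).
Variable s : fbasis F -> {set edges G}.
Hypothesis hsdeg : forall b, mdg b = mlcm_set (fun w => edge_monomial x (val w)) (s b).
Hypothesis htau : dg_morphism mu (koszul_product k x ltC) (tau x chi ltC s).

Local Notation K := (koszul k x ltC).
Local Notation K' := (taylor k lt' (fun v : 'I_n' => U_(v)%MM)).
Local Notation muK' := (taylor_product k lt' (fun v : 'I_n' => U_(v)%MM)).
Local Notation tau := (tau x chi ltC s).

Lemma tau_bvec b : tau (bvec b) = if #|chi @: s b| == #|s b| then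
  ('X_[y_lcm x chi (s b) - d_gcd x chi (s b)] : Q) *: @bvec k n K (chi @: s b) else 0.
Proof. exact: lin_ext_bvec. Qed.

Lemma tauZ (a : Q) y : tau (a *: y) = a *: tau y.
Proof. exact: linearZ. Qed.

Lemma tau_sum (T : Type) (r : seq T) (y : T -> carrier F) :
  tau (\sum_(i <- r) y i) = \sum_(i <- r) tau (y i).
Proof. exact: linear_sum. Qed.

(** Since tau^0 preserves units, the image of the degree 0 basis vector b0 must have a nonzero
    coefficient at the unit of the Koszul algebra. This forces s b0 to be empty, and then the unit
    of [mu] to be b0 itself. *)
Lemma base_unit : exists b0 : fbasis F,
  [/\ dga mu b0, s b0 = set0 & mdg b0 = 0%MM].
Proof.
have [b0 hb0] := dg_algebra_deg0 hmu; exists b0.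
have [_ [_ _ _ _ [u0 _]]] := hmu.
have uE : unit_elt mu = (unit_elt mu b0 : Q) *: bvec b0.
  rewrite [LHS]carrier_expand (bigD1 b0) // big1 => [|b bb0]; first exact: addr0.
  by rewrite (homogeneous_eq0 u0) ?scale0r // hb0.
have [_ _ _ _] := htau; rewrite uE tauZ tau_bvec => tau1.
have := congr1 (fun y : carrier K => y set0 : Q) tau1.
rewrite carrierZE [RHS]ffunE eqxx; have [cs|_] := boolP (#|chi @: s b0| == #|s b0|); last first.
  by rewrite ffunE mulr0 => /esym/eqP; rewrite oner_eq0.
rewrite carrierZE bvecE; have [/esym/eqP|_] := eqVneq; last first.
  by rewrite !mulr0 => /esym/eqP; rewrite oner_eq0.
rewrite imset_eq0 => /eqP s0; rewrite s0.
have m0 (mon : edges G -> 'X_{1..n}) : mlcm_set mon set0 = 0%MM by rewrite /mlcm_set big_set0.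
rewrite /y_lcm m0 sub0m mpolyX0 !mulr1 => u1.
split=> //; last by rewrite hsdeg s0 m0.
by apply: dg_algebra_dga => //; rewrite uE u1 scale1r.
Qed.

Let g (v : C) : 'I_n' := x' (val v).

Let CGv (v : C) : val v \in vertices G.
Proof. exact: (fsubsetP CG) (valP v). Qed.

Let g_inj : injective g.
Proof. by move=> u v /x'_inj uv; apply: val_inj; apply: uv; apply: CGv. Qed.

Let xC_inj : injective (fun v : C => x (val v)).
Proof. by move=> u v /x_inj uv; apply: val_inj; apply: uv; apply: CGv. Qed.

Local Notation J := (@koszul_map k n n' f C 'I_n' ltC lt' (fun v : C => x (val v)) id g).

Definition base_map (b : fbasis F) : carrier K' := J (tau (bvec b)).

Lemma base_mapE b : base_map b = if #|chi @: s b| == #|s b| then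
  ('X_[rename_mnm f (y_lcm x chi (s b) - d_gcd x chi (s b))] : Q') *:
     @bvec k n' K' (g @: (chi @: s b)) else 0.
Proof.
rewrite /base_map tau_bvec.
have [_|_] := boolP (#|chi @: s b| == #|s b|); last exact: koszul_map0.
by rewrite koszul_mapZ koszul_map_bvec renameX.
Qed.

Lemma base_map_ext y : @lin_ext k n' (bc_complex f F) K' base_map (bc_map f y) = J (tau y).
Proof.
rewrite (@linear_expand k n' (bc_complex f F) (carrier K') _
  (@lin_ext_is_linear k n' (bc_complex f F) K' base_map)) [in RHS](carrier_expand y) tau_sum koszul_map_sum.
apply: eq_bigr => b _; rewrite tauZ koszul_mapZ lin_ext_bvec.
by rewrite bc_mapE.
Qed.

Lemma base_mdg_on (b : fbasis F) : mnm_on A (mdg b).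
Proof.
move=> i iA; rewrite hsdeg mlcm_setE big1 // => w _.
rewrite (edge_monomialE x_inj _ (valP w)); case: existsP => // -[v /eqP xv].
case/negP: iA; rewrite -xv; apply/imsetP.
by exists [` edge_vertex (valP w) (valP v)]%fset.
Qed.

(** A dg morphism preserves degrees. Where tau^0 does not vanish, its value on b has a nonzero
    coefficient at the set of cover vertices of s b, whose size is therefore the degree of b. *)
Lemma base_map_support (b : fbasis F) (W : {set 'I_n'}) : base_map b W != 0 ->
  [/\ W = g @: (chi @: s b), #|W| = hdeg b &
    (base_map b W : Q') =
    'X_[rename_mnm f (y_lcm x chi (s b) - d_gcd x chi (s b))]].
Proof.
rewrite base_mapE; have [cs|_] := boolP (#|chi @: s b| == #|s b|); last first.
  by rewrite ffunE eqxx.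
rewrite carrierZE bvecE; have [-> _|_] := eqVneq W (g @: (chi @: s b)); last first.
  by rewrite mulr0 eqxx.
split=> //; last by rewrite mulr1.
rewrite card_imset //; have [_ tauh _ _ _] := htau.
apply: (tauh _ _ (@homogeneous_bvec _ _ F b) (chi @: s b)).
rewrite tau_bvec cs carrierZE bvecE eqxx mulr1.
apply: contraNneq (oner_neq0 k) => X0.
have := mcoeffX k (y_lcm x chi (s b) - d_gcd x chi (s b))%MM (y_lcm x chi (s b) - d_gcd x chi (s b))%MM.
by rewrite X0 mcoeff0 eqxx => /esym/eqP.
Qed.

Lemma base_comparison b0 : dga mu b0 -> s b0 = set0 ->
  @comparison k n' (bc_complex f F) (bc_product f mu) b0 K' muK' set0
    (fun W : {set 'I_n'} => W \subset [set x' (val c) | c : C]) base_map.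
Proof.
move=> H s0; have [_ tauh taud tauM _] := htau.
have idI : injective (id : 'I_n' -> 'I_n') by [].
have gfx (v : C) : f (x (val v)) = id (g v) by rewrite fx.
have supp0 b W (P : Prop) : (base_map b W != 0 -> P) -> (base_map b W = 0 -> P) -> P.
  by move=> P1 P0; have [/P0|/P1] := eqVneq (base_map b W) 0.
split.
- by move=> b W /base_map_support[_ cW _].
- move=> b W m; apply: (@supp0 b W) => [/base_map_support[-> _ E]|->]; last by rewrite msupp0.
  rewrite E msuppX inE => /eqP->.
  rewrite [mdg b]/= hsdeg -(y_lcmD_x_lcm x_inj hchi) rename_mnmD; congr (_ + _)%MM.
  apply/mnmP=> j; rewrite (mlcm_varE id) imset_id.
  have xA w : x (val (chi w)) \in A.
    apply/imsetP; exists [` chi_vertex hchi w]%fset => //.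
  have gx w : g (chi w) = f (x (val (chi w))) by rewrite fx // (chi_vertex hchi).
  have xonA : mnm_on A (x_lcm x chi (s b)).
    move=> i iA; rewrite (mlcm_varE (fun w => x (val (chi w)))).
    by case: imsetP => // -[w _ iw]; rewrite iw xA in iA.
  rewrite -imset_comp; have [/imsetP[i iA ->]|jA] := boolP (j \in f @: A).
    rewrite (rename_mnm_f base_f_inj xonA iA) (mlcm_varE (fun w => x (val (chi w)))).
    congr (nat_of_bool _); apply/imsetP/imsetP => -[w wW]; rewrite /= ?gx => e.
      by exists w => //; exact: (base_f_inj iA (xA w) e).
    by exists w => //=; rewrite gx e.
  rewrite (rename_mnm_out xonA jA); case: imsetP => // -[w _ /=]; rewrite gx => jw.
  by rewrite jw imset_f in jA.
- move=> b W /base_map_support[-> _ _]; apply/subsetP => _ /imsetP[c _ ->].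
  exact: imset_f.
- move=> b W bb0; apply: (@supp0 b W) => [/base_map_support[WE cW E]|->]; last exact: mcoeff0.
  rewrite E -renameX rename_coef0 mcoeffX (negPf (y_lcm_neq_gcd x_inj hchi acD _)) //.
  (* An empty s b would give an empty W, so b would have degree 0 and be b0. *)
  apply: contraNneq bb0 => sb0; rewrite -(dga_deg0 H) -cW WE sb0 !imset0.
  by rewrite cards0.
- rewrite base_mapE s0 !imset0 !cards0 eqxx /y_lcm {1}/mlcm_set big_set0 sub0m.
  by rewrite rename_mnm0 mpolyX0 scale1r.
- apply: (@linear_eq_basis _ _ (bc_complex f F) (carrier K')) => [a y y'|a y y'|b].
  + by rewrite diffP linearP.
  + by rewrite linearP diffP.
  (* Basis vectors come from the original ring, where tau^0 commutes with d; both changes of ring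
     commute with d as well. *)
  by rewrite -bc_map_bvec -bc_diff !base_map_ext taud -(koszul_map_diff xC_inj idI g_inj gfx lt'C).
apply: (@bilinear_eq_basis _ _ (bc_complex f F) (carrier K')) => [||b b'].
- split=> [u a y y'|y a u u']; first by rewrite pmulPl linearP.
  by rewrite pmulPr linearP.
- split=> [u a y y'|y a u u']; first by rewrite linearP pmulPl.
  by rewrite linearP pmulPr.
rewrite -!bc_map_bvec -bc_mul !base_map_ext tauM.
by rewrite -(koszul_map_mul f xC_inj idI g_inj lt'C).
Qed.

Lemma base_resolution : exists (F' : free_complex k n') (mu' : product F') b0 t,
  resolves (@edge_ideal k n' V x' G) mu' b0 /\
  @comparison k n' F' mu' b0 K' muK' set0
    (fun W : {set 'I_n'} => W \subset [set x' (val c) | c : C]) t.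
Proof.
have [b0 [H s0 mdg0]] := base_unit.
exists (bc_complex f F), (bc_product f mu), b0, base_map.
split; last exact: base_comparison.
have resF := minimal_resolves (ideal_gen_closed _) resI H mdg0.
apply: (bc_resolves H resF base_f_inj base_mdg_on (ideal_gen_closed _)).
  exact: base_ideal_sub.
exact: base_ideal_min.
Qed.

End Base.

(** * The inductive step *)

Section Step.
Variables (k : fieldType) (V : choiceType) (n : nat) (x : V -> 'I_n).
Variables (G G' : sgraph V) (C : {fset V}) (z : V).
Local Notation Q := {mpoly k[n]}.
Hypothesis x_inj : {in vertices G' &, injective x}.
Hypothesis GG' : (z |` vertices G `<=` vertices G')%fset.
Hypothesis zG : z \notin vertices G.
Hypothesis CG : (C `<=` vertices G)%fset.
Hypothesis eG' : edges G' = (edges G `|` [fset [fset z; c] | c in C])%fset.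
Variable lt : rel 'I_n.
Hypothesis hlt : strict_total_order lt.

Local Notation K := (taylor k lt (fun v : 'I_n => U_(v)%MM)).
Local Notation muK := (taylor_product k lt (fun v : 'I_n => U_(v)%MM)).
Let A : {set 'I_n} := [set x (val c) | c : C].
Let S : pred (fbasis K) := fun W : {set 'I_n} => W \subset A.

Lemma vertices_sub : {subset vertices G <= vertices G'}.
Proof. by move=> v vG; apply: (fsubsetP GG'); rewrite !inE vG orbT. Qed.

Lemma new_edge_monomial c : c \in C -> edge_monomial x [fset z; c]%fset = (U_(x z) + U_(x c))%MM.
Proof.
move=> cC; have zc : z != c by apply: contraNneq zG => ->; exact: (fsubsetP CG).
rewrite /edge_monomial -(big_seq_fsetE _ _ predT (fun v => U_(x v)%MM)).
by rewrite big_fsetU1 ?inE // big_seq_fset1.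
Qed.

Lemma new_variable_regular (q : Q) : edge_ideal x G ('X_(x z) * q) -> edge_ideal x G q.
Proof.
apply: (@monomial_ideal_regular _ _ (x z) _ [seq edge_monomial x e | e <- edges G]).
  by rewrite -map_comp.
move=> ? /mapP[e eG ->]; rewrite (@edge_monomialE _ _ x G) //; last first.
  by move=> u v uG vG; apply: x_inj; apply: vertices_sub.
case: existsP => // -[v /eqP xv]; case/negP: zG.
have vG := edge_vertex eG (valP v).
have zG' : z \in vertices G' by apply: (fsubsetP GG'); rewrite !inE eqxx.
by rewrite -(x_inj (vertices_sub vG) zG' xv).
Qed.

(** The boundaries of degree 1 elements of the Koszul algebra on the cover are the elements of the
    ideal of the cover variables, so the left side is I + z (C); its generators z x_c are the
    monomials of the new edges. *)
Lemma step_ideal (q : Q) :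
  @ext_ideal k n K set0 S (x z) (edge_ideal x G) q <-> edge_ideal x G' q.
Proof.
have [I0 ID IM] := ideal_gen_closed [seq ('X_[edge_monomial x e] : Q) | e <- edges G].
have idI' := ideal_gen_closed [seq ('X_[edge_monomial x e] : Q) | e <- edges G'].
have [I'0 I'D I'M] := idI'.
have K0 := @koszul_deg1 k n 'I_n lt id hlt (@inj_id 'I_n) A.
have d0 (e : carrier K) : homogeneous 1 e ->
    differential e = (differential e (set0 : {set 'I_n}) : Q) *: @bvec k n K set0.
  move=> e1; apply: (homogeneous0E (@koszul_dga k n 'I_n lt id hlt (@inj_id 'I_n))).
  exact: (diff_homogeneous (@koszul_chain k n 'I_n lt id hlt (@inj_id 'I_n))).
split=> [[q1 [e [Iq1 eS e1 ->]]]|].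
  apply: (I'D _ _).
    move: q1 Iq1; apply: ideal_gen_min => // _ /mapP[w wG ->].
    by apply: ideal_gen_mem; apply/mapP; exists w => //; rewrite eG' inE wG.
  have /K0 : exists f : carrier K, [/\ supported A f, homogeneous 1 f &
      differential f = (differential e (set0 : {set 'I_n}) : Q) *: @bvec k n K set0].
    by exists e; split=> //; apply: d0.
  move: (differential e _ : Q); apply: ideal_gen_min => [|_ /mapP[i iA ->]].
    split=> [|p p' Ip Ip'|a p Ip]; first by rewrite mulr0.
      by rewrite mulrDr; apply: I'D.
    by rewrite mulrCA; apply: I'M.
  move: iA; rewrite mem_enum => /imsetP[c _ ->].
  rewrite -mpolyXD -new_edge_monomial; last exact: valP.
  apply: ideal_gen_mem; apply/mapP; exists [fset z; val c]%fset => //.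
  rewrite eG' inE; apply/orP; right; apply/imfsetP; exists (val c) => //; exact: valP.
move: q; apply: ideal_gen_min => [|_ /mapP[w wG' ->]].
  split=> [|p p' [q1 [e [Iq eS e1 ->]]] [q1' [e' [Iq' eS' e1' ->]]]|a p [q1 [e [Iq eS e1 ->]]]].
  - exists 0, 0; rewrite diff0 carrier0E mulr0 addr0; split=> //; last exact: homogeneous0.
    by move=> W; rewrite carrier0E eqxx.
  - exists (q1 + q1'), (e + e'); rewrite diffD carrierDE mulrDr addrACA.
    by split=> //; [exact: ID | exact: supported_inD | exact: homogeneousD].
  exists (a * q1), (a *: e); rewrite diffZ carrierZE mulrCA -mulrDr.
  by split=> //; [exact: IM | exact: supported_inZ | exact: homogeneousZ].
move: wG'; rewrite eG' inE => /orP[wG|/imfsetP[c cC ->]].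
  exists 'X_[edge_monomial x w], 0; rewrite diff0 carrier0E mulr0 addr0; split=> //.
  - by apply: ideal_gen_mem; apply/mapP; exists w.
  - by move=> W; rewrite carrier0E eqxx.
  exact: homogeneous0.
(* The monomial z x_c is z times the boundary of the Koszul variable of c. *)
exists 0, (@bvec k n K [set x c]); rewrite new_edge_monomial // mpolyXD add0r.
split=> //.
- apply: supported_bvec; rewrite sub1set; apply/imsetP; by exists [` cC]%fset.
- by rewrite -[1%N](cards1 (x c)); apply: (@homogeneous_bvec _ _ K).
by rewrite (@koszul_diff_var k n 'I_n lt id hlt (@inj_id 'I_n)) carrierZE bvecE eqxx mulr1.
Qed.

End Step.

Lemma vertices_chain (V : choiceType) (G : nat -> sgraph V) (z : nat -> V) :
  (forall i, (z i.+1 |` vertices (G i) `<=` vertices (G i.+1))%fset) ->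
  forall i j, (i <= j)%N -> {subset vertices (G i) <= vertices (G j)}.
Proof.
move=> Gz i; elim=> [|j IH]; first by rewrite leqn0 => /eqP-> v.
rewrite leq_eqVlt => /orP[/eqP-> v //|ij v vG].
by apply: (fsubsetP (Gz j)); rewrite !inE IH ?orbT.
Qed.

Theorem theorem4p23
  (k : fieldType) (V : choiceType)
  (G : nat -> sgraph V) (C : nat -> {fset V}) (z : nat -> V)
  (hC : forall i, vertex_cover (G i) (C i))
  (h1 : vertices (G 0) != fset0)
  (h3 : forall i, (z i.+1 |` vertices (G i) `<=` vertices (G i.+1))%fset /\
                  z i.+1 \notin vertices (G i))
  (h4 : forall i, (C i `<=` C i.+1)%fset)
  (h5 : forall i, edges (G i.+1) =
          (edges (G i) `|` [fset [fset z i.+1; x] | x in C i])%fset)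
  (* the cover map of G^0, with D(G^0, C^0) acyclic, and the total orders *)
  (chi : edges (G 0) -> C 0) (hchi : cover_map chi)
  (h2 : acyclic_digraph (cover_digraph chi))
  (ltC : rel (C 0)) (ltE : rel (edges (G 0)))
  (hltC : strict_total_order ltC) (hltE : strict_total_order ltE)
  (hlt : forall w w', ltC (chi w) (chi w') -> ltE w w')
  (* for the graph G^i, Q is k[X_0, ..., X_(n i - 1)] *)
  (n : nat -> nat) (x : forall i, V -> 'I_(n i))
  (hx : forall i, {in vertices (G i) &, injective (x i)})
  (* the minimal free resolution G0 of Q / I(G^0), as a strictly commutative
     dg algebra identified with the quotient of the Taylor resolution by J,
     with a basis of images of certain g_W, W = s b *)
  (G0 : free_complex k (n 0)) (mu0 : product G0)
  (hG0 : minimal_free_resolution G0 (@edge_ideal k (n 0) V (x 0) (G 0)))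
  (hmu0 : dg_algebra mu0) (hmu0c : strictly_commutative mu0)
  (J : carrier (edge_taylor k (x 0) ltE) -> Prop)
  (hJ : dg_ideal (edge_taylor_product k (x 0) ltE) J)
  (pi0 : carrier (edge_taylor k (x 0) ltE) -> carrier G0)
  (hpi0 : dg_quotient_by (edge_taylor_product k (x 0) ltE) mu0 J pi0)
  (s : fbasis G0 -> {set edges (G 0)})
  (hs : forall b, pi0 (@bvec _ _ (edge_taylor k (x 0) ltE) (s b)) = bvec b)
  (* the multigrading of G0 is the one of the Taylor resolution *)
  (hsdeg : forall b, mdg b = mlcm_set (fun w => edge_monomial (x 0) (val w)) (s b))
  (htau : dg_morphism mu0 (koszul_product k (x 0) ltC) (tau (x 0) chi ltC s)) :
  forall i, exists (F : free_complex k (n i)) (mu : product F),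
    [/\ minimal_free_resolution F (@edge_ideal k (n i) V (x i) (G i)),
        dg_algebra mu & strictly_commutative mu].
Proof.
move=> i.
have Gij a b : (a <= b)%N -> {subset vertices (G a) <= vertices (G b)}.
  by apply: (@vertices_chain _ G z) => c; case: (h3 c).
have CG j : (C j `<=` vertices (G j))%fset by case: (hC j).
have xi_inj j : (j <= i)%N -> {in vertices (G j) &, injective (x i)}.
  by move=> ji u v uG vG; apply: hx; apply: Gij ji _ _.
have [v0 v0G] := fset0Pn _ h1.
(* Variables that are not vertices of G^0 are sent to the one of v0, an arbitrary choice: they do
   not occur in the multidegrees of the base resolution. *)
pose f a := odflt (x i v0)
  (omap (fun v : vertices (G 0) => x i (val v)) [pick v : vertices (G 0) | x 0 (val v) == a]).
have fx : {in vertices (G 0), forall v, f (x 0 v) = x i v}.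
  move=> v vG; rewrite /f; case: pickP => [u /eqP /= xu|/(_ [` vG]%fset)]; last by rewrite eqxx.
  by rewrite /= (hx 0 _ _ (valP u) vG xu).
(* The order on C^0 is carried to the variables of the ring of stage i and extended to all of them,
   so that one Koszul algebra serves all the covers. *)
have [lt [hlt' ltx]] := @extend_order _ _ ltC (fun c : C 0 => x i (val c)) hltC
  (fun u v uv => val_inj (xi_inj 0 (leq0n i) _ _ (fsubsetP (CG 0) _ (valP u))
     (fsubsetP (CG 0) _ (valP v)) uv)).
pose K := taylor k lt (fun v : 'I_(n i) => U_(v)%MM).
pose muK := taylor_product k lt (fun v : 'I_(n i) => U_(v)%MM).
pose A j : {set 'I_(n i)} := [set x i (val c) | c : C j].
pose S j : pred (fbasis K) := fun W : {set 'I_(n i)} => W \subset A j.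
(* The target stage i and its ring are fixed; the induction on j also builds the comparison map,
   always into the same K. *)
have step j : (j <= i)%N -> exists (F : free_complex k (n i)) (mu : product F) b0 t,
    resolves (@edge_ideal k (n i) V (x i) (G j)) mu b0 /\
    @comparison k (n i) F mu b0 K muK set0 (S j) t.
  elim: j => [_|j IH ji].
    exact: (@base_resolution k V (G 0) (C 0) (n 0) (n i) (x 0) (x i) (hx 0)
      (xi_inj 0 (leq0n i)) (CG 0) f fx chi hchi h2 ltC lt ltx G0 mu0 hG0 hmu0 hmu0c s hsdeg htau).
  have [F [mu [b0 [t [resF cmp]]]]] := IH (ltnW ji).
  have [GG zG] := h3 j.
  have idI := @inj_id 'I_(n i).
  have resK := @koszul_mm k (n i) 'I_(n i) lt id hlt' idI.
  have subS := @koszul_subcomplex k (n i) 'I_(n i) lt id hlt' idI (A j).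
  have zreg := @new_variable_regular k V (n i) (x i) (G j) (G j.+1) (z j.+1)
    (xi_inj j.+1 ji) GG zG.
  exists (@ext_complex k (n i) F b0 K set0 (S j) t (x i (z j.+1))).
  exists (@ext_product k (n i) F mu b0 K muK set0 (S j) t (x i (z j.+1))).
  exists (inl (inl b0)), (@ext_map k (n i) F b0 K set0 (S j) t (x i (z j.+1))).
  split.
    apply: resolves_equiv (ext_resolves resF resK subS cmp zreg) => q.
    exact: (@step_ideal k V (n i) (x i) (G j) (G j.+1) (C j) (z j.+1) zG (CG j) (h5 j)
      lt hlt' q).
  (* The new comparison map still takes its values on the cover of stage j; as the covers increase,
     the next subcomplex contains them. *)
  suff SS W : S j W -> S j.+1 W by exact: (comparison_subset SS (ext_comparison (x i (z j.+1)) resF resK subS cmp)).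
  move/subset_trans; apply; apply/subsetP => _ /imsetP[c _ ->]; apply/imsetP.
  by exists [` fsubsetP (h4 j) _ (valP c)]%fset.
have [F [mu [b0 [t [resF _]]]]] := step i (leqnn i).
by exists F, mu; apply: resolves_minimal resF.
Qed.
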